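(* Let $X=\mathcal{S}(\mathbb{R}^n)$ or $X=\mathcal{V}(\mathbb{R}^n)$, let $T:X\to X$ be a rearrangement, and let $\Phi$ be a Young function. If $T$ is smoothing and $f\in X$ is Lipschitz, then $Tf$ coincides with a Lipschitz function $\mathcal{H}^n$-almost everywhere on $\mathbb{R}^n$, and $$\int_{\{x:\,Tf(x)\geq a\}}\Phi\left(\|\nabla Tf(x)\|\right)\,dx\leq \int_{\{x:\,f(x)\geq a\}}\Phi\left(\|\nabla f(x)\|\right)\,dx$$ for each $a>\operatorname{ess\,inf} f$. Hence $$\int_{\mathbb{R}^n}\Phi\left(\|\nabla Tf(x)\|\right)\,dx\leq \int_{\mathbb{R}^n}\Phi\left(\|\nabla f(x)\|\right)\,dx,$$ where the integrals may be infinite.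
   Context: Throughout $n\ge 2$, $\mathcal{H}^n$ is $n$-dimensional Hausdorff (Lebesgue) measure in $\mathbb{R}^n$, $\|\cdot\|$ is the Euclidean norm, and $B^n$ is the closed unit ball. ''Essentially'' means up to a set of $\mathcal{H}^n$-measure zero. $\mathcal{M}^n$ is the class of measurable subsets of $\mathbb{R}^n$ and $\mathcal{L}^n$ the class of measurable sets of finite measure. $\mathcal{S}(\mathbb{R}^n)$ is the set of real-valued measurable functions $f$ on $\mathbb{R}^n$ with $\mathcal{H}^n(\{x:f(x)>t\})<\infty$ for all $t>\operatorname{ess\,inf} f$; $\mathcal{V}(\mathbb{R}^n)$ is the set of nonnegative real-valued measurable functions $f$ with $\mathcal{H}^n(\{x:f(x)>t\})<\infty$ for all $t>0$. A rearrangement $T:X\to X$ is a map that is equimeasurable, i.e. $\mathcal{H}^n(\{x:Tf(x)>t\})=\mathcal{H}^n(\{x:f(x)>t\})$ for all $t\in\mathbb{R}$ and $f\in X$, and monotonic, i.e. for $f,g\in X$, $f\le g$ essentially implies $Tf\le Tg$ essentially. For $A\in\mathcal{M}^n$, $A^*$ denotes the set of Lebesgue density points of $A$ (points of $\mathbb{R}^n$ where $A$ has density $1$). For $A\in\mathcal{L}^n$ put $\diamondsuit_TA=\{x:T1_A(x)=1\}$ and $\diamondsuit_T^*A=(\diamondsuit_TA)^*$. $T$ is smoothing if for each $d>0$ and each bounded $A\in\mathcal{M}^n$, $(\diamondsuit_T^*A)+dB^n\subset\diamondsuit_T^*(A+dB^n)$, essentially (Minkowski sums). A Young function is a left-continuous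 convex function $\Phi:[0,\infty)\to[0,\infty]$ with $\Phi(0)=0$. $\nabla Tf$ is the weak gradient of $Tf$, equivalently the a.e. gradient of the Lipschitz function with which $Tf$ coincides a.e. *)

(* Defs.v *)
From HB Require Import structures.
From mathcomp Require Import all_boot all_order all_algebra.
From mathcomp Require Import all_classical all_reals all_analysis.
From mathcomp Require Import ess_sup_inf.

Set Implicit Arguments.
Unset Strict Implicit.
Unset Printing Implicit Defensive.

Import Order.TTheory GRing.Theory Num.Theory.
Import numFieldNormedType.Exports.

Local Open Scope classical_set_scope.
Local Open Scope ring_scope.

Section lebesgue_outer_measure_rV.
Context (R : realType) (n : nat).
Implicit Types (c : 'rV[R]_n * 'rV[R]_n) (A : set 'rV[R]_n).

Definition box c : set 'rV[R]_n :=
  [set x | forall i, c.1 0 i < x 0 i <= c.2 0 i].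

Definition box_volume c : R := \prod_(i < n) Num.max 0 (c.2 0 i - c.1 0 i).

Definition box_cover A : set (set ('rV[R]_n * 'rV[R]_n)) :=
  [set C | countable C /\ A `<=` \bigcup_(c in C) box c].

Definition lebesgue_outer_measure A : \bar R :=
  ereal_inf [set \esum_(c in C) (box_volume c)%:E | C in box_cover A].

Local Open Scope ereal_scope.

Let box_volume_ge0 c : 0 <= (box_volume c)%:E.
Proof.
by rewrite lee_fin; apply: prodr_ge0 => i _; rewrite le_max lexx.
Qed.

Let outer0 : lebesgue_outer_measure set0 = 0.
Proof.
apply/eqP; rewrite eq_le; apply/andP; split.
  by apply: ereal_inf_lbound; exists set0; [split|rewrite esum_set0].
by apply: le_ereal_inf_tmp => _ [C _ <-]; exact: esum_ge0.
Qed.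

Let outer_ge0 A : 0 <= lebesgue_outer_measure A.
Proof. by apply: le_ereal_inf_tmp => _ [C _ <-]; exact: esum_ge0. Qed.

Let le_outer : {homo lebesgue_outer_measure : A B / A `<=` B >-> A <= B}.
Proof.
move=> A B AB; apply/ereal_inf_le_tmp => _ [C [cC BC] <-].
by exists C => //; split => //; exact: subset_trans BC.
Qed.

Let outer_sigma_subadditive : sigma_subadditive lebesgue_outer_measure.
Proof.
move=> A; have [[i ioo]|] := pselect (exists i, lebesgue_outer_measure (A i) = +oo).
  rewrite (eseries_pinfty _ _ ioo) ?leey// => k _.
  by rewrite -ltNye (lt_le_trans _ (outer_ge0 _)).
rewrite -forallNE => Aoo.
apply/lee_addgt0Pr => e e0.
apply: (le_trans _ (epsilon_trick _ _ (ltW e0))); last by move=> k; exact: outer_ge0.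
have /choice[G PG] : forall k, exists C, box_cover (A k) C /\
    \esum_(c in C) (box_volume c)%:E <=
    lebesgue_outer_measure (A k) + (e / (2 ^ k.+1)%:R)%:E.
  move=> k.
  have ek : (0 < e / (2 ^ k.+1)%:R)%R by rewrite divr_gt0// ltr0n expn_gt0.
  have fk : lebesgue_outer_measure (A k) \is a fin_num.
    by rewrite ge0_fin_numE// ltey; exact/eqP/Aoo.
  have [_ [C AC <-] /ltW HC] := lb_ereal_inf_adherent ek fk.
  by exists C.
apply: (@le_trans _ _ (\sum_(k <oo) \esum_(c in G k) (box_volume c)%:E)); last first.
  by apply: lee_nneseries => k *; [exact: esum_ge0|exact: (PG k).2].
apply: (@le_trans _ _ (\esum_(c in \bigcup_k G k) (box_volume c)%:E)).
  apply: ereal_inf_lbound; exists (\bigcup_k G k) => //; split.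
    by apply: bigcup_countable => // k _; exact: (PG k).1.1.
  move=> x [k _ /((PG k).1.2)[c Gc xc]].
  by exists c => //; exists k.
rewrite seqDU_bigcup_eq esum_bigcupT; [|exact: trivIset_seqDU|by []].
rewrite -nneseries_esumT; last by move=> k; exact: esum_ge0.
apply: lee_nneseries => k *; first exact: esum_ge0.
apply: ereal_sup_le => _ [F [fF FS] <-]; exists F => //.
by split => //; apply: subset_trans FS _; exact: subDsetl.
Qed.

HB.instance Definition _ := isOuterMeasure.Build R 'rV[R]_n
  lebesgue_outer_measure outer0 outer_ge0 le_outer outer_sigma_subadditive.

End lebesgue_outer_measure_rV.
Arguments lebesgue_outer_measure : clear implicits.

(* Measurability on 'rV[R]_n is Lebesgue measurability, i.e. Caratheodory
   measurability for the Lebesgue outer measure; it is not generated by the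
   Borel sets. *)
Section lebesgue_measure_rV.
Context (R : realType) (n : nat).
Let mu : {outer_measure set 'rV[R]_n -> \bar R} := lebesgue_outer_measure R n.

HB.instance Definition _ := @isMeasurable.Build (caratheodory_display mu)
  'rV[R]_n mu.-caratheodory (caratheodory_measurable_set0 mu)
  (@caratheodory_measurable_setC _ _ mu) (@caratheodory_measurable_bigcup _ _ mu).

Definition lebesgue_measure_rV : set 'rV[R]_n -> \bar R :=
  lebesgue_outer_measure R n.

HB.instance Definition _ := isMeasure.Build _ 'rV[R]_n R lebesgue_measure_rV
  (outer_measure0 mu) (outer_measure_ge0 mu)
  (@caratheodory_measure_sigma_additive _ _ mu).

End lebesgue_measure_rV.
Arguments lebesgue_measure_rV {R n}.

Section euclidean_space.
Context {R : realType} {n : nat}.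
Implicit Types (x y v : 'rV[R]_n) (f : 'rV[R]_n -> R) (A B : set 'rV[R]_n).

(* The library's norm on 'rV[R]_n is the supremum norm. *)
Definition enorm v : R := Num.sqrt (\sum_(i < n) v 0 i ^+ 2).

Definition eball x (r : R) : set 'rV[R]_n := [set y | enorm (y - x) <= r].

Definition minkowski_sum A B : set 'rV[R]_n := [set x + y | x in A & y in B].

Definition dilate (d : R) A : set 'rV[R]_n := [set d *: x | x in A].

Definition parallel_set A (d : R) : set 'rV[R]_n :=
  minkowski_sum A (dilate d (eball 0 1)).

Definition elipschitz f : Prop :=
  exists L : R, forall x y, `|f x - f y| <= L * enorm (x - y).

Definition gradient f x : 'rV[R]_n := \row_(i < n) 'D_(delta_mx 0 i) f x.

Definition ess_subset A B : Prop := lebesgue_measure_rV.-negligible (A `\` B).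

Definition density_points A : set 'rV[R]_n :=
  [set x | fine (lebesgue_measure_rV (A `&` eball x r)) /
           fine (lebesgue_measure_rV (eball x r)) @[r --> 0^'+] --> (1 : R)].

End euclidean_space.

Section rearrangements.
Context {R : realType} {n : nat}.
Implicit Types (f g : 'rV[R]_n -> R) (X : set ('rV[R]_n -> R))
  (T : ('rV[R]_n -> R) -> 'rV[R]_n -> R).

Definition ess_inf_rV f : \bar R := ess_inf lebesgue_measure_rV (EFin \o f).

Definition spaceS : set ('rV[R]_n -> R) :=
  [set f : 'rV[R]_n -> R | measurable_fun setT f /\
    forall t : R, (ess_inf_rV f < t%:E)%E ->
      (lebesgue_measure_rV [set x | t < f x]%R < +oo)%E].

Definition spaceV : set ('rV[R]_n -> R) :=
  [set f : 'rV[R]_n -> R | [/\ measurable_fun setT f, forall x, 0 <= f x &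
    forall t : R, 0 < t -> (lebesgue_measure_rV [set x | t < f x]%R < +oo)%E]].

Definition equimeasurable X T : Prop := forall f, X f -> forall t : R,
  lebesgue_measure_rV [set x | t < T f x] = lebesgue_measure_rV [set x | t < f x].

Definition monotonic X T : Prop := forall f g, X f -> X g ->
  (\forall x \ae lebesgue_measure_rV, f x <= g x) ->
  (\forall x \ae lebesgue_measure_rV, T f x <= T g x).

(* A map X -> X is a map on all functions that preserves X; its values
   outside X are irrelevant. *)
Definition rearrangement X T : Prop :=
  [/\ forall f, X f -> X (T f), equimeasurable X T & monotonic X T].

Definition diamond T (A : set 'rV[R]_n) : set 'rV[R]_n :=
  [set x | T \1_A x = 1].

Definition diamond_star T (A : set 'rV[R]_n) : set 'rV[R]_n :=
  density_points (diamond T A).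

Definition smoothing T : Prop :=
  forall (d : R) (A : set 'rV[R]_n), 0 < d -> measurable A -> bounded_set A ->
  ess_subset (parallel_set (diamond_star T A) d)
             (diamond_star T (parallel_set A d)).

End rearrangements.

(* Only the values of Phi on [0, +oo[ matter. *)
Definition young_function {R : realType} (Phi : R -> \bar R) : Prop :=
  [/\ forall t : R, 0 <= t -> (0 <= Phi t)%E,
      Phi 0 = 0%E,
      forall s t l : R, 0 <= s -> 0 <= t -> 0 <= l <= 1 ->
        (Phi (l * s + (1 - l) * t)%R <= l%:E * Phi s + (1 - l)%:E * Phi t)%E &
      forall t : R, 0 < t -> Phi s @[s --> t^'-] --> Phi t].

(* Main.v *)
(* T acts on superlevel sets: up to null sets {T f > t} is the image D U_t of
   U_t = {f > t} under a set rearrangement D which preserves measure and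
   inclusions. When f is L-Lipschitz, U_(t + L h) + h B is contained in U_t, so by
   smoothing the density points of D U_t are nested in the same way and define a
   Lipschitz representative g of T f.

   Smoothing also bounds the measure of ({g > t + c} + h B) \ {g > t} by that of
   ({f > t + c} + h B) \ {f > t}, because D preserves the measure of larger sets
   and of smaller ones. Integrating over t >= a gives an inequality between the
   integrals of (g^h - c - max(a, g))^+ and (f^h - c - max(a, f))^+, where f^h is the
   supremum of f over balls of radius h. With c replaced by c h, division by h and
   h -> 0 turn these integrands into (|grad| - c)^+ on {>= a}, since a Lipschitz
   function is differentiable almost everywhere (Rademacher). A Young function is a
   limit from below of combinations of the hinges t |-> (t - c)^+ with coefficients
   in [0, +oo], so Fatou's lemma yields the inequality on {>= a}. For the whole
   space let a decrease to ess inf f: the gradient of g vanishes where g attains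
   this value, which is then its minimum. *)
From HB Require Import structures.
Require Import Defs.
From mathcomp Require Import all_boot all_order all_algebra.
From mathcomp Require Import all_classical all_reals all_analysis.
From mathcomp Require Import measurable_realfun ess_sup_inf.
From mathcomp Require Import ring lra.

Set Implicit Arguments.
Unset Strict Implicit.
Unset Printing Implicit Defensive.

Import Order.TTheory GRing.Theory Num.Theory.
Import numFieldNormedType.Exports.

Local Open Scope classical_set_scope.
Local Open Scope ring_scope.

(** * Lebesgue measure *)

(** Smoothing holds only essentially and only for bounded sets. Boundedness comes from the Lipschitz
    condition: above [ess_inf_rV f] a superlevel set has finite measure, yet contains a cube of
    fixed size around each point of a slightly higher one. Null sets are removed by passing to
    density points, between which essential inclusions become true ones. The density theorem behind
    this is proved from covers by boxes and a Vitali selection; it serves again in Rademacher's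
    theorem, where almost every point of a set sees no proportionally large holes in it, and this
    gives the additivity of directional derivatives.

    The shift [c] is what produces all hinges: with [c = 0] alone only the integrals of the norm of
    the gradient would be compared. The Euclidean norm appears because smoothing uses Euclidean
    balls: the supremum of [f] over such a ball grows at the rate [enorm (gradient f x)].

    The restriction to heights [t >= a > ess inf f] keeps the integrands bounded by a Lipschitz
    constant and supported in a set of finite measure, so that dominated convergence applies to [f]
    and to [g] alike. *)

Section box_measure.
Context (R : realType) (n : nat).
Implicit Types (c : 'rV[R]_n * 'rV[R]_n) (x y v : 'rV[R]_n) (A B : set 'rV[R]_n).
Local Notation mu := (@lebesgue_measure_rV R n).

Lemma box_volume_ge0 c : 0 <= box_volume c.
Proof. by apply: prodr_ge0 => i _; rewrite le_max lexx. Qed.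

Lemma outer_measure_lt_cover (n_gt0 : (0 < n)%N) A (z : \bar R) :
  (mu A < z)%E -> exists b : nat -> 'rV[R]_n * 'rV[R]_n,
    A `<=` \bigcup_j box (b j) /\ (\sum_(0 <= j <oo) (box_volume (b j))%:E < z)%E.
Proof.
move=> /ereal_inf_lt[_ [C [/countable_bijP[B CB] AC] <-] Cz].
have [e eBC] : exists e, set_bij B C e by apply/card_set_bijP; rewrite card_eq_sym.
(* The indices outside [B] receive this empty box; its volume is [0] because the product has at
   least one factor. *)
have vol0 : box_volume (0, 0 : 'rV[R]_n) = 0.
  by rewrite /box_volume (bigD1 (Ordinal n_gt0))//= mxE subrr maxxx mul0r.
exists (fun j => if j \in B then e j else (0, 0)); split.
  move=> x /AC[c Cc xc]; have [_ _ /(_ _ Cc)[j Bj ejc]] := eBC.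
  by exists j => //; rewrite mem_set// ejc.
apply: le_lt_trans Cz; rewrite nneseries_esumT; last first.
  by move=> j; rewrite lee_fin box_volume_ge0.
rewrite (reindex_esum _ _ _ _ eBC) [leRHS]esum_mkcond.
by apply: le_esum => j _; case: ifPn => // _; rewrite vol0.
Qed.

(* The first k edges of the box are measured, the others only tested for
   containing the coordinate of x: integrating the inequality between such
   products over the coordinate k, one coordinate after the other, passes from
   the inclusion of a box in a union to the inequality of volumes. *)
Let part k c x : R := \prod_(i < n) (if (i < k)%N then Num.max 0 (c.2 0 i - c.1 0 i)
  else \1_(`]c.1 0 i, c.2 0 i]) (x 0 i)).

Let upd k x (t : R) : 'rV[R]_n := \row_i (if i == k then t else x 0 i).

Let part_ge0 k c x : 0 <= part k c x.
Proof. by apply: prodr_ge0 => i _; case: ifP => // _; rewrite le_max lexx. Qed.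

Let part_upd (k : 'I_n) c x : {K : R | 0 <= K & (forall t, part k c (upd k x t) =
   K * \1_(`]c.1 0 k, c.2 0 k]) t) /\ part k.+1 c x = K * Num.max 0 (c.2 0 k - c.1 0 k)}.
Proof.
exists (\prod_(i < n | i != k) (if (i < k)%N then Num.max 0 (c.2 0 i - c.1 0 i)
  else \1_(`]c.1 0 i, c.2 0 i]) (x 0 i))).
  by apply: prodr_ge0 => i _; case: ifP => // _; rewrite le_max lexx.
split=> [t|].
  rewrite /part (bigD1 k)//= ltnn mulrC mxE eqxx; congr (_ * _).
  by apply: eq_bigr => i /negbTE ik; rewrite mxE ik.
rewrite /part (bigD1 k)//= ltnSn mulrC; congr (_ * _).
by apply: eq_bigr => i /negbTE ik; rewrite ltnS leq_eqVlt (inj_eq val_inj) ik.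
Qed.

Let integral_part (k : 'I_n) c x :
  (\int[lebesgue_measure]_t (part k c (upd k x t))%:E = (part k.+1 c x)%:E)%E.
Proof.
have [K K0 [Kt ->]] := part_upd k c x.
under eq_integral do rewrite Kt EFinM.
rewrite ge0_integralZl//=; last first.
  by apply/measurable_EFinP; exact: measurable_indic.
rewrite integral_indic// setIT.
rewrite [X in (_ * X)%E](lebesgue_measure_itv `]c.1 0 k, c.2 0 k]).
rewrite /= lte_fin EFinM; congr (_ * _)%E.
case: ltP => h; rewrite ?EFinB; first by rewrite /Num.max subr_gt0 h.
by rewrite /Num.max ltNge subr_le0 h.
Qed.

Lemma box_volume_le_cover c (b : nat -> 'rV[R]_n * 'rV[R]_n) :
  box c `<=` \bigcup_j box (b j) ->
  ((box_volume c)%:E <= \sum_(0 <= j <oo) (box_volume (b j))%:E)%E.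
Proof.
move=> cb.
have boxE d x : part 0 d x = \1_(box d) x.
  rewrite /part indicE; have [|] := boolP (x \in box d).
    rewrite inE => xd; rewrite big1// => i _; rewrite indicE mem_set//.
    by rewrite /= in_itv/=; exact: xd.
  rewrite notin_setE => /existsNP[i] /negP xi; rewrite (bigD1 i)//= indicE.
  by rewrite memNset ?mul0r//= in_itv; exact/negP.
(* At [k = 0] this is the assumed inclusion in terms of indicators; at [k = n] it compares the
   volumes. *)
suff H k : (k <= n)%N -> forall x,
    ((part k c x)%:E <= \sum_(0 <= j <oo) (part k (b j) x)%:E)%E.
  have volE d x : part n d x = box_volume d.
    by apply: eq_bigr => i _; rewrite ltn_ord.
  have := H _ (leqnn n) 0; rewrite volE => /le_trans; apply.
  by rewrite le_eqVlt; apply/orP; left; apply/eqP/eq_eseriesr => j _; rewrite volE.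
elim: k => [_ x|k IH kn x].
  rewrite boxE indicE; have [|_] := boolP (x \in box c); last first.
    by apply: nneseries_ge0 => j _ _; rewrite lee_fin.
  rewrite inE => /cb[j _ xj].
  rewrite (nneseriesD1 (n := j))//; last by move=> *; rewrite lee_fin.
  rewrite boxE indicE mem_set//= leeDl//.
  by apply: nneseries_ge0 => i _ _; rewrite lee_fin.
pose k' := Ordinal kn.
have mpart d : measurable_fun [set: R] (fun t => (part k d (upd k' x t))%:E).
  apply/measurable_EFinP; have [K _ [Kt _]] := part_upd k' d x.
  rewrite (_ : (fun t => _) = (fun t => K * \1_(`]d.1 0 k', d.2 0 k']) t)).
    by apply: measurable_funM => //; exact: measurable_indic.
  by apply/funext => t; exact: Kt.
rewrite -(integral_part k').
under eq_eseriesr do rewrite -(integral_part k').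
rewrite -(integral_nneseries lebesgue_measure measurableT (fun j => mpart (b j)));
  last by move=> *; rewrite lee_fin.
apply: ge0_le_integral => //; first by move=> t _; rewrite lee_fin.
- exact: mpart.
- by apply: (ge0_emeasurable_sum (P := xpredT)) => j *; [rewrite lee_fin|exact: mpart].
- by move=> t _; apply: IH; exact: ltnW.
Qed.

Lemma lebesgue_measure_box (n_gt0 : (0 < n)%N) c : mu (box c) = (box_volume c)%:E.
Proof.
apply/eqP; rewrite eq_le; apply/andP; split.
  apply: ereal_inf_lbound; exists [set c].
    by split; [exact: countable1|rewrite bigcup_set1].
  by rewrite esum_set1// lee_fin box_volume_ge0.
rewrite leNgt; apply/negP => /(outer_measure_lt_cover n_gt0)[b [cb]].
by apply/negP; rewrite -leNgt; exact: box_volume_le_cover.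
Qed.

Lemma outer_measure_le_cover (n_gt0 : (0 < n)%N) A (b : nat -> 'rV[R]_n * 'rV[R]_n) :
  A `<=` \bigcup_j box (b j) ->
  (mu A <= \sum_(0 <= j <oo) (box_volume (b j))%:E)%E.
Proof.
move=> Ab; apply: (le_trans (le_outer_measure _ _ _ Ab)).
apply: (le_trans (outer_measure_sigma_subadditive _ _)).
apply: lee_nneseries => [j *|j _]; first exact: outer_measure_ge0.
by rewrite -(lebesgue_measure_box n_gt0).
Qed.

End box_measure.

Section measurable_sets.
Context {R : realType} {n : nat}.
Hypothesis n_gt0 : (0 < n)%N.
Implicit Types (c : 'rV[R]_n * 'rV[R]_n) (x y v : 'rV[R]_n) (A B : set 'rV[R]_n).
Local Notation mu := (@lebesgue_measure_rV R n).

Lemma rV_norm_coord x i : `|x 0 i| <= `|x|.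
Proof.
have -> : `|x| = mx_norm x by [].
by rewrite mx_normE -[leLHS]nngE num_le (le_bigmax _ (fun i => `|x i.1 i.2|%:nng) (0, i)).
Qed.

Lemma rV_norm_le x r : 0 <= r -> (forall i, `|x 0 i| <= r) -> `|x| <= r.
Proof.
move=> r0 xr; have -> : `|x| = mx_norm x by [].
have [->//|/mx_norm_neq0[[i j] ->]] := eqVneq (mx_norm x) 0.
by rewrite (ord1 i) xr.
Qed.

Let clip_le (i : 'I_n) (a : R) c : 'rV[R]_n * 'rV[R]_n :=
  (c.1, \row_j (if j == i then Num.min (c.2 0 j) a else c.2 0 j)).

Let clip_gt (i : 'I_n) (a : R) c : 'rV[R]_n * 'rV[R]_n :=
  (\row_j (if j == i then Num.max (c.1 0 j) a else c.1 0 j), c.2).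

Let clip_volume i a c : box_volume (clip_le i a c) + box_volume (clip_gt i a c) = box_volume c.
Proof.
rewrite /box_volume (bigD1 i)//= [X in _ + X](bigD1 i)//= [in RHS](bigD1 i)//= !mxE eqxx.
rewrite [X in _ * X + _](eq_bigr (fun j => Num.max 0 (c.2 0 j - c.1 0 j))); last first.
  by move=> j /negbTE ji; rewrite mxE ji.
rewrite [X in _ + _ * X](eq_bigr (fun j => Num.max 0 (c.2 0 j - c.1 0 j))); last first.
  by move=> j /negbTE ji; rewrite mxE ji.
rewrite -mulrDl; congr (_ * _).
rewrite /Num.max /Num.min; do ! case: ifPn => //=; rewrite -?leNgt; lra.
Qed.

(** Up to [e] the measure of [X] is the total volume of a cover by boxes, and the hyperplane cuts
    each box into two boxes whose volumes add up. *)
Lemma measurable_halfspace (i : 'I_n) (a : R) :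
  measurable [set x : 'rV[R]_n | x 0 i <= a].
Proof.
apply: le_caratheodory_measurable => X.
apply/lee_addgt0Pr => e e0.
change (mu (X `&` [set x | (x 0 i <= a)%R]) + mu (X `&` ~` [set x | (x 0 i <= a)%R]) <=
  mu X + e%:E)%E.
have [->|Xoo] := eqVneq (mu X) +oo%E; first by rewrite addye ?leey.
have Xfin : mu X \is a fin_num by rewrite ge0_fin_numE ?outer_measure_ge0// ltey.
have /(outer_measure_lt_cover n_gt0)[b [Xb /ltW bX]] : (mu X < mu X + e%:E)%E.
  by rewrite lteDl// lte_fin.
apply: le_trans bX.
rewrite (eq_eseriesr (g := fun j => (box_volume (clip_le i a (b j)))%:E +
   (box_volume (clip_gt i a (b j)))%:E)%E); last first.
  by move=> j _; rewrite -EFinD clip_volume.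
rewrite nneseriesD; last 2 first.
- by move=> *; rewrite lee_fin box_volume_ge0.
- by move=> *; rewrite lee_fin box_volume_ge0.
apply: leeD; apply: (outer_measure_le_cover n_gt0).
- move=> x [/Xb[j _ xj] xa]; exists j => // k; rewrite mxE.
  by case: eqP => [->|_]; rewrite ?le_min ?xa ?andbT; exact: xj.
- move=> x [/Xb[j _ xj] /negP xa]; exists j => // k; rewrite mxE.
  case: eqP => [->|_]; last exact: xj.
  by rewrite gt_max /=; have /andP[-> ->] := xj i; rewrite !andbT ltNge.
Qed.

Lemma measurable_box c : measurable (box c).
Proof.
rewrite (_ : box c = \bigcap_(i in setT) ([set x | x 0 i <= c.2 0 i] `\` [set x | x 0 i <= c.1 0 i])).
  apply: fin_bigcap_measurable => // i _.
  by apply: measurableD; exact: measurable_halfspace.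
apply/seteqP; split=> x /= h i => [_|]; first by have /andP[] := h i; split => //; apply/negP; rewrite -ltNge.
by have [->/negP] := h i Logic.I; rewrite -ltNge => ->.
Qed.

(** A sup-norm ball in the half-open form of [box]: it lies between the open ball and the closed
    one. *)
Definition cube x (r : R) : set 'rV[R]_n := box (x - const_mx r, x + const_mx r).

Lemma cubeP x r y : cube x r y <-> forall i, x 0 i - r < y 0 i <= x 0 i + r.
Proof. by rewrite /cube /box; split => /= h i; have := h i; rewrite !mxE. Qed.

Lemma measurable_cube x r : measurable (cube x r).
Proof. exact: measurable_box. Qed.

Lemma cube_measure x r : 0 <= r -> mu (cube x r) = ((2 * r) ^+ n)%:E.
Proof.
move=> r0; rewrite lebesgue_measure_box// /box_volume; congr EFin.
rewrite (eq_bigr (fun=> 2 * r)) ?prodr_const ?card_ord// => i _; rewrite !mxE.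
by rewrite (_ : _ - _ = 2 * r); [apply: max_r; lra|lra].
Qed.

Lemma cube_norm x r y : cube x r y -> `|y - x| <= r.
Proof.
move=> /cubeP xy; have r0 : 0 <= r by have := xy (Ordinal n_gt0); lra.
apply: rV_norm_le => // i; rewrite !mxE ler_norml; have := xy i; lra.
Qed.

Lemma norm_cube x r y : `|y - x| < r -> cube x r y.
Proof.
move=> xy; apply/cubeP => i.
have : `|(y - x) 0 i| < r by apply: le_lt_trans xy; exact: rV_norm_coord.
by rewrite !mxE ltr_norml; lra.
Qed.

Lemma norm_le_cube x r s y : `|y - x| <= r -> r < s -> cube x s y.
Proof. by move=> xy rs; apply: norm_cube; exact: le_lt_trans rs. Qed.

Lemma rat_dense_rV x (e : R) : 0 < e -> exists q : 'rV[rat]_n, `|x - map_mx ratr q| < e.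
Proof.
move=> e0.
have /choice[q qP] (i : 'I_n) : exists q : rat, `|x 0 i - ratr q| < e / 2.
  have xe : x 0 i - e / 2 < x 0 i + e / 2 by lra.
  have [q] := rat_in_itvoo xe.
  by rewrite in_itv/= => qx; exists q; rewrite ltr_norml; lra.
exists (\row_i q i); apply: (@le_lt_trans _ _ (e / 2)); last lra.
by apply: rV_norm_le => [|i]; [lra|rewrite !mxE ltW].
Qed.

Lemma measurable_open_rV A : open A -> measurable A.
Proof.
move=> oA.
rewrite (_ : A = \bigcup_(p in [set p : 'rV[rat]_n * rat |
   cube (map_mx ratr p.1) (ratr p.2) `<=` A]) cube (map_mx ratr p.1) (ratr p.2)).
  rewrite bigcup_mkcond; apply: countable_bigcupT_measurable => // p.
  by case: ifP => // _; exact: measurable_cube.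
apply/seteqP; split => [x Ax|x [p/= pA /pA//]].
have [e /= e0 eA] := (nbhs_normP _ _).1 (open_nbhs_nbhs (conj oA Ax)).
(* With the centre within [e / 4] of [x] and the half side between [e / 4] and [e / 2], the cube
   contains [x] and stays within distance [e] of it. *)
have e42 : e / 4 < e / 2 by lra.
have [r] := rat_in_itvoo e42.
rewrite in_itv/= => /andP[r1 r2].
have e4 : 0 < e / 4 by lra.
have [q qx] := rat_dense_rV x e4.
exists (q, r) => /=; last by apply: norm_cube; apply: lt_trans r1.
move=> y /cube_norm yq; apply: eA; rewrite /ball_/=.
rewrite (le_lt_trans (ler_distD (map_mx ratr q) _ _))// [X in _ + X]distrC.
by rewrite /= in e0; lra.
Qed.

Lemma continuous_measurable_rV (f : 'rV[R]_n -> R) : continuous f -> measurable_fun setT f.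
Proof.
move=> cf; apply: (measurability _ (RGenOpens.measurableE R)) => _ [_ [a [b ->] <-]].
by rewrite setTI; apply: measurable_open_rV; apply: open_comp => // *; exact: cf.
Qed.

Lemma negligible_measurable A : mu.-negligible A -> measurable A.
Proof. exact: measure_is_complete_caratheodory. Qed.

(** A set of outer measure zero satisfies the Caratheodory condition, so the equivalence holds for
    arbitrary sets. *)
Lemma negligibleP_rV A : mu.-negligible A <-> mu A = 0%E.
Proof.
split=> [NA|A0]; first by apply/negligibleP => //; exact: negligible_measurable.
suff mA : measurable A by exact/negligibleP.
apply: le_caratheodory_measurable => X.
rewrite -[leRHS]add0e; apply: leeD; last by apply: le_outer_measure.
by rewrite -A0; apply: le_outer_measure; exact: subIsetr.
Qed.

End measurable_sets.

Section translation.
Context {R : realType} {n : nat}.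
Hypothesis n_gt0 : (0 < n)%N.
Implicit Types (c : 'rV[R]_n * 'rV[R]_n) (x y v : 'rV[R]_n) (A B : set 'rV[R]_n).
Local Notation mu := (@lebesgue_measure_rV R n).

Let shift v : 'rV[R]_n -> 'rV[R]_n := fun x => x + v.

Let le_shift v A : (mu (shift v @^-1` A) <= mu A)%E.
Proof.
rewrite leNgt; apply/negP => /(outer_measure_lt_cover n_gt0)[b [Ab]]; apply/negP.
pose b' j := ((b j).1 - v, (b j).2 - v).
rewrite -leNgt (_ : \sum_(0 <= j <oo) (box_volume (b j))%:E =
    \sum_(0 <= j <oo) (box_volume (b' j))%:E)%E; last first.
  apply: eq_eseriesr => j _; congr EFin; apply: eq_bigr => i _.
  by rewrite !mxE; congr Num.max; lra.
apply: (outer_measure_le_cover n_gt0) => x /Ab[j _ xj]; exists j => // i.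
by have := xj i; rewrite !mxE/=; lra.
Qed.

Lemma lebesgue_measure_shift v A : mu [set x | A (x + v)] = mu A.
Proof.
apply/eqP; rewrite eq_le le_shift/=.
rewrite [X in (mu X <= _)%E](_ : A = shift (- v) @^-1` (shift v @^-1` A)) ?le_shift//.
by apply/seteqP; split => x; rewrite /shift/= subrK.
Qed.

Lemma measurable_shift v A : measurable A -> measurable [set x | A (x + v)].
Proof.
move=> mA; have mA' : (lebesgue_outer_measure R n).-caratheodory A := mA.
suff : (lebesgue_outer_measure R n).-caratheodory [set x | A (x + v)] by [].
move=> X.
have e Y : lebesgue_outer_measure R n Y = lebesgue_outer_measure R n [set x | Y (x - v)].
  by have := lebesgue_measure_shift (- v) Y; rewrite /lebesgue_measure_rV => ->.
rewrite e (mA' [set x | X (x - v)]) (e (X `&` _)) (e (X `&` ~` _)).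
by congr (_ + _)%E; congr (lebesgue_outer_measure R n _); apply/seteqP; split => x /=;
  rewrite subrK.
Qed.

Lemma bigcup_cube : \bigcup_k cube (0 : 'rV[R]_n) k%:R = setT.
Proof.
apply/seteqP; split => // x _; exists (Num.bound `|x|) => //.
by apply: norm_cube; rewrite subr0; exact: unstable.ltr_bound.
Qed.

(** Inside a large cube the hyperplane lies in a slab of thickness [e / (K + 1)], where [K] is the
    product of the other edges; its volume is at most [e]. *)
Lemma negligible_hyperplane (i : 'I_n) (a : R) :
  mu.-negligible [set x : 'rV[R]_n | x 0 i = a].
Proof.
suff H (k : nat) : mu.-negligible ([set x : 'rV[R]_n | x 0 i = a] `&` cube 0 k%:R).
  apply: (negligibleS _ (negligible_bigcup H)) => x xa.
  have : setT x by []; rewrite -bigcup_cube => -[k _ kx]; by exists k.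
apply/negligibleP_rV => //; apply/eqP; rewrite eq_le outer_measure_ge0 andbT.
pose K := \prod_(j < n | j != i) Num.max 0 (2 * k%:R : R).
have K0 : 0 <= K by apply: prodr_ge0 => j _; rewrite le_max lexx.
apply/lee_addgt0Pr => e e0; rewrite add0e.
have eK : 0 < e / (K + 1) by rewrite divr_gt0//; lra.
pose c : 'rV[R]_n * 'rV[R]_n :=
  (\row_j (if j == i then a - e / (K + 1) else - k%:R), \row_j (if j == i then a else k%:R)).
apply: (@le_trans _ _ (mu (box c))).
  apply: le_outer_measure => x /= [xa /cubeP xk] j; have := xk j; rewrite !mxE !add0r.
  by case: eqP => [->|//]; rewrite xa lexx andbT => _; lra.
rewrite lebesgue_measure_box// lee_fin /box_volume (bigD1 i)//= !mxE eqxx.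
rewrite (eq_bigr (fun=> Num.max 0 (2 * k%:R))); last first.
  by move=> j /negbTE ji; rewrite !mxE ji; congr Num.max; lra.
rewrite -/K max_r; last by lra.
by rewrite opprB addrCA subrr addr0 mulrAC ler_pdivrMr ?ler_pM2l//; lra.
Qed.

End translation.

Section sigma_finite.
Context {R : realType} {n : nat}.

(** This gives access to Fubini's theorem, used for layers and along lines. For [n = 0] the space is
    a point, covered by one box whose volume is an empty product. *)
Let sf : sigma_finite setT (@lebesgue_measure_rV R n).
Proof.
have [n0|n_gt0] := posnP n; last first.
  exists (fun k => cube 0 k%:R) => [|k]; first by rewrite bigcup_cube.
  split; first exact: measurable_cube.
  by rewrite /= cube_measure// ltry.
exists (fun=> setT) => [|k]; first by apply/seteqP; split => // x _; exists 0%N.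
split => //; apply: (@le_lt_trans _ _ (box_volume (0 : 'rV[R]_n, 0 : 'rV[R]_n))%:E).
  apply: ereal_inf_lbound; exists [set (0, 0)].
    split; first exact: countable1.
    by rewrite bigcup_set1 => x _ i; have := ltn_ord i; rewrite {2}n0.
  by rewrite esum_set1// lee_fin box_volume_ge0.
exact: ltry.
Qed.

HB.instance Definition _ := @Measure_isSigmaFinite.Build _ _ _ (@lebesgue_measure_rV R n) sf.

End sigma_finite.

(** * Density points *)

Section density.
Context {R : realType} {n : nat}.
Hypothesis n_gt0 : (0 < n)%N.
Implicit Types (x y v : 'rV[R]_n) (A B : set 'rV[R]_n) (s : seq ('rV[R]_n * R)).
Local Notation mu := (@lebesgue_measure_rV R n).

Let cubes s : set 'rV[R]_n := \bigcup_(p in [set` s]) cube p.1 p.2.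

Let measurable_cubes s : measurable (cubes s).
Proof.
by apply: fin_bigcup_measurable => [|p _]; [exact: finite_seq|exact: measurable_cube].
Qed.

Lemma ex_max_seq (T : eqType) (f : T -> R) (t : seq T) : t != [::] ->
  exists2 p, p \in t & forall q, q \in t -> f q <= f p.
Proof.
elim: t => // a [_ _|b t /(_ isT)[p pt IH] _].
  by exists a; rewrite ?mem_head// => q; rewrite inE => /eqP ->.
have [ap|pa] := leP (f a) (f p).
  exists p; first by rewrite inE pt orbT.
  by move=> q; rewrite inE => /predU1P[->//|/IH].
exists a; first exact: mem_head.
by move=> q; rewrite inE => /predU1P[->//|/IH qp]; exact: le_trans (ltW pa).
Qed.

Let cube_meet x y r r' : r' <= r -> cube x r `&` cube y r' !=set0 ->
  cube y r' `<=` cube x (3 * r).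
Proof.
move=> rr [z [/cubeP zx /cubeP zy]] w /cubeP wy; apply/cubeP => i.
by have := zx i; have := zy i; have := wy i; lra.
Qed.

(* Greedy Vitali selection: the largest cube, dilated three times, covers
   every cube which meets it; the cubes disjoint from it are left to the
   induction. *)
Lemma vitali_cubes A (c : R) s : measurable A -> 0 < c ->
  (forall p, p \in s -> 0 < p.2 /\ ((c * (2 * p.2) ^+ n)%:E <= mu (cube p.1 p.2 `\` A))%E) ->
  (c%:E * mu (cubes s) <= (3 ^+ n)%:E * mu (cubes s `\` A))%E.
Proof.
move=> mA c0; elim: {s}(size s).+1 {-2}s (ltnSn (size s)) => // m IH s sm sA.
have [->|s0] := eqVneq s [::].
  by rewrite /cubes set_nil bigcup_set0 measure0 mule0 mule_ge0// lee_fin exprn_ge0.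
have [p ps pmax] := ex_max_seq (fun p : 'rV[R]_n * R => p.2) s0.
pose disj (q : 'rV[R]_n * R) := `[< cube p.1 p.2 `&` cube q.1 q.2 = set0 >].
pose s' := [seq q <- s | disj q].
have [p0 pA] := sA _ ps.
have ss' : {subset s' <= s} by move=> q; rewrite mem_filter => /andP[].
have pp : cube p.1 p.2 p.1 by apply/cubeP => i; lra.
have s's : (size s' < m)%N.
  apply: leq_trans (sm : (size s <= m)%N).
  rewrite size_filter -[leqRHS](count_predC disj) -[X in (X < _)%N]addn0 ltn_add2l.
  rewrite -has_count; apply/hasP; exists p => //=; apply/negP => /asboolP.
  by rewrite setIid => /seteqP[/(_ _ pp)].
have {}IH := IH s' s's (fun q qs' => sA q (ss' q qs')).
have cov : cubes s `<=` cube p.1 (3 * p.2) `|` cubes s'.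
  move=> x [q /= qs xq]; have [qd|/asboolP/eqP/set0P qd] := boolP (disj q).
    by right; exists q => //=; rewrite mem_filter qd.
  by left; exact: cube_meet (pmax _ qs) qd _ xq.
have p3 : 0 <= 3 * p.2 by rewrite mulr_ge0// ltW.
have c3 : (c%:E * mu (cube p.1 (3 * p.2)) <= (3 ^+ n)%:E * mu (cube p.1 p.2 `\` A))%E.
  rewrite cube_measure// mulrCA exprMn -EFinM mulrCA EFinM.
  by apply: lee_pmul => //; rewrite lee_fin ?mulr_ge0 ?exprn_ge0//; lra.
have mcA q r : measurable (cube q r `\` A).
  by apply: measurableD => //; exact: measurable_cube.
have msA t : measurable (cubes t `\` A) by apply: measurableD.
apply: (@le_trans _ _ (c%:E * (mu (cube p.1 (3 * p.2)) + mu (cubes s')))%E).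
  apply: lee_wpmul2l; first by rewrite lee_fin ltW.
  apply: (le_trans _ (measureU2 _ _ _)) => //; last exact: measurable_cube.
  by apply: le_measure; rewrite ?inE//; apply: measurableU => //; exact: measurable_cube.
rewrite ge0_muleDr//; apply: (le_trans (leeD c3 IH)).
rewrite -ge0_muleDr//; apply: lee_wpmul2l; first by rewrite lee_fin exprn_ge0.
rewrite -measureU//; last first.
  apply/seteqP; split=> // x [[xp _] [[q /=]]]; rewrite mem_filter => /andP[/asboolP d _] xq.
  by move/seteqP: d => [/(_ x) h _] _; exact: h.
apply: le_measure; rewrite ?inE//; first exact: measurableU.
move=> x [[xp xA]|[[q /= /ss' qs xq] xA]]; split => //; first by exists p.
by exists q.
Qed.

(** The finite subfamilies enumerated by [pickle] increase to the whole family, and the measure is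
    continuous along increasing unions. *)
Lemma vitali_cubes_countable (I : countType) (p : I -> 'rV[R]_n * R) (P : set I) A (c : R) :
  measurable A -> 0 < c ->
  (forall i, P i -> 0 < (p i).2 /\
    ((c * (2 * (p i).2) ^+ n)%:E <= mu (cube (p i).1 (p i).2 `\` A))%E) ->
  (c%:E * mu (\bigcup_(i in P) cube (p i).1 (p i).2) <=
   (3 ^+ n)%:E * mu (\bigcup_(i in P) cube (p i).1 (p i).2 `\` A))%E.
Proof.
move=> mA c0 PA; set U := \bigcup_(i in P) _.
have mU : measurable U.
  rewrite /U bigcup_mkcond; apply: countable_bigcupT_measurable => // i.
  by case: ifP => // _; exact: measurable_cube.
pose s k := [seq p i | i <- pmap unpickle (iota 0 k) & `[< P i >]].
have sU : \bigcup_k cubes (s k) = U.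
  apply/seteqP; split=> x.
    move=> [k _ [q /= /mapP[i]]]; rewrite mem_filter => /andP[/asboolP Pi _ ->] xi.
    by exists i.
  move=> [i Pi xi]; exists (pickle i).+1 => //; exists (p i) => //=.
  apply/mapP; exists i => //; rewrite mem_filter; apply/andP; split; first exact/asboolP.
  rewrite mem_pmap; apply/mapP; exists (pickle i); last by rewrite pickleK.
  by rewrite mem_iota/= add0n.
have snd : nondecreasing_seq (fun k => cubes (s k)).
  move=> k l kl; apply/subsetPset => x [q /= /mapP[i]].
  rewrite mem_filter => /andP[Pi]; rewrite mem_pmap => /mapP[j].
  rewrite mem_iota/= add0n => jk ij -> xi.
  exists (p i) => //=; apply/mapP; exists i => //; rewrite mem_filter Pi/=.
  rewrite mem_pmap; apply/mapP; exists j => //; rewrite mem_iota/= add0n.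
  exact: leq_trans kl.
have := @nondecreasing_cvg_mu _ _ _ mu _ (fun k => measurable_cubes (s k)).
rewrite sU => /(_ mU snd) cvgU.
rewrite -lee_pdivlMl//.
apply: (cvge_le _ cvgU); apply: nearW => k /=.
rewrite lee_pdivlMl//.
apply: le_trans (vitali_cubes mA c0 _) _.
  by move=> q /mapP[i]; rewrite mem_filter => /andP[/asboolP Pi _ ->]; exact: PA.
apply: lee_wpmul2l; first by rewrite lee_fin exprn_ge0.
apply: le_measure; rewrite ?inE//; [exact: measurableD|exact: measurableD|].
by rewrite -sU => x [xk xA]; split => //; exists k.
Qed.

(** A half-open box avoids its lower faces, so only its upper faces can lie outside its interior. *)
Lemma box_boundary (c : 'rV[R]_n * 'rV[R]_n) :
  box c `\` (box c)^° `<=` \bigcup_(i in setT) [set x : 'rV[R]_n | x 0 i = c.2 0 i].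
Proof.
move=> x [xc xn]; apply: contrapT => h; apply: xn.
suff H (i : 'I_n) : \forall y \near x, c.1 0 i < (y : 'rV[R]_n) 0 i <= c.2 0 i.
  exact: (filter_forall _ H).
have x1 : c.1 0 i < x 0 i by have /andP[] := xc i.
have x2 : x 0 i < c.2 0 i.
  by rewrite lt_neqAle; have /andP[_ ->] := xc i; rewrite andbT; apply/eqP => e; apply: h; exists i.
have cx : {for x, continuous (fun y : 'rV[R]_n => y 0 i)} by exact: coord_continuous.
near=> y; apply/andP; split.
  by near: y; apply: (cvgr_gt _ cx).
by apply: ltW; near: y; apply: (cvgr_lt _ cx).
Unshelve. all: by end_near. Qed.

Lemma lebesgue_measureDI A B : measurable A -> measurable B ->
  mu A = (mu (A `\` B) + mu (A `&` B))%E.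
Proof. exact: measureDI. Qed.

Lemma lebesgue_measureU2 A B : (mu (A `|` B) <= mu A + mu B)%E.
Proof. exact: outer_measureU2. Qed.

Lemma le_lebesgue_measure A B : A `<=` B -> (mu A <= mu B)%E.
Proof. exact: le_outer_measure. Qed.

(** An open [U] covers almost all of a bounded part [B] of [A] with small excess [U \ B]. The
    exceptional points in [U] have small cubes inside [U] of which a fixed share misses [A]; by the
    Vitali estimate the union of these cubes is controlled by [U \ A], hence by the excess. *)
Lemma cube_density A (c : R) : measurable A -> 0 < c ->
  mu.-negligible [set x | A x /\ forall d, 0 < d -> exists r, [/\ 0 < r, r < d &
    ((c * (2 * r) ^+ n)%:E <= mu (cube x r `\` A))%E] ].
Proof.
move=> mA c0; set N := [set x | _].
suff H (k : nat) : mu.-negligible (N `&` cube 0 k%:R).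
  apply: (negligibleS _ (negligible_bigcup H)) => x xN.
  have : setT x by []; rewrite -bigcup_cube => -[k _ kx]; by exists k.
pose B := A `&` cube 0 k%:R.
have mB : measurable B by apply: measurableI => //; exact: measurable_cube.
have Bfin : mu B \is a fin_num.
  rewrite ge0_fin_numE//; apply: (@le_lt_trans _ _ (mu (cube 0 k%:R))).
    by apply: le_outer_measure; exact: subIsetr.
  by rewrite cube_measure// ltry.
apply/negligibleP_rV => //; apply/eqP; rewrite eq_le outer_measure_ge0 andbT.
(* Passing to rational cubes at most doubles the half side, which costs a factor [2 ^+ n]. *)
pose c' := c / 2 ^+ n; have c'0 : 0 < c' by rewrite divr_gt0// exprn_gt0.
apply/lee_addgt0Pr => e0 e00; rewrite add0e.
pose e := e0 * c' / 3 ^+ n.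
have e_gt0 : 0 < e by rewrite divr_gt0 ?mulr_gt0// exprn_gt0.
have /(outer_measure_lt_cover n_gt0)[b [Bb be]] : (mu B < mu B + e%:E)%E.
  by rewrite lteDl// lte_fin.
(* Interiors make [U] open; what they lose of [B] lies in countably many hyperplanes. *)
pose U := \bigcup_j (box (b j))^°.
have oU : open U by apply: bigcup_open => j _; exact: open_interior.
have mU : measurable U by exact: measurable_open_rV.
have BU : mu.-negligible (B `\` U).
  have H j : mu.-negligible (\bigcup_(i in [set: 'I_n]) [set x : 'rV[R]_n | x 0 i = (b j).2 0 i]).
    pose F k := [set x : 'rV[R]_n | exists2 i : 'I_n, i = k :> nat & x 0 i = (b j).2 0 i].
    have NF l : mu.-negligible (F l).
      have [kn|nk] := ltnP l n.
        apply: (negligibleS _ (negligible_hyperplane n_gt0 (Ordinal kn) ((b j).2 0 (Ordinal kn)))).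
        by move=> x [i ik xi]; have <- : i = Ordinal kn by exact: val_inj.
      apply: (negligibleS _ (negligible_set0 _)) => x [i ik _].
      by have := ltn_ord i; rewrite ik ltnNge nk.
    apply: (negligibleS _ (negligible_bigcup NF)) => x [i _ xi].
    by exists i => //; exists i.
  apply: (negligibleS _ (negligible_bigcup H)) => x [Bx Ux].
  have [j _ xj] := Bb x Bx; exists j => //; apply: box_boundary; split => //.
  by move=> xi; apply: Ux; exists j.
have UB : (mu (U `\` B) <= e%:E)%E.
  have BIU : mu (B `&` U) = mu B.
    rewrite [RHS](lebesgue_measureDI mB mU) (_ : mu (B `\` U) = 0%E) ?add0e//.
    exact/negligibleP_rV.
  rewrite -(@leeD2lE _ (mu B))// -{1}BIU setIC addeC -(lebesgue_measureDI mU mB).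
  apply: le_trans (ltW be); apply: (outer_measure_le_cover n_gt0).
  by apply: subset_bigcup => j _; exact: interior_subset.
pose p (i : 'rV[rat]_n * rat) : 'rV[R]_n * R := (map_mx ratr i.1, ratr i.2).
pose P := [set i | [/\ cube (p i).1 (p i).2 `<=` U, 0 < (p i).2 &
   ((c' * (2 * (p i).2) ^+ n)%:E <= mu (cube (p i).1 (p i).2 `\` A))%E] ].
have := @vitali_cubes_countable _ p P A c' mA c'0 (fun i Pi => let: And3 _ a b := Pi in conj a b).
set W := \bigcup_(i in P) _ => /= WA.
have NW : N `&` cube 0 k%:R `<=` W `|` (B `\` U).
  move=> x [[Ax Nx] xk]; have [Ux|Ux] := pselect (U x); [left|by right].
  have [d /= d0 dU] := (nbhs_normP _ _).1 (open_nbhs_nbhs (conj oU Ux)).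
  have d3 : 0 < d / 3 by lra.
  have [r [r0 rd cr]] := Nx _ d3.
  (* A rational centre within [r / 2] of [x] and a half side between [3 r / 2] and [2 r] give a cube
     that contains [cube x r] and stays within [3 r < d] of [x]. *)
  have r2 : 0 < r / 2 by lra.
  have [q qx] := rat_dense_rV x r2.
  have r3 : 3 / 2 * r < 2 * r by lra.
  have [t] := rat_in_itvoo r3; rewrite in_itv/= => /andP[t1 t2].
  exists (q, t); last by apply: norm_cube => /=; lra.
  have sub : cube x r `<=` cube (map_mx ratr q) (ratr t).
    move=> y /cubeP xy; apply/cubeP => i; have := xy i.
    have : `|(x - map_mx ratr q) 0 i| < r / 2 by apply: le_lt_trans qx; exact: rV_norm_coord.
    by rewrite !mxE ltr_norml; lra.
  split => /=; first 2 last.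
  - apply: (@le_trans _ _ (mu (cube x r `\` A))); last first.
      by apply: le_outer_measure; exact: setSD.
    apply: le_trans cr; rewrite lee_fin /c' mulrAC ler_pdivrMr ?exprn_gt0// -mulrA.
    by rewrite ler_pM2l// -exprMn ler_pXn2r// ?nnegrE; lra.
  - move=> y /cube_norm yq; apply: dU; rewrite /ball_/=.
    rewrite (le_lt_trans (ler_distD (map_mx ratr q) _ _))// [X in _ + X]distrC.
    by have := yq n_gt0; lra.
  - by lra.
have BU0 : mu (B `\` U) = 0%E by exact/negligibleP_rV.
apply: (le_trans (le_outer_measure _ _ _ NW)).
apply: (le_trans (lebesgue_measureU2 _ _)); rewrite BU0 adde0.
rewrite -[e0%:E]mul1e -(mulVf (lt0r_neq0 c'0)) EFinM -muleA lee_pdivlMl//.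
apply: (le_trans WA); rewrite (_ : c'%:E * _ = (3 ^+ n)%:E * e%:E)%E; last first.
  rewrite -!EFinM /e; congr EFin.
  by rewrite mulrC [RHS]mulrC divfK// expf_neq0.
apply: lee_wpmul2l; first by rewrite lee_fin exprn_ge0.
apply: le_trans UB; apply: le_outer_measure => x [[i [iU _ _] xi] xA].
by split; [exact: iU|move=> [Ax _]].
Qed.

End density.

(** * The Euclidean norm *)

Section euclidean_norm.
Context {R : realType} {n : nat}.
Implicit Types (x y v w : 'rV[R]_n).

Lemma sum_sqr_ge0 v : 0 <= \sum_(i < n) v 0 i ^+ 2.
Proof. by apply: sumr_ge0 => i _; exact: sqr_ge0. Qed.

Lemma enorm_ge0 v : 0 <= enorm v.
Proof. exact: sqrtr_ge0. Qed.

Lemma enorm_sqr v : enorm v ^+ 2 = \sum_(i < n) v 0 i ^+ 2.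
Proof. by rewrite sqr_sqrtr// sum_sqr_ge0. Qed.

Lemma enormN v : enorm (- v) = enorm v.
Proof. by rewrite /enorm; congr Num.sqrt; apply: eq_bigr => i _; rewrite mxE sqrrN. Qed.

Lemma enormZ (a : R) v : enorm (a *: v) = `|a| * enorm v.
Proof.
rewrite /enorm -sqrtr_sqr -sqrtrM ?sqr_ge0//; congr Num.sqrt.
by rewrite mulr_sumr; apply: eq_bigr => i _; rewrite mxE exprMn.
Qed.

Lemma enorm0 : enorm (0 : 'rV[R]_n) = 0.
Proof. by rewrite -(scale0r 0) enormZ normr0 mul0r. Qed.

Lemma cauchy_schwarz v w : \sum_(i < n) v 0 i * w 0 i <= enorm v * enorm w.
Proof.
set C := \sum_(i < n) _; set a := enorm v; set b := enorm w.
have [w0|w0] := eqVneq b 0.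
  have wi i : w 0 i = 0.
    have := enorm_sqr w; rewrite -/b w0 expr0n/= => /esym/eqP.
    rewrite psumr_eq0 => [/allP/(_ i)|j _]; last exact: sqr_ge0.
    by rewrite mem_index_enum sqrf_eq0 => /(_ isT)/eqP.
  by rewrite w0 mulr0 /C big1// => i _; rewrite wi mulr0.
have b0 : 0 < b by rewrite lt_def w0 enorm_ge0.
(* The vector here is [b ^+ 2] times the component of [v] orthogonal to [w]. *)
have : 0 <= \sum_(i < n) (b ^+ 2 * v 0 i - C * w 0 i) ^+ 2.
  by apply: sumr_ge0 => i _; exact: sqr_ge0.
rewrite (eq_bigr (fun i : 'I_n => b ^+ 4 * v 0 i ^+ 2 - 2 * b ^+ 2 * C * (v 0 i * w 0 i) +
   C ^+ 2 * w 0 i ^+ 2)); last by move=> i _; ring.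
rewrite big_split sumrB/= -!mulr_sumr -!enorm_sqr -/a -/b -/C => h.
have {h} h : 0 <= b ^+ 2 * ((a * b) ^+ 2 - C ^+ 2) by apply: le_trans h _; rewrite le_eqVlt; apply/orP; left; apply/eqP; ring.
have {}h : C ^+ 2 <= (a * b) ^+ 2 by rewrite -subr_ge0 -(pmulr_rge0 _ (exprn_gt0 2 b0)).
have [C0|/ltW C0] := leP 0 C; last by rewrite (le_trans C0)// mulr_ge0// enorm_ge0.
by rewrite -(@ler_pXn2r _ 2)// nnegrE mulr_ge0// enorm_ge0.
Qed.

Lemma enormD v w : enorm (v + w) <= enorm v + enorm w.
Proof.
rewrite -(@ler_pXn2r _ 2) ?nnegrE ?addr_ge0 ?enorm_ge0// sqrrD !enorm_sqr.
under eq_bigr do rewrite mxE sqrrD.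
rewrite !big_split/= lerD2r lerD2l mulr2n.
by apply: lerD; exact: cauchy_schwarz.
Qed.

Lemma enormB x y : enorm (x - y) = enorm (y - x).
Proof. by rewrite -enormN opprB. Qed.

Lemma norm_le_enorm v : `|v| <= enorm v.
Proof.
apply: rV_norm_le; first exact: enorm_ge0.
move=> i; rewrite -(@ler_pXn2r _ 2) ?nnegrE ?enorm_ge0// enorm_sqr -normrX ger0_norm ?sqr_ge0//.
by rewrite (bigD1 i)//= lerDl sumr_ge0// => j _; exact: sqr_ge0.
Qed.

Lemma enorm_le_norm v : enorm v <= n%:R * `|v|.
Proof.
rewrite -(@ler_pXn2r _ 2) ?nnegrE ?enorm_ge0 ?mulr_ge0// enorm_sqr.
apply: (@le_trans _ _ (\sum_(i < n) `|v| ^+ 2)).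
  apply: ler_sum => i _; rewrite -[leLHS]ger0_norm ?sqr_ge0// normrX.
  by rewrite ler_pXn2r ?nnegrE// rV_norm_coord.
rewrite sumr_const card_ord -[_ ^+ 2 *+ n]mulr_natl exprMn ler_wpM2r ?sqr_ge0//.
by rewrite -natrX ler_nat; case: (n) => // k; rewrite -{1}(expn1 k.+1) leq_pexp2l.
Qed.

End euclidean_norm.

Section density_points.
Context {R : realType} {n : nat}.
Hypothesis n_gt0 : (0 < n)%N.
Implicit Types (x y v : 'rV[R]_n) (A B C : set 'rV[R]_n).
Local Notation mu := (@lebesgue_measure_rV R n).

Lemma eball_cube x r : 0 < r -> eball x r `<=` cube x (2 * r).
Proof.
move=> r0 y xy; apply: (@norm_le_cube _ _ _ r); last lra.
exact: le_trans (norm_le_enorm _) xy.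
Qed.

Let natn : (0 : R) < n%:R. Proof. by rewrite ltr0n. Qed.

Lemma cube_eball x r : cube x (r / n%:R) `<=` eball x r.
Proof.
move=> y /(cube_norm n_gt0) xy; apply: (le_trans (enorm_le_norm _)).
by rewrite mulrC -ler_pdivlMr.
Qed.

Lemma eball_measure_ge x r : 0 < r -> (((2 * (r / n%:R)) ^+ n)%:E <= mu (eball x r))%E.
Proof.
move=> r0; have rn : 0 <= r / n%:R by rewrite divr_ge0// ltW.
by rewrite -(cube_measure n_gt0 x)//; apply: le_lebesgue_measure; exact: cube_eball.
Qed.

Lemma eball_measure_fin A x r : 0 < r -> mu (A `&` eball x r) \is a fin_num.
Proof.
move=> r0; rewrite ge0_fin_numE ?outer_measure_ge0//.
apply: (@le_lt_trans _ _ (mu (cube x (2 * r)))).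
  by apply: le_lebesgue_measure => y [_]; exact: eball_cube.
by rewrite cube_measure ?ltry//; lra.
Qed.

Let dens A x r : R := fine (mu (A `&` eball x r)) / fine (mu (eball x r)).

Let eball_gt0 x r : 0 < r -> 0 < fine (mu (eball x r)).
Proof.
move=> r0; rewrite -lte_fin fineK; last by rewrite -[eball _ _]setTI eball_measure_fin.
apply: lt_le_trans (eball_measure_ge x r0); rewrite lte_fin exprn_gt0//.
by rewrite mulr_gt0// divr_gt0.
Qed.

Let le_dens A B x r : 0 < r -> (mu (A `&` eball x r) <= mu (B `&` eball x r))%E ->
  dens A x r <= dens B x r.
Proof.
move=> r0 AB; rewrite ler_pM2r ?invr_gt0 ?eball_gt0//.
by rewrite -lee_fin !fineK// eball_measure_fin.
Qed.

Let densT x r : 0 < r -> dens setT x r = 1.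
Proof. by move=> r0; rewrite /dens setTI divff// gt_eqF ?eball_gt0. Qed.

Let dens_le1 A x r : 0 < r -> dens A x r <= 1.
Proof.
move=> r0; rewrite -(densT x r0); apply: le_dens => //.
by apply: le_lebesgue_measure; exact: setSI.
Qed.

Let densC A x r : measurable A -> 0 < r -> dens A x r + dens (~` A) x r = 1.
Proof.
move=> mA r0; rewrite -(densT x r0) /dens -mulrDl setTI -fineD ?eball_measure_fin//.
have mA' : (lebesgue_outer_measure R n).-caratheodory A := mA.
by rewrite /lebesgue_measure_rV (mA' (eball x r)) ![_ `&` eball _ _]setIC.
Qed.

Lemma ess_subset_measure A B C : ess_subset A B -> (mu (A `&` C) <= mu (B `&` C))%E.
Proof.
move=> /(negligibleP_rV) AB; rewrite -[leRHS]adde0 -AB.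
apply: le_trans (lebesgue_measureU2 _ _); apply: le_lebesgue_measure => x [Ax Cx].
by have [Bx|Bx] := pselect (B x); [left|right].
Qed.

(** Densities ignore null sets. This is the step from essential inclusions to pointwise ones. *)
Lemma sub_density_points A B : ess_subset A B -> density_points A `<=` density_points B.
Proof.
move=> AB x Ax; have {}Ax : dens A x r @[r --> 0^'+] --> (1 : R) := Ax.
suff : dens B x r @[r --> 0^'+] --> (1 : R) by [].
apply: (@squeeze_cvgr _ _ _ _ (dens A x) (cst 1) (dens B x) _ 1 Ax (cvg_cst _)).
near=> r; have r0 : 0 < r by near: r; exact: nbhs_right_gt.
by rewrite dens_le1// andbT le_dens//; exact: ess_subset_measure.
Unshelve. all: by end_near. Qed.

Lemma density_points_interior A x e : 0 < e ->
  ess_subset [set y | `|y - x| < e] A -> density_points A x.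
Proof.
move=> e0 eA; suff : dens A x r @[r --> 0^'+] --> (1 : R) by [].
apply: cvg_near_cst.
near=> r; have r0 : 0 < r by near: r; exact: nbhs_right_gt.
apply/eqP; rewrite eq_le dens_le1//= -(densT x r0) le_dens//.
apply: le_trans (ess_subset_measure _ eA); apply: le_lebesgue_measure => y [_ xy]; split => //.
apply: le_lt_trans (norm_le_enorm _) _; apply: le_lt_trans xy _.
by near: r; exact: nbhs_right_lt.
Unshelve. all: by end_near. Qed.

(** The density theorem for cubes carries over to Euclidean balls, since each ball lies between two
    cubes of comparable volume. *)
Lemma ess_sub_density_points A : measurable A -> ess_subset A (density_points A).
Proof.
move=> mA.
(* The ball of radius [r] lies in the cube of half side [2 r] and contains the one of half side
   [r / n]; [(2 n) ^ n] is the ratio of their volumes. *)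
pose c k := (2 * n%:R : R) ^- n / k.+1%:R.
have c0 k : 0 < c k by rewrite divr_gt0// invr_gt0 exprn_gt0// mulr_gt0.
apply: (negligibleS _ (negligible_bigcup (fun k => cube_density n_gt0 mA (c0 k)))).
move=> x [Ax nx]; apply: contrapT => h; apply: nx.
suff : dens A x r @[r --> 0^'+] --> (1 : R) by [].
apply/cvgrPdist_le => e e0.
have [k ke] : exists k, k.+1%:R^-1 < e.
  by exists (Num.bound e^-1); rewrite invf_plt ?posrE// (lt_le_trans (unstable.ltr_bound _))// ler_nat.
have [d d0 dA] : exists2 d, 0 < d & forall r, 0 < r -> r < d ->
    (mu (cube x r `\` A) < (c k * (2 * r) ^+ n)%:E)%E.
  apply: contrapT => h'; apply: h; exists k => //; split => // d d0.
  apply: contrapT => h''; apply: h'; exists d => // r r0 rd.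
  by rewrite ltNge; apply/negP => rA; apply: h''; exists r.
near=> r; have r0 : 0 < r by near: r; exact: nbhs_right_gt.
rewrite -(densC x mA r0) addrC addKr ger0_norm ?divr_ge0 ?fine_ge0 ?outer_measure_ge0//.
apply: le_trans (ltW ke); rewrite /dens ler_pdivrMr ?eball_gt0//.
rewrite -lee_fin fineK ?eball_measure_fin//.
apply: (@le_trans _ _ (mu (cube x (2 * r) `\` A))).
  by apply: le_lebesgue_measure => y [Ay /(eball_cube r0)].
have r2d : 2 * r < d by rewrite mulrC -ltr_pdivlMr//; near: r; apply: nbhs_right_lt; rewrite divr_gt0.
apply: (le_trans (ltW (dA _ _ r2d))); first by rewrite mulr_gt0.
rewrite [leRHS]EFinM fineK; last by rewrite -[eball _ _]setTI eball_measure_fin.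
apply: (@le_trans _ _ (k.+1%:R^-1%:E * ((2 * (r / n%:R)) ^+ n)%:E)%E).
  rewrite -EFinM lee_fin /c mulrAC mulrC ler_pM2l ?invr_gt0//.
  rewrite -exprVn -exprMn le_eqVlt; apply/orP; left; apply/eqP; congr (_ ^+ _).
  by field; rewrite gt_eqF.
by apply: lee_wpmul2l; [rewrite lee_fin invr_ge0|exact: eball_measure_ge].
Unshelve. all: by end_near. Qed.

(** Almost every point outside [A] is a density point of the complement. It cannot be one of [A]
    too, because the two densities add up to [1]. *)
Lemma density_points_ess_sub A : measurable A -> ess_subset (density_points A) A.
Proof.
move=> mA; apply: (negligibleS _ (ess_sub_density_points (measurableC mA))).
move=> x [dA Ax]; split => // dCA.
have h2 : dens A x r + dens (~` A) x r @[r --> 0^'+] --> (1 + 1 : R) by exact: cvgD dA dCA.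
have h1 : dens A x r + dens (~` A) x r @[r --> 0^'+] --> (1 : R).
  apply: cvg_near_cst; near=> r.
  by apply: densC => //; near: r; exact: nbhs_right_gt.
have h12 : (1 : R) = 1 + 1 by exact: (norm_cvg_unique h1 h2).
by have /eqP := esym h12; rewrite -subr_eq0 addrK oner_eq0.
Unshelve. all: by end_near. Qed.

Lemma ess_subset_trans B A C : ess_subset A B -> ess_subset B C -> ess_subset A C.
Proof.
move=> AB BC; apply: negligibleS (negligibleU AB BC) => x [Ax Cx].
by have [Bx|Bx] := pselect (B x); [right|left].
Qed.

Lemma subset_ess A B : A `<=` B -> ess_subset A B.
Proof. by move=> AB; apply: negligibleS (negligible_set0 _) => x [/AB]. Qed.

End density_points.

(** * Function spaces and essential infima *)

Section function_spaces.
Context {R : realType} {n : nat}.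
Hypothesis n_gt0 : (0 < n)%N.
Implicit Types (x y v : 'rV[R]_n) (A B C : set 'rV[R]_n) (f g : 'rV[R]_n -> R).
Local Notation mu := (@lebesgue_measure_rV R n).

Lemma lebesgue_measureT : mu setT = +oo%E.
Proof.
apply/eqyP => r r0; pose s := Num.max r 1.
have s1 : 1 <= s by rewrite le_max lexx orbT.
apply: (@le_trans _ _ (mu (cube 0 s))); last exact: le_lebesgue_measure.
have s0 : 0 <= s by lra.
rewrite (cube_measure n_gt0)// lee_fin; apply: (@le_trans _ _ (2 * s)).
  by apply: (@le_trans _ _ s); [rewrite le_max lexx|lra].
by rewrite -[leLHS]expr1 ler_weXn2l//; lra.
Qed.

Lemma lebesgue_measure_conegligible A : mu.-negligible (~` A) -> mu A = +oo%E.
Proof.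
move=> /negligibleP_rV A0; apply/eqP; rewrite -leye_eq -lebesgue_measureT -(setUv A).
by rewrite (le_trans (lebesgue_measureU2 _ _))// A0 adde0.
Qed.

Lemma ess_subset_eq_measure A B : measurable A -> measurable B -> ess_subset A B ->
  mu A = mu B -> (mu A < +oo)%E -> ess_subset B A.
Proof.
move=> mA mB /negligibleP_rV AB muAB Aoo; apply/negligibleP_rV.
have := lebesgue_measureDI mA mB; rewrite AB add0e => muA.
have := lebesgue_measureDI mB mA; rewrite setIC -muA -muAB => /esym/eqP.
have Af : mu A \is a fin_num by rewrite ge0_fin_numE ?outer_measure_ge0.
move=> /eqP BA; apply/eqP; rewrite eq_le outer_measure_ge0 andbT.
by rewrite -(leeD2rE _ _ Af) BA add0e.
Qed.

Lemma measurable_superlevel f (t : R) : measurable_fun setT f -> measurable [set x | t < f x].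
Proof.
move=> mf; have := mf measurableT `]t, +oo[%classic (measurable_itv _).
rewrite setTI (_ : f @^-1` _ = [set x | t < f x])//.
by apply/seteqP; split => x /=; rewrite in_itv/= andbT.
Qed.

Lemma ess_inf_infinite f (t : R) : (t%:E < ess_inf_rV f)%E -> mu [set x | t < f x] = +oo%E.
Proof.
move=> tf; apply: lebesgue_measure_conegligible.
apply: (negligibleS _ (ess_inf_le mu (EFin \o f))) => x /= ft h; apply: ft.
by rewrite -lte_fin (lt_le_trans tf).
Qed.

Lemma le_ess_inf_rV f (m : R) : (forall x, m <= f x) -> (m%:E <= ess_inf_rV f)%E.
Proof. by move=> mf; apply/ess_infP; apply: nearW => x; rewrite lee_fin. Qed.

Lemma spaceSP f (m : R) : measurable_fun setT f -> (forall x, m <= f x) ->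
  (forall t, m <= t -> (mu [set x | (t < f x)%R] < +oo)%E) -> spaceS f.
Proof.
move=> mf fm ft; split => // t t1; apply: ft.
by rewrite -lee_fin; apply: le_trans (ltW t1); exact: le_ess_inf_rV.
Qed.

End function_spaces.

Lemma lte_real_between (R : realFieldType) (x y : \bar R) : (x < y)%E ->
  exists r : R, (x < r%:E < y)%E.
Proof.
case: x y => [x| |] [y| |]//=; rewrite ?lte_fin ?ltxx// => xy.
- by exists ((x + y) / 2); rewrite !lte_fin !midf_lt.
- by exists (x + 1); rewrite lte_fin ltry ltrDl ltr01.
- by exists (y - 1); rewrite lte_fin ltNyr gtrDl oppr_lt0 ltr01.
- by exists 0; rewrite ltry ltNyr.
Qed.

(** * Superlevel sets of rearranged functions *)

Section rearrangement.
Context {R : realType} {n : nat}.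
Hypothesis n_gt0 : (0 < n)%N.
Implicit Types (x y v : 'rV[R]_n) (A B C : set 'rV[R]_n) (f g F G : 'rV[R]_n -> R).
Local Notation mu := (@lebesgue_measure_rV R n).
Context (X : set ('rV[R]_n -> R)) (X_SV : X = spaceS \/ X = spaceV).
Context (T : ('rV[R]_n -> R) -> 'rV[R]_n -> R) (T_rearr : rearrangement X T).

Let X_measurable f : X f -> measurable_fun setT f.
Proof. by case: X_SV => -> []. Qed.

Let ess_inf_lt_fin f (t : R) : X f -> (ess_inf_rV f < t%:E)%E ->
  (mu [set x | (t < f x)%R] < +oo)%E.
Proof.
case: X_SV => -> [mf]; first by move=> h /h.
move=> f0 h ft; apply: h; rewrite -lte_fin; apply: le_lt_trans ft.
exact: le_ess_inf_rV.
Qed.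

Let XT f : X f -> X (T f). Proof. by have [h _ _] := T_rearr; exact: h. Qed.

Let superlevel f (t : R) := [set x | t < f x].

Let mT f t : X f -> measurable (superlevel (T f) t).
Proof. by move=> /XT/X_measurable; exact: measurable_superlevel. Qed.

Let muT f t : X f -> mu (superlevel (T f) t) = mu (superlevel f t).
Proof. by have [_ h _] := T_rearr => /h ->. Qed.

Let ess_eq A B := ess_subset A B /\ ess_subset B A.

Let ess_eq_sym A B : ess_eq A B -> ess_eq B A. Proof. by case. Qed.

Let ess_eq_trans B A C : ess_eq A B -> ess_eq B C -> ess_eq A C.
Proof. by move=> [AB BA] [BC CB]; split; [exact: ess_subset_trans AB BC|exact: ess_subset_trans CB BA]. Qed.

(* T F and T G have the same superlevel set at a height where the comparable
   functions F and G do, because the two superlevel sets are nested and of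
   equal finite measure. *)
Let same_level F G (s : R) A : X F -> X G -> (forall x, F x <= G x) ->
  superlevel F s = A -> superlevel G s = A -> (mu A < +oo)%E ->
  ess_eq (superlevel (T F) s) (superlevel (T G) s).
Proof.
move=> XF XG FG FA GA Aoo.
have sub : ess_subset (superlevel (T F) s) (superlevel (T G) s).
  have [_ _ /(_ F G XF XG)] := T_rearr; move=> /(_ _)/negligibleS; apply.
    by move=> x [/= sF sG] FGx; apply: sG; exact: lt_le_trans FGx.
  exact: aeW.
split => //; apply: ess_subset_eq_measure => //; rewrite ?muT ?FA ?GA//; exact: mT.
Qed.

(** Heights not separated by values of [F] are not separated by [T F] either: nested sets of equal
    finite measure agree up to a null set. *)
Let shift_level F (s s' : R) A : X F -> superlevel F s = A -> superlevel F s' = A ->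
  (mu A < +oo)%E -> ess_eq (superlevel (T F) s) (superlevel (T F) s').
Proof.
wlog ss' : s s' / s <= s' => [hw|] XF FA FA' Aoo.
  have [/hw|/ltW/hw] := leP s s'; first exact.
  by move=> h; apply: ess_eq_sym; exact: h.
have sub : ess_subset (superlevel (T F) s') (superlevel (T F) s).
  by apply: subset_ess => x /=; exact: le_lt_trans.
split => //; apply: ess_subset_eq_measure => //; rewrite ?muT ?FA ?FA'//; exact: mT.
Qed.

Let step A (a b : R) x := b + (a - b) * \1_A x.

Let step_in A a b x : A x -> step A a b x = a.
Proof. by move=> Ax; rewrite /step indicE mem_set//=; lra. Qed.

Let step_out A a b x : ~ A x -> step A a b x = b.
Proof. by move=> Ax; rewrite /step indicE memNset//=; lra. Qed.

Let measurable_step A a b : measurable A -> measurable_fun setT (step A a b).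
Proof.
move=> mA; apply: measurable_funD => //; exact: measurable_funM.
Qed.

Let superlevel_step A (a b s : R) : b <= s -> s < a -> superlevel (step A a b) s = A.
Proof.
move=> bs sa; apply/seteqP; split => x; rewrite /superlevel/=.
  by apply: contraPP => /step_out ->; rewrite ltNge bs.
by move=> /step_in ->.
Qed.

Let superlevel_step_fin A (a b s : R) : (mu A < +oo)%E -> b <= s ->
  (mu (superlevel (step A a b) s) < +oo)%E.
Proof.
move=> Aoo bs; apply: le_lt_trans Aoo; apply: le_lebesgue_measure => x.
rewrite /superlevel/=; apply: contraPP => /step_out ->.
by rewrite ltNge bs.
Qed.

Let X_step A (a b : R) : measurable A -> (mu A < +oo)%E -> b <= a ->
  (X = spaceV -> b = 0) -> X (step A a b).
Proof.
move=> mA Aoo ba Vb; have sb x : b <= step A a b x.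
  by have [/step_in ->|/step_out ->] := pselect (A x).
case: X_SV => XE; rewrite XE.
  apply: (spaceSP (m := b)) => //; first exact: measurable_step.
  by move=> t; exact: superlevel_step_fin.
have b0 := Vb XE; split; first exact: measurable_step.
  by rewrite -{1}b0.
by move=> t t0; apply: superlevel_step_fin => //; rewrite b0 ltW.
Qed.

Let indic_step A : \1_A = step A 1 0.
Proof. by apply/funext => x; rewrite /step subr0 mul1r add0r. Qed.

Let X_indic A : measurable A -> (mu A < +oo)%E -> X \1_A.
Proof. by move=> mA Aoo; rewrite indic_step; exact: X_step. Qed.

(** The set rearrangement [D] of the overview. As a superlevel set, unlike [diamond], it is directly
    subject to equimeasurability and monotonicity. *)
Definition rearr_set A := [set x | 0 < T \1_A x].

Lemma measurable_rearr_set A : measurable A -> (mu A < +oo)%E -> measurable (rearr_set A).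
Proof. by move=> mA Aoo; apply: mT; exact: X_indic. Qed.

Lemma rearr_set_measure A : measurable A -> (mu A < +oo)%E -> mu (rearr_set A) = mu A.
Proof.
move=> mA Aoo; rewrite (muT 0 (X_indic mA Aoo)) indic_step.
by rewrite superlevel_step.
Qed.

Lemma le_rearr_set A B : measurable A -> measurable B -> (mu B < +oo)%E -> A `<=` B ->
  ess_subset (rearr_set A) (rearr_set B).
Proof.
move=> mA mB Boo AB; have Aoo : (mu A < +oo)%E.
  by apply: le_lt_trans Boo; exact: le_lebesgue_measure.
have [_ _ /(_ \1_A \1_B)] := T_rearr.
move=> /(_ (X_indic mA Aoo) (X_indic mB Boo) _)/negligibleS; apply.
  by move=> x [/= a b] AB'; apply: b; exact: lt_le_trans AB'.
apply: aeW => x; rewrite !indicE ler_nat; case: (boolP (x \in A)) => //.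
by rewrite inE => /AB/mem_set ->.
Qed.

(** The image of the intersection is essentially contained in both images, so their intersection has
    at least the measure of the intersection of [A] and [B], whereas the image of [A] has the
    measure of [A]. *)
Lemma rearr_setD A B : measurable A -> measurable B -> (mu A < +oo)%E -> (mu B < +oo)%E ->
  (mu (rearr_set A `\` rearr_set B) <= mu (A `\` B))%E.
Proof.
move=> mA mB Aoo Boo.
have mI : measurable (A `&` B) by exact: measurableI.
have Ioo : (mu (A `&` B) < +oo)%E.
  by apply: le_lt_trans Aoo; apply: le_lebesgue_measure; exact: subIsetl.
have If : mu (A `&` B) \is a fin_num by rewrite ge0_fin_numE ?outer_measure_ge0.
have mDA := measurable_rearr_set mA Aoo.
have mDB := measurable_rearr_set mB Boo.
have le : (mu (A `&` B) <= mu (rearr_set A `&` rearr_set B))%E.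
  rewrite -rearr_set_measure//.
  suff /(ess_subset_measure setT) :
      ess_subset (rearr_set (A `&` B)) (rearr_set A `&` rearr_set B) by rewrite !setIT.
  rewrite /ess_subset setDIr; apply: negligibleU.
    by apply: le_rearr_set => //; exact: subIsetl.
  by apply: le_rearr_set => //; exact: subIsetr.
rewrite -(leeD2rE _ _ If) -(lebesgue_measureDI mA mB) -(rearr_set_measure mA Aoo).
by rewrite [leRHS](lebesgue_measureDI mDA mDB) leeD2l.
Qed.

(** Almost everywhere [T \1_A] does not exceed [1], and it takes no value in []0, 1 - 1 / (k + 1)]]
    because the superlevel sets of [\1_A] at both ends coincide. *)
Lemma diamond_rearr_set A : measurable A -> (mu A < +oo)%E ->
  ess_subset (diamond T A) (rearr_set A) /\ ess_subset (rearr_set A) (diamond T A).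
Proof.
move=> mA Aoo; have XA := X_indic mA Aoo; split.
  by apply: subset_ess => x; rewrite /diamond/rearr_set/= => ->.
have N1 : mu.-negligible (superlevel (T \1_A) 1).
  apply/negligibleP_rV; rewrite muT// (_ : superlevel _ _ = set0) ?measure0//.
  apply/seteqP; split => // x; rewrite /superlevel/= indicE.
  by case: (x \in A); rewrite ?ltxx// ltNge ler01.
have N2 k : mu.-negligible (rearr_set A `\` superlevel (T \1_A) (1 - k.+1%:R^-1)).
  have /andP[k0 k1] : 0 < (k.+1%:R^-1 : R) <= 1 by rewrite invr_gt0 ltr0n/= invf_le1// ler1n.
  have [|||sub _] := @shift_level \1_A 0 (1 - k.+1%:R^-1) A XA => //.
  - by rewrite indic_step superlevel_step.
  - by rewrite indic_step superlevel_step ?subr_ge0 ?gtrBl.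
apply: (negligibleS _ (negligibleU N1 (negligible_bigcup N2))) => x [x0 x1].
have [x2|x2|x2] := ltgtP (T \1_A x) 1; [right|by left|by []].
have d0 : 0 < 1 - T \1_A x by lra.
exists (Num.bound (1 - T \1_A x)^-1) => //; split => //; rewrite /superlevel/= => x3.
set k := Num.bound _ in x3.
have : k.+1%:R^-1 < 1 - T \1_A x.
  by rewrite invf_plt ?posrE// (lt_le_trans (unstable.ltr_bound _))// ler_nat.
by rewrite ltrBrDl -ltrBrDr => /(lt_trans x3); rewrite ltxx.
Qed.

(** The functions [f] and [\1_A] need not be comparable, so they are linked by a chain: [f <= F],
    [H <= F], then [H] moved from height [t] to height [0], then [H] against [\1_A]. All of them
    have the superlevel set [A] at the heights concerned. *)
Lemma superlevel_rearr f (t : R) : X f -> (ess_inf_rV f < t%:E)%E ->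
  ess_subset [set x | t < T f x] (rearr_set [set x | t < f x]) /\
  ess_subset (rearr_set [set x | t < f x]) [set x | t < T f x].
Proof.
move=> Xf ft; set A := [set x | t < f x].
have mf := X_measurable Xf.
have mA : measurable A by exact: measurable_superlevel.
have Aoo : (mu A < +oo)%E by exact: ess_inf_lt_fin.
have f0 : X = spaceV -> (forall x, 0 <= f x) /\ 0 < t.
  move=> XV; have f0 : forall x, 0 <= f x by move: Xf; rewrite XV => -[].
  by split=> //; rewrite -lte_fin; apply: le_lt_trans ft; exact: le_ess_inf_rV.
(* On [A] the value [a] exceeds [t], is at least [1], and equals [1] when [t <= 0], so [H] is
   comparable with [\1_A] whatever the sign of [t]. *)
pose a := Num.max t 0 + 1.
have ta : t < a by rewrite /a; have : t <= Num.max t 0 by [rewrite le_max lexx]; lra.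
have a0 : 0 < a by rewrite /a; have : 0 <= Num.max t 0 by [rewrite le_max lexx orbT]; lra.
(* The value [b] off [A] depends on the space: [t] in [spaceS], which bounds [F] from below by [t],
   and [0] in [spaceV]. The last condition yields [H <= F] off [A]. *)
have [b [bt XF bH]] : exists b, [/\ b <= t, X (fun x => Num.max (f x) (step A a b x)) &
    forall x, ~ A x -> Num.min t 0 <= Num.max (f x) b].
  have mF b : measurable_fun setT (fun x => Num.max (f x) (step A a b x)).
    by apply: measurable_maxr => //; exact: measurable_step.
  case: X_SV => XE.
    exists t; split => // [|x _]; last by rewrite ge_min le_max lexx orbT.
    rewrite XE; apply: (spaceSP (m := t)) => // [x|s ts].
      by rewrite le_max; have [/step_in ->|/step_out ->] := pselect (A x);
        rewrite ?lexx ?(ltW ta) orbT.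
    apply: le_lt_trans Aoo; apply: le_lebesgue_measure => x /=; rewrite lt_max => /orP[|].
      by apply: le_lt_trans ts.
    by apply: contraPP => /step_out ->; rewrite ltNge ts.
  have [f0' t0] := f0 XE; have [_ _ foo] : spaceV f by rewrite -XE.
  exists 0; split => [|| x _]; [exact: ltW| |by rewrite ge_min !le_max f0' orbT].
  rewrite XE; split=> // [x|s s0]; first by rewrite le_max f0'.
  apply: (@le_lt_trans _ _ (mu (superlevel f s `|` A))).
    apply: le_lebesgue_measure => x; rewrite /superlevel/= lt_max.
    move=> /orP[->|]; first by left.
    move=> p; right; apply: contrapT => /step_out e; by move: p; rewrite e ltNge (ltW s0).
  by rewrite (le_lt_trans (lebesgue_measureU2 _ _))// lte_add_pinfty// foo.
pose F x := Num.max (f x) (step A a b x).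
pose H := step A a (Num.min t 0).
have XH : X H.
  apply: X_step => //; last by move=> /f0[_ t0]; rewrite min_r// ltW.
  by rewrite ge_min (ltW ta).
have FA : superlevel F t = A.
  apply/seteqP; split => x; rewrite /superlevel/F/= lt_max; last by move=> ->.
  move=> /orP[//|]; apply: contraPP => /step_out ->.
  by rewrite ltNge bt.
have A1 : superlevel \1_A 0 = A by rewrite indic_step superlevel_step.
have s1 : ess_eq (superlevel (T f) t) (superlevel (T F) t).
  by apply: (same_level (A := A)) => // x; rewrite le_max lexx.
have s2 : ess_eq (superlevel (T H) t) (superlevel (T F) t).
  apply: (same_level (A := A)) => //.
    move=> x; rewrite /H /F le_max.
    have [Ax|Ax] := pselect (A x); first by rewrite !step_in// lexx orbT.
    by rewrite !step_out// -le_max; exact: bH.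
  by rewrite superlevel_step// ge_min lexx.
have s3 : ess_eq (superlevel (T H) t) (superlevel (T H) 0).
  by apply: (shift_level (A := A)) => //; rewrite superlevel_step// ge_min lexx ?orbT.
have s4 : ess_eq (superlevel (T H) 0) (rearr_set A).
  rewrite /rearr_set -/(superlevel (T \1_A) 0).
  have H0 : superlevel H 0 = A by rewrite superlevel_step// ge_min lexx orbT.
  have X1 := X_indic mA Aoo.
  have [t0|t0] := leP 0 t.
    apply: ess_eq_sym; apply: (same_level (A := A)) => // x; rewrite indic_step /H.
    have [Ax|Ax] := pselect (A x); last by rewrite !step_out// le_min t0 lexx.
    by rewrite !step_in// /a lerDr le_max lexx orbT.
  apply: (same_level (A := A)) => // x; rewrite indic_step /H.
  have [Ax|Ax] := pselect (A x); last by rewrite !step_out// ge_min lexx orbT.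
  by rewrite !step_in// /a max_r ?add0r// ltW.
exact: ess_eq_trans s1 (ess_eq_trans (ess_eq_sym s2) (ess_eq_trans s3 s4)).
Qed.

(** At a height strictly between the two infima in the wrong order, the superlevel set of [T f]
    would have finite measure and that of [f] infinite measure. *)
Lemma le_ess_inf_rearr f : X f -> (ess_inf_rV f <= ess_inf_rV (T f))%E.
Proof.
move=> Xf; rewrite leNgt; apply/negP => /lte_real_between[t /andP[t1 t2]].
have := ess_inf_lt_fin (XT Xf) t1.
by rewrite (muT t Xf) (ess_inf_infinite n_gt0 t2).
Qed.

End rearrangement.

(** * Lipschitz functions and parallel sets *)

Section lipschitz.
Context {R : realType} {n : nat}.
Hypothesis n_gt0 : (0 < n)%N.
Implicit Types (x y v : 'rV[R]_n) (A B C : set 'rV[R]_n) (f g : 'rV[R]_n -> R).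
Local Notation mu := (@lebesgue_measure_rV R n).

Lemma elipschitz_ge0 f : elipschitz f ->
  exists2 L : R, 0 <= L & forall x y, `|f x - f y| <= L * enorm (x - y).
Proof.
move=> [L fL]; exists (Num.max L 0); first by rewrite le_max lexx orbT.
by move=> x y; apply: (le_trans (fL x y)); rewrite ler_wpM2r ?enorm_ge0// le_max lexx.
Qed.

Lemma elipschitz_continuous f : elipschitz f -> continuous f.
Proof.
move=> /elipschitz_ge0[L L0 fL] x.
apply/(@cvgrPdist_lt _ _ _ (nbhs x)) => e e0.
have d0 : 0 < e / (L * n%:R + 1) by rewrite divr_gt0// ltr_wpDl// mulr_ge0.
near=> y; apply: (le_lt_trans (fL x y)).
apply: (@le_lt_trans _ _ (L * (n%:R * `|x - y|))).
  by rewrite ler_wpM2l// enorm_le_norm.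
have : `|x - y| < e / (L * n%:R + 1) by near: y; exact: cvgr_dist_lt.
have L1 : 0 < L * n%:R + 1 by rewrite ltr_wpDl// mulr_ge0.
rewrite ltr_pdivlMr// => h; apply: le_lt_trans h.
by rewrite mulrA mulrC ler_wpM2l// lerDl.
Unshelve. all: by end_near. Qed.

Lemma open_superlevel f (t : R) : continuous f -> open [set x | t < f x].
Proof.
move=> cf; rewrite (_ : [set x | _] = f @^-1` [set r | t < r])//.
by apply: open_comp => [x _|]; [exact: cf|exact: open_gt].
Qed.

Lemma open_cube A x : open A -> A x -> exists2 r : R, 0 < r & cube x r `<=` A.
Proof.
move=> oA Ax.
have [e /= e0 eA] := (nbhs_normP _ _).1 (open_nbhs_nbhs (conj oA Ax)).
exists (e / 2); first by rewrite divr_gt0.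
move=> y /(cube_norm n_gt0) xy; apply: eA; rewrite /ball_/= distrC.
by apply: le_lt_trans xy _; lra.
Qed.

Lemma open_measure_gt0 A x : open A -> A x -> (0 < mu A)%E.
Proof.
move=> oA Ax; have [r r0 rA] := open_cube oA Ax.
apply: lt_le_trans (le_lebesgue_measure rA).
by rewrite (cube_measure n_gt0) ?ltW// lte_fin exprn_gt0// mulr_gt0.
Qed.

Lemma ess_inf_le_continuous f x : continuous f -> (ess_inf_rV f <= (f x)%:E)%E.
Proof.
move=> cf; rewrite leNgt; apply/negP => /lte_real_between[t /andP[]].
rewrite lte_fin => t1 t2.
have oA : open [set y | f y < t].
  rewrite (_ : [set x | _] = f @^-1` [set r | r < t])//.
  by apply: open_comp => [y _|]; [exact: cf|exact: open_lt].
have := open_measure_gt0 oA t1; apply/negP; rewrite -leNgt.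
rewrite (_ : mu _ = 0%E)//; apply/negligibleP_rV.
apply: (negligibleS _ (ess_inf_le mu (EFin \o f))) => y /= fy h.
by have := lt_le_trans t2 h; rewrite lte_fin ltNge (ltW fy).
Qed.

(* Around each point of the higher superlevel set the lower one contains a cube
   of a fixed size, while its measure outside of large cubes tends to 0. *)
Lemma bounded_superlevel f (t t' : R) : elipschitz f -> t' < t ->
  (mu [set x | (t' < f x)%R] < +oo)%E ->
  exists M : R, forall x, t < f x -> `|x| <= M.
Proof.
move=> flip tt' Uoo; have [L L0 fL] := elipschitz_ge0 flip.
have cf := elipschitz_continuous flip.
set U := [set x | t' < f x].
have mU : measurable U by apply: measurable_open_rV => //; exact: open_superlevel.
have Ln : 0 < L * n%:R + 1 by rewrite ltr_wpDl// mulr_ge0.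
pose r := (t - t') / (L * n%:R + 1) / 2.
have r0 : 0 < r by rewrite divr_gt0// divr_gt0// subr_gt0.
have rU x : t < f x -> cube x r `<=` U.
  move=> tx y /(cube_norm n_gt0) xy; rewrite /U/=.
  have : f x - f y < t - t'.
    apply: le_lt_trans (ler_norm _) _; apply: le_lt_trans (fL x y) _.
    rewrite enormB; apply: (@le_lt_trans _ _ (L * (n%:R * r))).
      by rewrite ler_wpM2l// (le_trans (enorm_le_norm _))// ler_wpM2l.
    have -> : t - t' = (L * n%:R + 1) * r * 2 by rewrite /r; field; rewrite gt_eqF.
    have h := mulr_ge0 L0 (mulr_ge0 (ler0n R n) (ltW r0)).
    lra.
  by move=> ?; lra.
pose F k := U `\` cube 0 k%:R.
have mF k : measurable (F k) by apply: measurableD => //; exact: measurable_cube.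
have F0 : \bigcap_k F k = set0.
  apply/seteqP; split => // x Fx; have : setT x by [].
  by rewrite -bigcup_cube => -[k _ kx]; have [] := Fx k Logic.I.
have : mu (F k) @[k --> \oo] --> mu (\bigcap_k F k).
  apply: nonincreasing_cvg_mu => //.
  - by apply: le_lt_trans Uoo; apply: le_lebesgue_measure; exact: subDsetl.
  - by apply: bigcap_measurable => //; exists 0%N.
  - move=> k l kl; apply/subsetPset => x [Ux xl]; split => // /cubeP xk; apply: xl.
    apply/cubeP => i; have : (k%:R : R) <= l%:R by rewrite ler_nat.
    by have := xk i; rewrite !mxE; lra.
rewrite F0 measure0 => /fine_cvgP[_ /cvgrPdist_lt].
move=> /(_ ((2 * r) ^+ n)) [|k _ /(_ k (leqnn k))/=]; first by rewrite exprn_gt0// mulr_gt0.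
rewrite sub0r normrN ger0_norm ?fine_ge0 ?outer_measure_ge0// => Fk.
exists (k%:R + r) => x tx; rewrite leNgt; apply/negP => xk.
move: Fk; apply/negP; rewrite -leNgt -lee_fin fineK; last first.
  rewrite ge0_fin_numE ?outer_measure_ge0//.
  by apply: le_lt_trans Uoo; apply: le_lebesgue_measure; exact: subDsetl.
rewrite -(cube_measure n_gt0 x (ltW r0)); apply: le_lebesgue_measure => y xy; split.
  exact: rU xy.
move=> /(cube_norm n_gt0); rewrite subr0 => yk.
have := cube_norm n_gt0 xy; rewrite distrC => yx.
have := le_trans (ler_distD y x 0) (lerD yx (_ : `|y - 0| <= k%:R)).
by rewrite !subr0 => /(_ yk); rewrite [r + _]addrC leNgt xk.
Qed.

Section parallel.
Implicit Types (h : R).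

Lemma parallel_setP A h z : 0 < h ->
  parallel_set A h z <-> exists2 x, A x & enorm (z - x) <= h.
Proof.
move=> h0; split=> [[x Ax [_ [y y1 <-] <-]]|[x Ax xz]].
  exists x => //; rewrite addrC addKr enormZ gtr0_norm// ler_piMr// ?(ltW h0)//.
  by move: y1; rewrite /eball/= subr0.
exists x => //; exists (z - x); last by rewrite addrC subrK.
exists (h^-1 *: (z - x)); last by rewrite scalerA divff ?gt_eqF// scale1r.
by rewrite /eball/= subr0 enormZ gtr0_norm ?invr_gt0// mulrC ler_pdivrMr// mul1r.
Qed.

Lemma open_parallel_set A h : 0 < h -> open A -> open (parallel_set A h).
Proof.
move=> h0 oA; rewrite openE => z /(parallel_setP _ _ h0)[x Ax xz].
have [r r0 rA] := open_cube oA Ax.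
suff : nbhs z (parallel_set A h) by [].
apply: (nbhs_normP z (parallel_set A h)).2; exists r => //= w; rewrite /ball_/= => zw.
apply/(parallel_setP _ _ h0); exists (x + (w - z)).
  by apply: rA; apply: norm_cube; rewrite addrC addKr distrC.
by rewrite (_ : w - _ = z - x)//; apply/rowP => i; rewrite !mxE; lra.
Qed.

Lemma le_parallel_set A B h : 0 < h -> A `<=` B -> parallel_set A h `<=` parallel_set B h.
Proof.
move=> h0 AB z /(parallel_setP _ _ h0)[x /AB Bx xz].
by apply/(parallel_setP _ _ h0); exists x.
Qed.

Lemma bounded_measure_lty A (M : R) : (forall x, A x -> `|x| <= M) -> (mu A < +oo)%E.
Proof.
move=> AM; apply: (@le_lt_trans _ _ (mu (cube 0 (Num.max M 0 + 1)))).
  apply: le_lebesgue_measure => x /AM xM; apply: norm_cube; rewrite subr0.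
  by apply: (le_lt_trans xM); rewrite ltr_pwDr// le_max lexx.
by rewrite (cube_measure n_gt0) ?ltry// addr_ge0// le_max lexx orbT.
Qed.

Lemma parallel_set_bounded A h (M : R) : 0 < h -> (forall x, A x -> `|x| <= M) ->
  forall x, parallel_set A h x -> `|x| <= M + h.
Proof.
move=> h0 AM x /(parallel_setP _ _ h0)[y Ay xy].
rewrite (_ : x = y + (x - y)); last by rewrite addrC subrK.
apply: (le_trans (ler_normD _ _)); apply: lerD; first exact: AM.
exact: le_trans (norm_le_enorm _) xy.
Qed.

Lemma parallel_superlevel f (t h L : R) : 0 <= L -> 0 < h ->
  (forall x y, `|f x - f y| <= L * enorm (x - y)) ->
  parallel_set [set x | t < f x] h `<=` [set x | t - L * h < f x].
Proof.
move=> L0 h0 fL z /(parallel_setP _ _ h0)[x /= tx xz].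
have : f x - f z <= L * h.
  apply: le_trans (ler_norm _) _; apply: le_trans (fL x z) _.
  by rewrite enormB ler_wpM2l.
by move=> ?; lra.
Qed.

End parallel.

Lemma density_points0 : density_points set0 = set0 :> set 'rV[R]_n.
Proof.
apply/seteqP; split => // x xd.
have h : fine (mu (set0 `&` eball x r)) / fine (mu (eball x r)) @[r --> 0^'+] --> (1 : R) := xd.
have h0 : fine (mu (set0 `&` eball x r)) / fine (mu (eball x r)) @[r --> 0^'+] --> (0 : R).
  apply: cvg_near_cst; apply: nearW => r.
  by rewrite set0I measure0 mul0r.
have h01 : (0 : R) = 1 by exact: (norm_cvg_unique h0 h).
by have /eqP := esym h01; rewrite oner_eq0.
Qed.

End lipschitz.

Lemma ae_forall_countable d (T : measurableType d) (R : realType) (m : {measure set T -> \bar R})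
    (I : countType) (P : I -> T -> Prop) :
  (forall i, \forall x \ae m, P i x) -> \forall x \ae m, forall i, P i x.
Proof.
move=> aeP; pose Q k x := if unpickle k is Some i then P i x else True.
have aeQ k : \forall x \ae m, Q k x by rewrite /Q; case: unpickle => //; exact: aeW.
have := ae_foralln aeQ; apply: filterS => x Qx i.
by have := Qx (pickle i); rewrite /Q pickleK.
Qed.

(** * The Lipschitz representative *)

Section smoothing.
Context {R : realType} {n : nat}.
Hypothesis n_gt0 : (0 < n)%N.
Implicit Types (x y v : 'rV[R]_n) (A B C : set 'rV[R]_n).
Local Notation mu := (@lebesgue_measure_rV R n).
Context (X : set ('rV[R]_n -> R)) (X_SV : X = spaceS \/ X = spaceV).
Context (T : ('rV[R]_n -> R) -> 'rV[R]_n -> R) (T_rearr : rearrangement X T).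
Hypothesis T_smooth : smoothing T.

(** The smoothing property carried over from [diamond] to [rearr_set]: the two agree up to null
    sets, hence have the same density points. *)
Lemma smoothing_rearr_set A (h M : R) : open A -> (forall x, A x -> `|x| <= M) -> 0 < h ->
  ess_subset (parallel_set (density_points (rearr_set T A)) h) (rearr_set T (parallel_set A h)).
Proof.
move=> oA AM h0.
have oP := open_parallel_set n_gt0 h0 oA.
have PM := parallel_set_bounded h0 AM.
have mA := measurable_open_rV n_gt0 oA.
have mP := measurable_open_rV n_gt0 oP.
have [DA AD] := diamond_rearr_set X_SV T_rearr mA (bounded_measure_lty n_gt0 AM).
have [DP PD] := diamond_rearr_set X_SV T_rearr mP (bounded_measure_lty n_gt0 PM).
have bA : bounded_set A.
  by exists M; split=> [|K MK x Ax]; [exact: num_real|exact: le_trans (AM _ Ax) (ltW MK)].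
apply: (@ess_subset_trans _ _ (parallel_set (diamond_star T A) h)).
  by apply: subset_ess; apply: le_parallel_set => //; exact: sub_density_points.
apply: ess_subset_trans (T_smooth h0 mA bA) _.
apply: (@ess_subset_trans _ _ (density_points (rearr_set T (parallel_set A h)))).
  by apply: subset_ess; exact: sub_density_points.
apply: density_points_ess_sub => //.
exact: (measurable_rearr_set X_SV T_rearr mP (bounded_measure_lty n_gt0 PM)).
Qed.

Context (f : 'rV[R]_n -> R) (Xf : X f) (f_lip : elipschitz f).

Let U t := [set x | t < f x].
Let W t := [set x | t < T f x].
(** A canonical representative of [W t], determined by the class of [W t] modulo null sets;
    inclusions between the sets [E t] hold at every point. *)
Let E t := density_points (W t).

Let cf : continuous f. Proof. exact: elipschitz_continuous. Qed.

Let mT : measurable_fun setT (T f).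
Proof.
have [/(_ f Xf) XTf _ _] := T_rearr.
by move: XTf; case: X_SV => -> [].
Qed.

Let mW t : measurable (W t). Proof. exact: measurable_superlevel. Qed.

Let mU t : measurable (U t).
Proof. by apply: measurable_open_rV => //; exact: open_superlevel. Qed.

Lemma superlevel_finite t : (ess_inf_rV f < t%:E)%E -> (mu (U t) < +oo)%E.
Proof.
move: Xf; case: X_SV => -> [_]; first by move=> h /h.
move=> f0 h ft; apply: h; rewrite -lte_fin; apply: le_lt_trans ft.
exact: le_ess_inf_rV.
Qed.

(** This makes the superlevel sets admissible for smoothing; the gap between [t] and the essential
    infimum leaves room for a lower height with finite measure. *)
Lemma superlevel_bounded t : (ess_inf_rV f < t%:E)%E ->
  exists M : R, forall x, U t x -> `|x| <= M.
Proof.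
move=> /lte_real_between[t' /andP[ft' t't]].
by apply: (@bounded_superlevel _ _ n_gt0 f t t') => //; exact: superlevel_finite.
Qed.

Lemma smoothing_superlevel t h : (ess_inf_rV f < t%:E)%E -> 0 < h ->
  ess_subset (parallel_set (E t) h) (rearr_set T (parallel_set (U t) h)).
Proof.
move=> ft h0; have [M UM] := superlevel_bounded ft.
have [WU UW] := superlevel_rearr X_SV T_rearr Xf ft.
apply: (@ess_subset_trans _ _ (parallel_set (density_points (rearr_set T (U t))) h)); last first.
  by apply: (smoothing_rearr_set _ UM h0); exact: open_superlevel.
by apply: subset_ess; apply: le_parallel_set => //; exact: sub_density_points.
Qed.

Let le_E s t : s <= t -> E t `<=` E s.
Proof.
move=> st; apply: sub_density_points => //; apply: subset_ess => x.
by rewrite /W/=; exact: le_lt_trans.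
Qed.

Context (L : R) (L0 : 0 <= L) (fL : forall x y, `|f x - f y| <= L * enorm (x - y)).

(** Since [enorm (x - y) < h] is strict, a whole neighbourhood of [y] lies in [E t + h B]. By
    smoothing it is essentially contained in [W (t - L * h)], which makes [y] itself a density
    point. *)
Let E_shift t h x y : (ess_inf_rV f < (t - L * h)%:E)%E -> enorm (x - y) < h ->
  E t x -> E (t - L * h) y.
Proof.
move=> ft xy Ex; have h0 : 0 < h by apply: le_lt_trans xy; exact: enorm_ge0.
have ft' : (ess_inf_rV f < t%:E)%E.
  by apply: (lt_le_trans ft); rewrite lee_fin gerBl mulr_ge0// ltW.
have n0 : (0 : R) < n%:R by rewrite ltr0n.
apply: (@density_points_interior _ _ n_gt0 _ _ ((h - enorm (x - y)) / n%:R)).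
  by rewrite divr_gt0// subr_gt0.
apply: (@ess_subset_trans _ _ (parallel_set (E t) h)).
  apply: subset_ess => z /=; rewrite ltr_pdivlMr// mulrC => zy.
  apply/(parallel_setP _ _ h0); exists x => //.
  rewrite (_ : z - x = (z - y) + (y - x)); last by rewrite addrA subrK.
  apply: (le_trans (enormD _ _)); rewrite [enorm (y - x)]enormB.
  have := enorm_le_norm (z - y); move=> ?; lra.
apply: ess_subset_trans (smoothing_superlevel ft' h0) _.
have [_] := superlevel_rearr X_SV T_rearr Xf ft.
apply: ess_subset_trans.
have sub : parallel_set (U t) h `<=` U (t - L * h) by exact: parallel_superlevel.
have Uoo := superlevel_finite ft.
have mP : measurable (parallel_set (U t) h).
  by apply: measurable_open_rV => //; apply: open_parallel_set => //; exact: open_superlevel.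
exact: (le_rearr_set X_SV T_rearr mP (mU _) Uoo sub).
Qed.

Let fB : exists B : R, forall x, f x <= B.
Proof.
have := ess_inf_le_continuous n_gt0 0 cf => m0.
have [M UM] : exists M : R, forall x, U (f 0 + 1) x -> `|x| <= M.
  by apply: superlevel_bounded; apply: (le_lt_trans m0); rewrite lte_fin ltrDl.
exists (Num.max (f 0 + 1) (f 0 + L * (n%:R * M))) => x.
rewrite le_max; have [//|/UM xM] := leP (f x) (f 0 + 1).
apply/orP; right; rewrite -lerBlDl.
apply: (le_trans (ler_norm _)); apply: (le_trans (fL _ _)); rewrite subr0 ler_wpM2l//.
by apply: (le_trans (enorm_le_norm _)); rewrite ler_wpM2l.
Qed.

(** The heights up to the essential infimum belong to [S x] by default, so [sup (S x)] does not fall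
    below it even if [x] lies in no [E t]. *)
Let S x := [set t : R | (ess_inf_rV f < t%:E)%E -> E t x].

Let S_down x s t : s <= t -> S x t -> S x s.
Proof.
move=> st St fs; apply: (le_E st); apply: St.
by apply: (lt_le_trans fs); rewrite lee_fin.
Qed.

Let S_ub x : has_ubound (S x).
Proof.
have [B fB'] := fB; exists B => t St; rewrite leNgt; apply/negP => Bt.
have Et : E t x.
  apply: St; apply: (le_lt_trans (ess_inf_le_continuous n_gt0 0 cf)).
  by rewrite lte_fin (le_lt_trans (fB' 0)).
suff : density_points set0 x by rewrite density_points0.
apply: (sub_density_points n_gt0 _ Et); rewrite /ess_subset setD0.
apply/negligibleP_rV; have [_ /(_ f Xf t) -> _] := T_rearr.
rewrite (_ : [set _ | _] = set0) ?measure0//.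
by apply/seteqP; split => // y /=; rewrite ltNge (ltW (le_lt_trans (fB' y) Bt)).
Qed.

(** If the essential infimum is [-oo] there is no default height. Then some [E t0] has a point, and
    [E_shift] carries it to any [x] at the price of a lower height. *)
Let S_neq0 x : S x !=set0.
Proof.
have [[r mr]|m] : (exists r : R, (r%:E <= ess_inf_rV f)%E) \/ ess_inf_rV f = -oo%E.
- by case: (ess_inf_rV f) => [r| |]; [left; exists r|left; exists 0; rewrite leey|right].
- by exists r => /= mr'; have := lt_le_trans mr' mr; rewrite ltxx.
- pose t0 := f 0 - 1.
  have ft0 : (ess_inf_rV f < t0%:E)%E by rewrite m ltNyr.
  have [x0 Ex0] : exists x0, E t0 x0.
    apply: contrapT => /forallNP h.
    have := ess_sub_density_points n_gt0 (mW t0).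
    rewrite /ess_subset (_ : density_points _ = set0) ?setD0; last first.
      by apply/seteqP; split=> // z /h.
    move=> /negligibleP_rV W0; have [_ /(_ f Xf t0) WU _] := T_rearr.
    have U0 : mu (U t0) = 0%E by rewrite -W0 [RHS]WU.
    have : (0 < mu (U t0))%E.
      apply: (@open_measure_gt0 _ _ n_gt0 _ 0); first exact: open_superlevel.
      by rewrite /U/t0/= gtrBl.
    by rewrite U0 ltxx.
  exists (t0 - L * (enorm (x0 - x) + 1)) => /= h.
  by apply: E_shift Ex0 => //; rewrite ltrDl.
Qed.

Let g x := sup (S x).

Let g_shift x y h : enorm (x - y) < h -> g x <= g y + L * h.
Proof.
move=> xy; apply: (ge_sup (S_neq0 x)) => t St; rewrite -lerBlDr.
apply: (ub_le_sup (S_ub y)) => /= ft.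
have h0 : 0 < h by apply: le_lt_trans xy; exact: enorm_ge0.
apply: (E_shift ft xy); apply: St.
by apply: (lt_le_trans ft); rewrite lee_fin gerBl mulr_ge0// ltW.
Qed.

Lemma lipschitz_rearr : exists g : 'rV[R]_n -> R,
  elipschitz g /\ \forall x \ae mu, T f x = g x.
Proof.
exists g; split.
  have half x y : g x - g y <= L * enorm (x - y).
    apply/ler_addgt0Pr => e e0.
    have L1 : 0 < L + 1 by rewrite ltr_wpDl.
    have e1 : 0 < e / (L + 1) by rewrite divr_gt0.
    have /g_shift : enorm (x - y) < enorm (x - y) + e / (L + 1) by rewrite ltrDl.
    have : L * (e / (L + 1)) <= e.
      by rewrite mulrA mulrAC ler_piMl// ?(ltW e0)// ler_pdivrMr// mul1r lerDl.
    rewrite mulrDr => h1 h2; rewrite lerBlDl; apply: (le_trans h2).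
    by rewrite !lerD2l.
  exists L => x y; rewrite ler_norml half andbT lerNl opprB enormB; exact: half.
(* Rational heights separate the values of [T f] and [g], and a single null set serves all of
   them. *)
have aeWE : \forall x \ae mu, forall q : rat, (ess_inf_rV f < (ratr q)%:E)%E ->
    (W (ratr q) x <-> E (ratr q) x).
  apply: ae_forall_countable => q.
  apply: (negligibleS _ (negligibleU (ess_sub_density_points n_gt0 (mW (ratr q)))
    (density_points_ess_sub n_gt0 (mW (ratr q))))) => x /= h.
  apply: contrapT => h'; apply: h => _; split=> [Wx|Ex].
    by apply: contrapT => nE; apply: h'; left.
  by apply: contrapT => nW; apply: h'; right.
have aem : \forall x \ae mu, (ess_inf_rV f <= (T f x)%:E)%E.
  have := ess_inf_le mu (EFin \o T f); apply: filterS => x; apply: le_trans.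
  exact: (le_ess_inf_rearr n_gt0 X_SV T_rearr Xf).
move: aeWE aem; apply: filterS2 => x WE mx; apply/eqP; rewrite eq_le; apply/andP; split.
- rewrite leNgt; apply/negP => /rat_in_itvoo[q]; rewrite in_itv/= => /andP[gq qT].
  move: gq; rewrite ltNge => /negP; apply; apply: (ub_le_sup (S_ub x)) => /= fq.
  by apply/(WE _ fq).
- rewrite leNgt; apply/negP => /rat_in_itvoo[q]; rewrite in_itv/= => /andP[Tq qg].
  have fq : (ess_inf_rV f < (ratr q)%:E)%E by apply: (le_lt_trans mx); rewrite lte_fin.
  have nEq : ~ E (ratr q) x by move=> /(WE _ fq); rewrite /W/= ltNge (ltW Tq).
  move: qg; rewrite ltNge => /negP; apply; apply: (ge_sup (S_neq0 x)) => t St.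
  rewrite leNgt; apply/negP => qt; apply: nEq.
  exact: (S_down (ltW qt) St).
Qed.

End smoothing.

(** * Comparison of parallel sets *)

Section level_inequality.
Context {R : realType} {n : nat}.
Hypothesis n_gt0 : (0 < n)%N.
Implicit Types (x y v : 'rV[R]_n) (A B C : set 'rV[R]_n) (h : R).
Local Notation mu := (@lebesgue_measure_rV R n).
Context (X : set ('rV[R]_n -> R)) (X_SV : X = spaceS \/ X = spaceV).
Context (T : ('rV[R]_n -> R) -> 'rV[R]_n -> R) (T_rearr : rearrangement X T).
Hypothesis T_smooth : smoothing T.
Context (f : 'rV[R]_n -> R) (Xf : X f) (f_lip : elipschitz f).
Context (g : 'rV[R]_n -> R) (g_lip : elipschitz g).
Hypothesis Tfg : \forall x \ae mu, T f x = g x.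

Let Tg t : ess_subset [set x | t < T f x] [set x | t < g x] /\
  ess_subset [set x | t < g x] [set x | t < T f x].
Proof.
by split; apply: negligibleS Tfg => x [/= a b] e; apply: b; rewrite ?e// -e.
Qed.

(** The set [{g > t + c}] is open, so its points are density points and smoothing applies to it as
    it stands; [rearr_setD] then compares the differences. *)
Lemma level_inequality t c h : (ess_inf_rV f < t%:E)%E -> 0 <= c -> 0 < h ->
  (mu (parallel_set [set x | (t + c < g x)%R] h `\` [set x | (t < g x)%R]) <=
   mu (parallel_set [set x | (t + c < f x)%R] h `\` [set x | (t < f x)%R]))%E.
Proof.
move=> ft c0 h0.
have fs : (ess_inf_rV f < (t + c)%:E)%E by apply: (lt_le_trans ft); rewrite lee_fin lerDl.
have cf := elipschitz_continuous f_lip; have cg := elipschitz_continuous g_lip.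
have [M UM] := superlevel_bounded n_gt0 X_SV Xf f_lip fs.
have Poo := bounded_measure_lty n_gt0 (parallel_set_bounded h0 UM).
have Uoo := superlevel_finite X_SV Xf ft.
have oU s : open [set x | s < f x] by exact: open_superlevel.
have mP := measurable_open_rV n_gt0 (open_parallel_set n_gt0 h0 (oU (t + c))).
have mU := measurable_open_rV n_gt0 (oU t).
have [_ UW] := superlevel_rearr X_SV T_rearr Xf ft.
apply: le_trans (rearr_setD X_SV T_rearr mP mU Poo Uoo).
have PE : ess_subset (parallel_set [set x | t + c < g x] h)
    (rearr_set T (parallel_set [set x | t + c < f x] h)).
  apply: ess_subset_trans (smoothing_superlevel n_gt0 X_SV T_rearr T_smooth Xf f_lip fs h0).
  apply: subset_ess; apply: le_parallel_set => // x xg.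
  have [r r0 rg] := open_cube n_gt0 (open_superlevel cg : open [set x | t + c < g x]) xg.
  apply: (density_points_interior n_gt0 r0).
  apply: (@ess_subset_trans _ _ [set x | t + c < g x]); last by have [] := Tg (t + c).
  by apply: subset_ess => y xy; apply: rg; exact: norm_cube.
have DE := ess_subset_trans UW (Tg t).1.
suff /(ess_subset_measure setT) : ess_subset (parallel_set [set x | t + c < g x] h `\` [set x | t < g x])
   (rearr_set T (parallel_set [set x | t + c < f x] h) `\` rearr_set T [set x | t < f x]).
  by rewrite !setIT.
apply: negligibleS (negligibleU PE DE) => x [[px gx] h'].
have [rx|rx] := pselect (rearr_set T (parallel_set [set x | t + c < f x] h) x); last by left.
by right; split => //; apply: contrapT => nx; apply: h'.
Qed.

End level_inequality.

(** * Suprema over balls and integration over levels *)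

Section upper_envelope.
Context {R : realType} {n : nat}.
Hypothesis n_gt0 : (0 < n)%N.
Implicit Types (x y v : 'rV[R]_n) (h : R).

Definition upper_envelope (f : 'rV[R]_n -> R) h x : R := sup [set f y | y in eball x h].

Context (f : 'rV[R]_n -> R) (L : R) (L0 : 0 <= L).
Hypothesis fL : forall x y, `|f x - f y| <= L * enorm (x - y).

Let le_fL x y h : enorm (y - x) <= h -> f y <= f x + L * h.
Proof.
move=> xy; rewrite -lerBlDl; apply: (le_trans (ler_norm _)); apply: (le_trans (fL _ _)).
by rewrite ler_wpM2l.
Qed.

Let ub x h : ubound [set f y | y in eball x h] (f x + L * h).
Proof. by move=> _ [y xy <-]; exact: le_fL. Qed.

Lemma upper_envelope_ge x y h : enorm (y - x) <= h -> f y <= upper_envelope f h x.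
Proof. by move=> xy; apply: ub_le_sup; [exists (f x + L * h); exact: ub|exists y]. Qed.

Lemma upper_envelope_le x h : 0 <= h -> upper_envelope f h x <= f x + L * h.
Proof.
move=> h0; apply: ge_sup; last exact: ub.
by exists (f x); exists x => //; rewrite /eball/= subrr enorm0.
Qed.

Lemma le_upper_envelope x h : 0 <= h -> f x <= upper_envelope f h x.
Proof. by move=> h0; apply: upper_envelope_ge; rewrite subrr enorm0. Qed.

(** A supremum exceeds [s] exactly when some value does. This translates the sets of the smoothing
    property into functions. *)
Lemma upper_envelope_superlevel h (s : R) : 0 < h ->
  [set x | s < upper_envelope f h x] = parallel_set [set x | s < f x] h.
Proof.
move=> h0; apply/seteqP; split=> x /=.
  move=> /sup_gt[|_ [y xy <-] sy]; first by exists (f x); exists x => //; rewrite /eball/= subrr enorm0 ltW.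
  by apply/(parallel_setP _ _ h0); exists y => //; rewrite enormB.
move=> /(parallel_setP _ _ h0)[y /= sy xy]; apply: (lt_le_trans sy).
by apply: upper_envelope_ge; rewrite enormB.
Qed.

Lemma measurable_upper_envelope h : 0 < h -> measurable_fun setT (upper_envelope f h).
Proof.
move=> h0; apply: (measurability _ (RGenOInfty.measurableE R)) => _ [_ [a ->] <-].
rewrite setTI; apply: (measurable_open_rV n_gt0).
rewrite (_ : _ @^-1` _ = [set x | a < upper_envelope f h x]); last first.
  by apply/seteqP; split => x /=; rewrite in_itv/= andbT.
rewrite upper_envelope_superlevel//; apply: (open_parallel_set n_gt0 h0).
apply: open_superlevel; apply: elipschitz_continuous; by exists L.
Qed.

End upper_envelope.

Section layer_cake.
Context {R : realType} d (V : measurableType d) (m : {sigma_finite_measure set V -> \bar R}).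

(** By Tonelli's theorem on [V * R], the integral of [(u - max(a, w))^+] is the integral over
    [t >= a] of the measure of [{w <= t < u}]. *)
Lemma le_integral_layers (u1 w1 u2 w2 : V -> R) (a : R) :
  measurable_fun setT u1 -> measurable_fun setT w1 ->
  measurable_fun setT u2 -> measurable_fun setT w2 ->
  (forall t, a <= t -> (m [set x | (w1 x <= t < u1 x)%R] <= m [set x | (w2 x <= t < u2 x)%R])%E) ->
  (\int[m]_x (Num.max 0 (u1 x - Num.max a (w1 x)))%:E <=
   \int[m]_x (Num.max 0 (u2 x - Num.max a (w2 x)))%:E)%E.
Proof.
move=> mu1 mw1 mu2 mw2 le12.
pose A (u w : V -> R) := [set p : V * R | a <= p.2 /\ w p.1 <= p.2 < u p.1].
have mA (u w : V -> R) : measurable_fun setT u -> measurable_fun setT w -> measurable (A u w).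
  move=> mu mw.
  have mf : measurable_fun [set: V * R] fst by exact: measurable_fst.
  have ms : measurable_fun [set: V * R] (fun p : V * R => p.2 : R) by exact: measurable_snd.
  have mu' : measurable_fun [set: V * R] (fun p => u p.1) by exact: measurableT_comp.
  have mw' : measurable_fun [set: V * R] (fun p => w p.1) by exact: measurableT_comp.
  rewrite (_ : A u w = (setT `&` [set p : V * R | a <= p.2]) `&`
    ((setT `&` [set p : V * R | w p.1 <= p.2]) `&` ~` (setT `&` [set p : V * R | u p.1 <= p.2]))).
    apply: measurableI; first exact: measurable_fun_le.
    by apply: measurableI; [|apply: measurableC]; exact: measurable_fun_le.
  apply/seteqP; split=> p; rewrite /A/=.
    by move=> [ap /andP[wp up]]; do 2?split => //; move=> [_]; rewrite leNgt up.
  move=> [[_ ap] [[_ wp] up]]; split => //; rewrite wp/= ltNge; apply/negP => h.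
  by apply: up.
have AE (u w : V -> R) : measurable_fun setT u -> measurable_fun setT w ->
   (\int[m]_x (Num.max 0 (u x - Num.max a (w x)))%:E =
    \int[lebesgue_measure]_t m (ysection (A u w) t))%E.
  move=> mu mw.
  have := @indic_fubini_tonelli _ _ _ _ _ m lebesgue_measure _ (mA _ _ mu mw).
  rewrite indic_fubini_tonelli_FE; last exact: mA.
  rewrite indic_fubini_tonelli_GE; last exact: mA.
  move=> <-; apply: eq_integral => x _ /=.
  rewrite (_ : xsection _ _ = `[Num.max a (w x), u x[%classic).
    rewrite lebesgue_measure_itv/= lte_fin; case: ltP => h.
      by rewrite -EFinB; congr EFin; rewrite /Num.max subr_gt0 h.
    by congr EFin; rewrite /Num.max subr_gt0 ltNge h.
  apply/seteqP; split => t /=; rewrite /xsection/= inE /A/= in_itv/= ge_max.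
    by move=> [-> /andP[-> ->]].
  by move=> /andP[/andP[-> ->] ->].
rewrite !AE//; apply: ge0_le_integral => //.
- by apply: measurable_fun_ysection; exact: mA.
- by apply: measurable_fun_ysection; exact: mA.
- move=> t _; have [ta|ta] := leP a t; last first.
    rewrite (_ : ysection _ _ = set0) ?measure0//.
    by apply/seteqP; split => // x; rewrite /ysection/= inE /A/= leNgt ta => -[].
  have yE u w : ysection (A u w) t = [set x | w x <= t < u x].
    by apply/seteqP; split => x; rewrite /ysection/= inE /A/= ta => // -[].
  by rewrite !yE; exact: le12.
Qed.

End layer_cake.

(** * Differentiability almost everywhere *)

Section lipschitz_line.
Context {R : realType}.
Local Notation lambda := (@lebesgue_measure R).

Lemma stieltjes_itv (G : cumulative R R) (a b : R) : a <= b ->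
  lebesgue_stieltjes_measure G `]a, b]%classic = (G b - G a)%:E.
Proof.
move=> ab; rewrite /lebesgue_stieltjes_measure/= /measure_extension measurable_mu_extE/=.
  by rewrite wlength_itv_bnd.
exact: is_ocitv.
Qed.

(* If G1 + G2 = id, then the Stieltjes measures of G1 and G2 add up to the
   Lebesgue measure, so both have densities. *)
Lemma cumulative_derivable_ae (G1 G2 : cumulative R R) :
  (forall x, G1 x + G2 x = x) -> {ae lambda, forall x, derivable G1 x 1}.
Proof.
move=> G12.
pose nu1 := lebesgue_stieltjes_measure G1.
pose nu2 := lebesgue_stieltjes_measure G2.
have nuE A : measurable A -> lambda A = (nu1 A + nu2 A)%E.
  move=> mA; rewrite -(measure_addE nu1 nu2 A).
  apply: (@lebesgue_measure_unique R (measure_add nu1 nu2)) => // X.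
  move=> /ocitvP[->|[[a b] /= ab ->]]; first by rewrite !measure0.
  have -> : lambda `]a, b]%classic = (b - a)%:E.
    by rewrite lebesgue_measure_itv/= lte_fin ab.
  transitivity (nu1 `]a, b]%classic + nu2 `]a, b]%classic)%E; last exact/esym/measure_addE.
  rewrite /nu1 /nu2 (stieltjes_itv _ (ltW ab)) (stieltjes_itv G2 (ltW ab)) -EFinD.
  by congr EFin; have := G12 a; have := G12 b; lra.
suff H (k : nat) : {ae lambda, forall x, - k%:R < x < k%:R -> derivable G1 x 1}.
  have := ae_foralln H; apply: filterS => x h; apply: (h (Num.bound `|x|)).
  by rewrite -ltr_norml unstable.ltr_bound.
(* On a bounded window [nu1] is finite, and Radon-Nikodym provides an integrable density. *)
pose D : set (measurableTypeR R) := `]- k%:R, k%:R : R]%classic.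
have mD : measurable D by exact: measurable_itv.
have Dk : (- k%:R : R) <= k%:R by have : (0 : R) <= k%:R by [rewrite ler0n]; lra.
have Doo : (nu1 D < +oo)%E by rewrite /nu1 /D (stieltjes_itv _ Dk) ltry.
pose nu : {finite_measure set (measurableTypeR R) -> \bar R} := mfrestr mD Doo.
have numu : nu `<< lambda.
  apply/null_content_dominatesP => A mA A0.
  apply/eqP; rewrite eq_le measure_ge0 andbT -A0.
  rewrite (_ : nu A = nu1 (A `&` D))//.
  apply: (@le_trans _ _ (lambda (A `&` D))).
    by rewrite nuE ?leeDl ?measure_ge0//; exact: measurableI.
  by apply: le_measure; rewrite ?inE//; exact: measurableI.
have [f [f0 ffin fint fE]] := radon_nikodym_sigma_finite numu.
have fineE : EFin \o (fine \o f) = f by apply/funext => x /=; rewrite fineK.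
have fintA y : lambda.-integrable [set` Interval (BRight (- k%:R)) (BRight y)] (EFin \o (fine \o f)).
  by rewrite fineE; apply: integrableS fint.
have floc : locally_integrable [set: R] (fine \o f).
  by apply: open_integrable_locally; [exact: openT|rewrite fineE].
(* Within the window [G1] is, up to a constant, the primitive of the density, and a primitive is
   derivable almost everywhere. *)
have := FTC1 fintA floc; apply: filterS => [|x /= fx /andP[kx xk]].
  exact: (ae_filter_ringOfSetsType lambda).
have [] := fx; first by rewrite lte_fin.
set Phi := (X in derivable X x 1) => dx _.
have dx' : derivable (Phi + cst (G1 (- k%:R))) x 1 by apply: derivableD.
apply: near_eq_derivable dx'.
near=> y; rewrite /Phi fctE /= /Rintegral.
have ky : - k%:R < y by near: y; exact: lt_nbhsr.
have yk : y <= k%:R by near: y; exact: lt_le_nbhsl.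
rewrite (eq_integral f) => [|z _]; last by rewrite /= fineK.
rewrite -fE; last exact: measurable_itv.
rewrite (_ : nu _ = nu1 `]- k%:R, y]%classic).
  by rewrite /nu1 (stieltjes_itv _ (ltW ky))/= subrK.
rewrite /nu/= /mfrestr /mrestr setIidl// => z; rewrite /D/= !in_itv/= => /andP[kz zy]; rewrite kz/=.
exact: le_trans yk.
Unshelve. all: by end_near. Qed.

(** If [K > 0] is a Lipschitz constant, [K x + F x] and [K x - F x] are nondecreasing; divided by
    [2 K] they add up to the identity, and [F] is a combination of one of them and the identity. *)
Lemma lipschitz_derivable_ae (F : R -> R) (L : R) :
  (forall x y, `|F x - F y| <= L * `|x - y|) -> {ae lambda, forall x, derivable F x 1}.
Proof.
move=> FL.
pose K := Num.max L 0 + 1.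
have K0 : 0 < K by rewrite /K ltr_wpDl// le_max lexx orbT.
have {}FL x y : `|F x - F y| <= K * `|x - y|.
  by apply: (le_trans (FL x y)); rewrite ler_wpM2r// /K ler_wpDr// le_max lexx.
have cF : continuous F.
  move=> x; apply/(@cvgrPdist_lt _ _ _ (nbhs x)) => e e0.
  near=> y; apply: (le_lt_trans (FL x y)).
  rewrite mulrC -ltr_pdivlMr//; near: y; apply: cvgr_dist_lt => //.
  by rewrite divr_gt0.
pose g1 x := (F x + K * x) / (2 * K).
pose g2 x := (K * x - F x) / (2 * K).
have K2 : 0 < 2 * K by rewrite mulr_gt0.
have nd1 : nondecreasing g1.
  move=> x y xy; rewrite ler_pM2r ?invr_gt0//.
  have := FL x y; rewrite ler_norml => /andP[h1 h2].
  rewrite ler0_norm in h1 h2; last by rewrite subr_le0.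
  lra.
have nd2 : nondecreasing g2.
  move=> x y xy; rewrite ler_pM2r ?invr_gt0//.
  have := FL x y; rewrite ler_norml => /andP[h1 h2].
  rewrite ler0_norm in h1 h2; last by rewrite subr_le0.
  lra.
have cK : continuous (fun x : R => K * x) by move=> x; exact: mulrl_continuous.
have rc1 : right_continuous g1.
  apply: right_continuousW => x; apply: cvgM; last exact: cvg_cst.
  by apply: cvgD; [exact: cF|exact: cK].
have rc2 : right_continuous g2.
  apply: right_continuousW => x; apply: cvgM; last exact: cvg_cst.
  by apply: cvgB; [exact: cK|exact: cF].
pose G1 : cumulative R R := HB.pack g1 (isCumulative.Build R _ R g1 nd1 rc1).
pose G2 : cumulative R R := HB.pack g2 (isCumulative.Build R _ R g2 nd2 rc2).
have /(cumulative_derivable_ae (G1 := G1)) : forall x, G1 x + G2 x = x.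
  move=> x; rewrite /= /g1 /g2; field.
  by rewrite gt_eqF.
apply: filterS => [|x dx]; first exact: (ae_filter_ringOfSetsType lambda).
have -> : F = (2 * K) \*: g1 - K \*: id.
  by apply/funext => y; rewrite /g1 !fctE /= /GRing.scale/=; field; rewrite gt_eqF.
by apply: derivableB; apply: derivableZ => //; exact: derivable_id.
Unshelve. all: by end_near. Qed.

End lipschitz_line.

Section directional_derivative.
Context {R : realType} {n : nat}.
Implicit Types (x y v w : 'rV[R]_n) (f : 'rV[R]_n -> R).

(** The limit is explicit and the quotient is cleared, so [h = 0] is no exception and errors simply
    add up. *)
Definition has_dderiv f x v (l : R) := forall e, 0 < e -> exists2 d, 0 < d &
  forall h, `|h| < d -> `|f (x + h *: v) - f x - l * h| <= e * `|h|.

Lemma quot_dist_le (D h l e : R) : h != 0 -> (`|D / h - l| <= e) = (`|D - l * h| <= e * `|h|).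
Proof.
by move=> h0; rewrite -[RHS]ler_pdivrMr ?normr_gt0// -normf_div [in RHS]mulrBl mulfK.
Qed.

Lemma has_dderivP f x v l :
  has_dderiv f x v l <-> h^-1 *: (f (h *: v + x) - f x) @[h --> 0^'] --> l.
Proof.
have qE h : h != 0 -> forall e, (`|l - h^-1 *: (f (h *: v + x) - f x)| <= e) =
    (`|f (x + h *: v) - f x - l * h| <= e * `|h|).
  move=> h0 e; rewrite -quot_dist_le// distrC [h *: v + x]addrC.
  by rewrite [_ / h]mulrC.
split=> [fl|].
  apply/(@cvgrPdist_le _ _ _ (0^') _) => e e0; have [d d0 fd] := fl e e0.
  near=> h; have h0 : h != 0 by near: h; exact: nbhs_dnbhs_neq.
  have hd : `|h| < d by near: h; apply: dnbhs0_lt.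
  by rewrite qE//; exact: fd.
move=> /(@cvgrPdist_le _ _ _ (0^') _) fl e e0; have := fl e e0.
move=> [d /= d0 fd]; exists d => // h hd.
have [->|h0] := eqVneq h 0; first by rewrite scale0r addr0 subrr mulr0 subrr normr0 mulr0.
rewrite -qE//; apply: fd => //=; rewrite /ball_/= sub0r normrN//.
Unshelve. all: by end_near. Qed.

Lemma has_dderiv_derive f x v l : has_dderiv f x v l -> derivable f x v /\ 'D_v f x = l.
Proof.
move=> /has_dderivP fl; split; first by apply/cvg_ex; exists l.
by apply/cvg_lim => //; exact: Rhausdorff.
Qed.

Lemma derivable_has_dderiv f x v : derivable f x v -> has_dderiv f x v ('D_v f x).
Proof. by move=> h; apply/has_dderivP. Qed.

Lemma has_dderivZ f x v l (c : R) : has_dderiv f x v l -> has_dderiv f x (c *: v) (c * l).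
Proof.
move=> fl e e0; have c0 : 0 < `|c| + 1 by rewrite ltr_wpDl.
have [d d0 fd] := fl _ (divr_gt0 e0 c0).
exists (d / (`|c| + 1)) => [|h hd]; first by rewrite divr_gt0.
have hc : `|h * c| < d.
  rewrite normrM; move: hd; rewrite ltr_pdivlMr// => /(le_lt_trans _); apply.
  by rewrite ler_wpM2l// lerDl.
have := fd _ hc; rewrite scalerA (_ : l * (h * c) = c * l * h); last by ring.
move=> /le_trans; apply; rewrite normrM.
rewrite (_ : _ * (_ * _) = (e * `|h|) * (`|c| / (`|c| + 1))); last by ring.
rewrite ler_piMr ?mulr_ge0 ?(ltW e0)//.
by rewrite ler_pdivrMr// mul1r lerDl.
Qed.

Context f (L : R) (L0 : 0 <= L) (fL : forall x y, `|f x - f y| <= L * enorm (x - y)).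

Definition dquot v (h : R) x := (f (x + h *: v) - f x) / h.

(** Derivability along [v] through countably many conditions on values of [f]. The set of such
    points is measurable, as integration over lines demands. *)
Definition rat_cauchy v x := forall k : nat, exists j : nat, forall a b : rat,
  0 < `|ratr a : R| < j.+1%:R^-1 -> 0 < `|ratr b : R| < j.+1%:R^-1 ->
  `|dquot v (ratr a) x - dquot v (ratr b) x| <= k.+1%:R^-1.

Lemma ex_invn_lt (e : R) : 0 < e -> exists k : nat, k.+1%:R^-1 < e.
Proof.
move=> e0; exists (Num.bound e^-1).
by rewrite invf_plt ?posrE// (lt_le_trans (unstable.ltr_bound _))// ler_nat.
Qed.

Lemma has_dderiv_rat_cauchy v x l : has_dderiv f x v l -> rat_cauchy v x.
Proof.
move=> fl k; have e0 : 0 < (k.+1%:R^-1 / 2 : R) by rewrite divr_gt0.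
have [d d0 fd] := fl _ e0; have [j jd] := ex_invn_lt d0.
have q a : 0 < `|ratr a : R| < j.+1%:R^-1 -> `|dquot v (ratr a) x - l| <= k.+1%:R^-1 / 2.
  move=> /andP[a0 aj]; have := fd _ (lt_trans aj jd).
  by rewrite -quot_dist_le// -normr_gt0.
exists j => a b /q qa /q qb; rewrite (le_trans (ler_distD l _ _))// [`|l - _|]distrC.
by rewrite (splitr k.+1%:R^-1) lerD.
Qed.

Lemma rat_cauchy_has_dderiv v x : rat_cauchy v x -> exists l, has_dderiv f x v l.
Proof.
(* The index [j.+2] puts these increments strictly below [j.+1%:R^-1]. *)
move=> fc; pose a (j : nat) := dquot v (ratr (j.+2%:R^-1)) x.
have ra (j : nat) : ratr (j.+2%:R^-1) = j.+2%:R^-1 :> R by rewrite -[j.+2%:R in RHS]ratr_nat -fmorphV.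
have aj (i j : nat) : (i <= j)%N -> 0 < `|ratr (j.+2%:R^-1) : R| < i.+1%:R^-1.
  move=> ij; rewrite ra normfV normr_nat invr_gt0 ltr0n/= ltf_pV2 ?posrE ?ltr0n//.
  by rewrite ltr_nat !ltnS.
have ca : cvgn a.
  apply/cauchy_cvgP/cauchy_exP => e e0; have [k ke] := ex_invn_lt e0.
  have [j fj] := fc k; exists (a j).
  suff : \forall i \near \oo, ball (a j) e (a i) by [].
  near=> i.
  apply: le_lt_trans ke; apply: fj; first exact: aj.
  by apply: aj; near: i; exact: nbhs_infty_ge.
pose l := lim (a @ \oo); exists l => e e0.
have e2 : 0 < e / 2 by rewrite divr_gt0.
have [k ke] := ex_invn_lt e2; have [j fj] := fc k.
have fl (b : rat) : `|ratr b : R| < j.+1%:R^-1 ->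
    `|f (x + ratr b *: v) - f x - l * ratr b| <= e / 2 * `|ratr b|.
  move=> bj; have [b0|b0] := eqVneq (ratr b : R) 0.
    by rewrite b0 scale0r addr0 subrr mulr0 subrr normr0 mulr0.
  rewrite -quot_dist_le// -/(dquot v (ratr b) x).
  have cab : `|dquot v (ratr b) x - a i| @[i --> \oo] --> `|dquot v (ratr b) x - l|.
    by apply: cvg_norm; apply: cvgB => //; exact: cvg_cst.
  apply: (cvgr_to_le cab); near=> i; apply: le_trans (ltW ke).
  apply: fj; first by rewrite normr_gt0 b0.
  by apply: aj; near: i; exact: nbhs_infty_ge.
exists j.+1%:R^-1 => [|h hj]; first by rewrite invr_gt0.
apply/ler_addgt0Pr => t t0.
(* The cost per unit of replacing [h] by a rational: in [f], in [l * h] and in the error term. The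
   second bound in [s] keeps that rational in the range given by [j]. *)
pose C := L * enorm v + `|l| + e / 2.
have C0 : 0 < C + 1 by rewrite ltr_wpDl// !addr_ge0 ?mulr_ge0 ?enorm_ge0// ltW.
pose s := Num.min (t / (C + 1)) (j.+1%:R^-1 - `|h|).
have s0 : 0 < s by rewrite lt_min divr_gt0//= subr_gt0.
have [b] : exists b : rat, ratr b \in `]h - s, h + s[.
  by apply: rat_in_itvoo; rewrite ltrD2l gt0_cp.
rewrite in_itv/= -ltr_distl => hb.
have [sC sj] : s <= t / (C + 1) /\ s <= j.+1%:R^-1 - `|h|.
  by split; rewrite ge_min lexx ?orbT.
have bh : `|ratr b| <= `|h| + s.
  by rewrite -(subrK h (ratr b)) addrC (le_trans (ler_normD _ _))// lerD2l ltW.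
have bj : `|ratr b : R| < j.+1%:R^-1.
  rewrite -(subrK h (ratr b)) addrC (le_lt_trans (ler_normD _ _))//.
  by rewrite -ltrBrDl (lt_le_trans hb).
have := fl b bj.
have h1 : `|f (x + h *: v) - f (x + ratr b *: v)| <= L * enorm v * s.
  apply: (le_trans (fL _ _)); rewrite -mulrA ler_wpM2l//.
  rewrite opprD addrACA subrr add0r -scalerBl enormZ mulrC ler_wpM2l ?enorm_ge0//.
  by rewrite distrC ltW.
have h2 : `|l * ratr b - l * h| <= `|l| * s.
  by rewrite -mulrBr normrM ler_wpM2l// ltW.
move=> h3.
have -> : f (x + h *: v) - f x - l * h = (f (x + h *: v) - f (x + ratr b *: v)) +
   (f (x + ratr b *: v) - f x - l * ratr b) + (l * ratr b - l * h) by ring.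
apply: (le_trans (ler_normD _ _)); apply: (le_trans (lerD (ler_normD _ _) (lexx _))).
apply: (le_trans (lerD (lerD h1 h3) h2)).
have h4 : e / 2 * `|ratr b| <= e / 2 * (`|h| + s) by rewrite ler_wpM2l// ltW.
have h5 : (C + 1) * s <= t by rewrite mulrC -ler_pdivlMr.
have h6 : e / 2 * `|h| <= e * `|h| by rewrite ler_wpM2r//; lra.
apply: (@le_trans _ _ (e / 2 * `|h| + C * s)).
  have -> : e / 2 * `|h| + C * s = L * enorm v * s + e / 2 * (`|h| + s) + `|l| * s.
    by rewrite /C; ring.
  by rewrite lerD2r lerD2l.
apply: lerD => //; apply: le_trans h5; rewrite ler_wpM2r ?(ltW s0)//; lra.
Unshelve. all: by end_near. Qed.

End directional_derivative.

(** * Rademacher's theorem *)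

Section rademacher.
Context {R : realType} {n : nat}.
Hypothesis n_gt0 : (0 < n)%N.
Implicit Types (x y v w : 'rV[R]_n) (A B N : set 'rV[R]_n).
Local Notation mu := (@lebesgue_measure_rV R n).
Local Notation lambda := (@lebesgue_measure R).

(* By translation invariance mu N is the average over t in [0, 1] of
   mu {x | N (x + t v)}; exchange the order of integration. *)
Lemma negligible_lines v N :
  measurable [set p : 'rV[R]_n * R | N (p.1 + p.2 *: v)] ->
  (forall x, lambda.-negligible [set t | N (x + t *: v)]) -> mu.-negligible N.
Proof.
move=> mM lN; set M := [set p | _] in mM.
pose I : set R := `[0, 1]%classic.
have mI : measurable I by exact: measurable_itv.
have mA : measurable (M `&` (setT `*` I)).
  by apply: measurableI => //; apply: measurableX.
have := @indic_fubini_tonelli _ _ _ _ _ (@lebesgue_measure_rV R n) (@lebesgue_measure R) _ mA.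
rewrite indic_fubini_tonelli_FE// indic_fubini_tonelli_GE//.
rewrite integral0_eq => [|x _ /=]; last first.
  have mx : measurable (xsection (M `&` (setT `*` I)) x) by exact: measurable_xsection.
  apply/negligibleP => //; apply: negligibleS (lN x) => t.
  by rewrite /xsection/= inE => -[].
move=> I0.
have : (\int[lambda]_t (if t \in I then mu N else 0) = 0)%E.
  rewrite [RHS]I0; apply: eq_integral => t _ /=; apply/esym; case: ifPn => [|]; rewrite ?inE ?notin_setE => tI.
    rewrite -(lebesgue_measure_shift n_gt0 (t *: v) N); congr mu.
    by apply/seteqP; split => x; rewrite /ysection/= inE => // -[].
  rewrite (_ : ysection _ _ = set0) ?measure0//.
  by apply/seteqP; split => // x; rewrite /ysection/= inE => -[_ [_]].
rewrite -integral_mkcond integral_cst//= /I lebesgue_measure_itv/= lte_fin ltr01.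
by rewrite oppr0 adde0 mule1 => /negligibleP_rV.
Qed.

Context (f : 'rV[R]_n -> R) (L : R) (L0 : 0 <= L).
Hypothesis fL : forall x y, `|f x - f y| <= L * enorm (x - y).

Let f_lip : elipschitz f. Proof. by exists L. Qed.

(** A superlevel set is a countable union of measurable rectangles: a rational [q] close to [t]
    replaces [t], and the Lipschitz condition bounds the change, which the margin in [C k]
    absorbs. *)
Lemma measurable_along_line v w :
  measurable_fun setT (fun p : 'rV[R]_n * R => f (p.1 + p.2 *: v + w)).
Proof.
apply: (measurability _ (RGenOInfty.measurableE R)) => _ [_ [s ->] <-].
rewrite setTI.
pose C k := s + L * enorm v / k.+1%:R.
rewrite (_ : _ @^-1` _ = \bigcup_(q in [set: rat]) \bigcup_k
   ([set x | C k < f (x + (ratr q *: v + w))] `*` [set t : R | `|t - ratr q| < k.+1%:R^-1])).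
  apply: bigcupT_measurable_rat => q; apply: bigcup_measurable => k _; apply: measurableX.
    have mC : measurable [set x | C k < f x].
      apply: measurable_open_rV => //; apply: open_superlevel.
      exact: elipschitz_continuous.
    exact: (measurable_shift n_gt0 _ mC).
  rewrite (_ : [set t | _] = ball (ratr q : R) k.+1%:R^-1); first exact: measurable_ball.
  by apply/seteqP; split => t /=; rewrite /ball/= distrC.
have fd x t q : `|f (x + t *: v + w) - f (x + (ratr q *: v + w))| <= L * enorm v * `|t - ratr q|.
  apply: (le_trans (fL _ _)).
  rewrite (_ : _ - _ = (t - ratr q) *: v); last by rewrite scalerBl; apply/rowP => i; rewrite !mxE; ring.
  by rewrite enormZ (mulrC `|_|) mulrA.
have Lv : 0 <= L * enorm v by rewrite mulr_ge0// enorm_ge0.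
apply/seteqP; split => -[x t] /=; rewrite in_itv/= andbT.
  move=> sf; pose g := f (x + t *: v + w) - s.
  have g0 : 0 < g by rewrite subr_gt0.
  have K0 : 0 < 2 * (L * enorm v) + 1 by rewrite ltr_wpDl// mulr_ge0.
  have [k kg] := ex_invn_lt (divr_gt0 g0 K0).
  have [q] : exists q : rat, ratr q \in `]t - k.+1%:R^-1, t + k.+1%:R^-1[.
    by apply: rat_in_itvoo; rewrite ltrD2l gt0_cp// invr_gt0.
  rewrite in_itv/= -ltr_distl distrC => tq.
  exists q => //; exists k => //; split => //=.
  have := fd x t q; rewrite ler_norml => /andP[_ h1].
  have h2 : L * enorm v * `|t - ratr q| <= L * enorm v * k.+1%:R^-1 by rewrite ler_wpM2l// ltW.
  move: kg; rewrite ltr_pdivlMr// => kg.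
  have : 0 < k.+1%:R^-1 :> R by rewrite invr_gt0.
  rewrite /C; move: kg h1 h2; rewrite /g.
  set a := k.+1%:R^-1; set F := f _; set G := f _; set D := L * enorm v => kg h1 h2 a0.
  lra.
move=> [q _ [k _ [/= h1 h2]]].
have := fd x t q; rewrite ler_norml => /andP[h3 _].
have h4 : L * enorm v * `|t - ratr q| <= L * enorm v * k.+1%:R^-1 by rewrite ler_wpM2l// ltW.
move: h1 h3 h4; rewrite /C; set a := k.+1%:R^-1; set F := f _; set G := f _; set D := L * enorm v.
by move=> h1 h3 h4; lra.
Qed.

(** Along each line in direction [v] the function is Lipschitz in one variable, so the exceptional
    set meets every such line in a null set. *)
Lemma derivable_ae v : \forall x \ae mu, derivable f x v.
Proof.
have sub x : rat_cauchy f v x -> derivable f x v.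
  by move=> /(rat_cauchy_has_dderiv L0 fL)[l /has_dderiv_derive[]].
suff : mu.-negligible (~` [set x | rat_cauchy f v x]).
  by apply: negligibleS => x /= h /sub.
apply: (@negligible_lines v).
- rewrite (_ : [set p | _] = ~` [set p : 'rV[R]_n * R | rat_cauchy f v (p.1 + p.2 *: v)])//.
  apply: measurableC.
  pose q (a : rat) (p : 'rV[R]_n * R) := dquot f v (ratr a) (p.1 + p.2 *: v).
  have mq a : measurable_fun setT (q a).
    have m0 : measurable_fun setT (fun p : 'rV[R]_n * R => f (p.1 + p.2 *: v)).
      have := measurable_along_line v 0.
      by under eq_fun do rewrite addr0.
    by apply: measurable_funM => //; apply: measurable_funB => //; exact: measurable_along_line.
  pose S (k j : nat) (ab : rat * rat) := [set p | 0 < `|ratr ab.1 : R| < j.+1%:R^-1 ->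
    0 < `|ratr ab.2 : R| < j.+1%:R^-1 -> `|q ab.1 p - q ab.2 p| <= k.+1%:R^-1].
  rewrite (_ : [set p | _] = \bigcap_k \bigcup_j ~` (\bigcup_ab ~` S k j ab)); last first.
    apply/seteqP; split => p /=.
      move=> h k _; have [j hj] := h k; exists j => // -[[a b] _]; apply => ha hb.
      exact: hj.
    move=> h k; have [j _ hj] := h k Logic.I; exists j => a b ha hb.
    by apply: contrapT => nle; apply: hj; exists (a, b) => // /(_ ha hb).
  apply: bigcapT_measurable => k; apply: bigcupT_measurable => j.
  apply: measurableC; apply: countable_bigcupT_measurable => // -[a b].
  apply: measurableC; rewrite /S/=.
  have [ha|ha] := boolP (0 < `|ratr a : R| < j.+1%:R^-1); last first.
    by rewrite (_ : [set _ | _] = setT)//; apply/seteqP; split => // p _ /=.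
  have [hb|hb] := boolP (0 < `|ratr b : R| < j.+1%:R^-1); last first.
    by rewrite (_ : [set _ | _] = setT)//; apply/seteqP; split => // p _ /=.
  rewrite (_ : [set _ | _] = setT `&` [set p | `|q a p - q b p| <= k.+1%:R^-1]).
    apply: measurable_fun_le => //; apply: measurableT_comp => //.
    exact: measurable_funB.
  by apply/seteqP; split => p /=; [move=> /(_ isT isT)|move=> [_ ?] _ _].
- move=> x; pose F t := f (x + t *: v).
  have FL s t : `|F s - F t| <= L * enorm v * `|s - t|.
    apply: (le_trans (fL _ _)); rewrite opprD addrACA subrr add0r -scalerBl enormZ.
    by rewrite -mulrA [enorm v * _]mulrC.
  apply: negligibleS (lipschitz_derivable_ae FL) => t /= nc dF; apply: nc.
  have dft : derivable f (x + t *: v) v.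
    rewrite /derivable (_ : (fun h => _) = (fun h => h^-1 *: ((F \o shift t) (h *: 1) - F t))) //.
    apply/funext => h; rewrite /F /=; congr (_ *: (f _ - _)).
    by rewrite scalerDl -[h%:A]/(h * 1) mulr1 addrCA.
  have /= := derivable_has_dderiv dft.
  exact: has_dderiv_rat_cauchy.
Qed.

End rademacher.

Section porosity.
Context {R : realType} {n : nat}.
Hypothesis n_gt0 : (0 < n)%N.
Implicit Types (x y v w : 'rV[R]_n) (A B N : set 'rV[R]_n).
Local Notation mu := (@lebesgue_measure_rV R n).

(* A hole of radius proportional to h at distance proportional to h from x
   would contradict that x is a density point of the closure of A. *)
Lemma small_holes A : \forall x \ae mu, A x -> forall w (e : R), 0 < e ->
  exists2 d, 0 < d & forall h, 0 < h < d -> exists2 y, A y & `|y - (x + h *: w)| <= e * h.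
Proof.
have mC : measurable (closure A).
  rewrite -(setCK (closure A)); apply: measurableC; apply: measurable_open_rV => //.
  by apply: closed_openC; exact: closed_closure.
have nN : mu.-negligible (\bigcup_k [set x | closure A x /\ forall d, 0 < d ->
    exists r, [/\ 0 < r, r < d &
      ((k.+1%:R^-1 * (2 * r) ^+ n)%:E <= mu (cube x r `\` closure A))%E] ]).
  by apply: negligible_bigcup => k; apply: cube_density => //; rewrite invr_gt0.
apply: negligibleS nN => x /= /existsNP[Ax nx].
apply: contrapT => nN; apply: nx => w e e0.
(* The cube of half side [h * s] around [x] contains the hole of half side [e * h / 2] around
   [x + h *: w], whose share of the volume is [(e / (2 * s)) ^+ n]. *)
pose s : R := `|w| + e; have s0 : 0 < s by rewrite ltr_wpDl.
have c0 : 0 < (e / (2 * s)) ^+ n by rewrite exprn_gt0// divr_gt0// mulr_gt0.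
have [k kc] := ex_invn_lt c0.
apply: contrapT => nd; apply: nN; exists k => //; split; first exact: subset_closure.
move=> d d0; have ds0 : 0 < d / s by rewrite divr_gt0.
apply: contrapT => nr; apply: nd; exists (d / s) => // h /andP[h0 hd].
apply: contrapT => ny; apply: nr; exists (h * s).
have hs0 : 0 < h * s by rewrite mulr_gt0.
split => //; first by rewrite -ltr_pdivlMr.
have eh0 : 0 <= e * h / 2 by rewrite divr_ge0// mulr_ge0// ltW.
apply: (@le_trans _ _ (mu (cube (x + h *: w) (e * h / 2)))).
  rewrite cube_measure// lee_fin (_ : 2 * (e * h / 2) = e / (2 * s) * (2 * (h * s))); last first.
    by field; rewrite gt_eqF.
  by rewrite [leRHS]exprMn ler_wpM2r ?exprn_ge0 ?mulr_ge0 ?(ltW kc) ?(ltW h0) ?(ltW s0).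
apply: le_lebesgue_measure => y yh.
have yh' : `|y - (x + h *: w)| <= e * h / 2 by exact: cube_norm yh.
have ehh : e * h / 2 < e * h by have : 0 < e * h by [exact: mulr_gt0]; lra.
split.
  apply: (@norm_le_cube _ _ _ (`|y - (x + h *: w)| + h * `|w|)).
    rewrite (_ : y - x = (y - (x + h *: w)) + h *: w); last by rewrite opprD addrA subrK.
    by rewrite (le_trans (ler_normD _ _))// normrZ gtr0_norm.
  by rewrite /s mulrDr; lra.
move=> /(_ (ball y (e * h / 2))) [].
  by apply: nbhsx_ballx; rewrite divr_gt0// mulr_gt0.
move=> z [Az yz]; apply: ny; exists z => //.
rewrite (_ : z - _ = (z - y) + (y - (x + h *: w))); last by rewrite addrA subrK.
move: yz; rewrite -ball_normE/= distrC => /ltW yz.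
by rewrite (le_trans (ler_normD _ _))// [leRHS]splitr lerD.
Qed.

End porosity.

Section linearity.
Context {R : realType} {n : nat}.
Hypothesis n_gt0 : (0 < n)%N.
Implicit Types (x y v w : 'rV[R]_n) (A B N : set 'rV[R]_n).
Local Notation mu := (@lebesgue_measure_rV R n).
Context (f : 'rV[R]_n -> R) (L : R) (L0 : 0 <= L).
Hypothesis fL : forall x y, `|f x - f y| <= L * enorm (x - y).

Let lip_norm x y r : `|x - y| <= r -> `|f x - f y| <= L * n%:R * r.
Proof.
move=> xy; rewrite (le_trans (fL _ _))// -mulrA ler_wpM2l//.
by rewrite (le_trans (enorm_le_norm _))// ler_wpM2l.
Qed.

(* On a set where D_v f is almost constant and its difference quotients
   converge uniformly, D_v f near x + h w is compared with D_v f at x. *)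
Lemma derive_add_ae v w : \forall x \ae mu, 'D_(v + w) f x = 'D_v f x + 'D_w f x.
Proof.
(* The three indices are the accuracy, the range of [h] and the approximate value of the
   derivative. *)
pose A (ikq : nat * nat * rat) := [set x | `|'D_v f x - ratr ikq.2| <= ikq.1.1.+1%:R^-1 /\
  forall h, 0 < h < ikq.1.2.+1%:R^-1 ->
    `|f (x + h *: v) - f x - 'D_v f x * h| <= ikq.1.1.+1%:R^-1 * h].
have hA := ae_forall_countable (fun ikq => small_holes n_gt0 (A ikq)).
have hD : \forall x \ae mu, derivable f x w /\ derivable f x (v + w).
  by apply: filterI; exact: (derivable_ae n_gt0 L0 fL).
move: hA (derivable_ae n_gt0 L0 fL v) hD; apply: filterS3 => x hA.
move=> /derivable_has_dderiv dv [/derivable_has_dderiv dw /derivable_has_dderiv dvw].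
(* Two Lipschitz displacements by [e * h], three difference quotients with error [e], and [2 e]
   between the derivatives at [x] and [y]. *)
pose C := 2 * (L * n%:R) + 5.
have C0 : 0 < C by rewrite ltr_wpDl// !mulr_ge0.
suff H (i : nat) : `|'D_(v + w) f x - ('D_v f x + 'D_w f x)| <= C * i.+1%:R^-1.
  apply/eqP; rewrite -subr_eq0 -normr_le0 leNgt; apply/negP => nz.
  have [i] := ex_invn_lt (divr_gt0 nz C0); rewrite ltr_pdivlMr// ltNge => /negP; apply.
  by rewrite mulrC.
set e : R := i.+1%:R^-1; have e0 : 0 < e by rewrite invr_gt0.
have [q] : exists q : rat, ratr q \in `]'D_v f x - e, 'D_v f x + e[.
  by apply: rat_in_itvoo; rewrite ltrD2l gt0_cp.
rewrite in_itv/= -ltr_distl distrC => /ltW Dq.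
have [dv' dv0 {}dv] := dv _ e0; have [dw' dw0 {}dw] := dw _ e0; have [dx' dx0 {}dvw] := dvw _ e0.
have [k kd] := ex_invn_lt dv0.
have Ax : A (i, k, q) x.
  split => // h /andP[h0 hk]; have := dv h; rewrite gtr0_norm// => -> //.
  exact: lt_trans hk kd.
have [d d0 hd] := hA (i, k, q) Ax w e e0.
pose h := Num.min (Num.min d dw') (Num.min k.+1%:R^-1 dx') / 2.
have m0 : 0 < Num.min (Num.min d dw') (Num.min k.+1%:R^-1 dx').
  by rewrite !lt_min d0 dw0 dx0 invr_gt0 ltr0n.
have h0 : 0 < h by exact: divr_gt0.
have : h < Num.min (Num.min d dw') (Num.min k.+1%:R^-1 dx').
  by rewrite ltr_pdivrMr// ltr_pMr// ltr1n.
rewrite !lt_min => /andP[/andP[h1 h2] /andP[h3 h4]].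
have [|y [/= yq yd] yx] := hd h; first by rewrite h0.
have := dw h; rewrite gtr0_norm// => /(_ h2) {}dw.
have := dvw h; rewrite gtr0_norm// => /(_ h4) {}dvw.
have := yd h; rewrite h0 h3 => /(_ isT) {}yd.
have g1 : `|f (x + h *: (v + w)) - f (y + h *: v)| <= L * n%:R * (e * h).
  apply: lip_norm; rewrite distrC; apply: le_trans yx; rewrite scalerDr.
  by rewrite le_eqVlt; apply/orP; left; apply/eqP; congr `|_|; apply/rowP => ?; rewrite !mxE; ring.
have g2 := lip_norm yx.
have g3 : `|('D_v f y - 'D_v f x) * h| <= 2 * (e * h).
  rewrite normrM (gtr0_norm h0) mulrA ler_wpM2r ?(ltW h0)//.
  by rewrite (le_trans (ler_distD (ratr q) _ _))// mulr2n mulrDl mul1r lerD// distrC.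
rewrite -(ler_pM2r h0) -{1}(gtr0_norm h0) -normrM -mulrA.
move: g1 g2 g3 dw dvw yd; rewrite /C -/e.
move: (f (x + h *: (v + w))) (f (y + h *: v)) (f y) (f (x + h *: w)) (f x) => a1 a2 a3 a4 a5.
move: ('D_(v + w) f x) ('D_v f x) ('D_w f x) ('D_v f y) (L * n%:R) => b1 b2 b3 b4 M.
clear; rewrite !ler_norml => /andP[? ?] /andP[? ?] /andP[? ?] /andP[? ?] /andP[? ?] /andP[? ?].
lra.
Qed.

End linearity.

Section total_derivative.
Context {R : realType} {n : nat}.
Hypothesis n_gt0 : (0 < n)%N.
Implicit Types (x y u v w : 'rV[R]_n).
Local Notation mu := (@lebesgue_measure_rV R n).
Local Notation ratv := (map_mx (@ratr R)).

Definition dot v w : R := \sum_(i < n) v 0 i * w 0 i.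

Lemma dotDl u v w : dot (u + v) w = dot u w + dot v w.
Proof. by rewrite -big_split; apply: eq_bigr => i _; rewrite mxE mulrDl. Qed.

Lemma dotBl u v w : dot (u - v) w = dot u w - dot v w.
Proof. by rewrite -sumrB; apply: eq_bigr => i _; rewrite !mxE mulrBl. Qed.

Lemma dotZl (a : R) v w : dot (a *: v) w = a * dot v w.
Proof. by rewrite mulr_sumr; apply: eq_bigr => i _; rewrite mxE mulrA. Qed.

Lemma dotvv v : dot v v = enorm v ^+ 2.
Proof. by rewrite enorm_sqr; apply: eq_bigr => i _; rewrite expr2. Qed.

Lemma norm_dot v w : `|dot v w| <= enorm v * enorm w.
Proof.
rewrite ler_norml cauchy_schwarz andbT lerNl -(enormN v) -mulN1r -dotZl scaleN1r.
exact: cauchy_schwarz.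
Qed.

(* The coordinates are the multiples of 1/(N + 1) in [-1, 1]. *)
Definition grid N (k : {ffun 'I_n -> 'I_(N.*2.+3)}) : 'rV[rat]_n :=
  \row_i ((k i)%:R / N.+1%:R - 1).

Lemma ex_grid N u : `|u| <= 1 -> exists k, `|u - ratv (grid (N := N) k)| <= N.+1%:R^-1.
Proof.
move=> u1; have N0 : 0 < N.+1%:R :> R by [].
have ui i : 0 <= (u 0 i + 1) * N.+1%:R <= N.+1.*2%:R.
  have := le_trans (rV_norm_coord u i) u1; rewrite ler_norml => /andP[u1l u1r].
  apply/andP; split; first by apply: mulr_ge0; [lra|exact: ltW].
  by rewrite -mul2n natrM ler_wpM2r ?(ltW N0)//; lra.
have kN i : (Num.truncn ((u 0 i + 1) * N.+1%:R)%R < N.*2.+3)%N.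
  have /andP[u0 u2] := ui i; rewrite ltnS -(ler_nat R) (le_trans _ u2)//.
  by rewrite truncn_le.
exists [ffun i => Ordinal (kN i)]; apply: rV_norm_le => [|i]; first by rewrite invr_ge0 ltW.
rewrite !mxE ffunE/= rmorphB rmorph1 fmorph_div/= !ratr_nat.
have /andP[u0 _] := ui i; have /andP[h1 h2] := truncn_itv u0.
have {}h2 : (u 0 i + 1) * N.+1%:R <= (Num.truncn ((u 0 i + 1) * N.+1%:R))%:R + 1.
  by rewrite natr1 ltW.
set t := (Num.truncn _)%:R in h1 h2 *.
rewrite (_ : _ - _ = ((u 0 i + 1) * N.+1%:R - t) / N.+1%:R); last by field; rewrite gt_eqF.
rewrite normrM normfV (gtr0_norm N0) ler_pdivrMr// mulVf ?gt_eqF//.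
by rewrite ler_norml; apply/andP; split; lra.
Qed.

Context (f : 'rV[R]_n -> R) (L : R) (L0 : 0 <= L).
Hypothesis fL : forall x y, `|f x - f y| <= L * enorm (x - y).

(** Additivity holds almost everywhere for each pair of directions; only for countably many
    directions is there a common null set, hence the rational vectors. *)
Lemma rat_derivative_ae : \forall x \ae mu, forall q : 'rV[rat]_n,
  has_dderiv f x (ratv q) (dot (ratv q) (gradient f x)).
Proof.
have h1 := ae_forall_countable (fun q : 'rV[rat]_n => derivable_ae n_gt0 L0 fL (ratv q)).
have h2 := ae_forall_countable (fun q : 'rV[rat]_n * 'rV[rat]_n =>
  derive_add_ae n_gt0 L0 fL (ratv q.1) (ratv q.2)).
move: h1 h2; apply: filterS2 => x h1 h2 q.
suff <- : 'D_(ratv q) f x = dot (ratv q) (gradient f x) by exact: derivable_has_dderiv.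
rewrite [q]row_sum_delta; elim/big_ind : _ => [|p r Dp Dr|i _].
- have -> : ratv 0 = 0 *: ratv (0 : 'rV_n) by apply/rowP => j; rewrite !mxE rmorph0 mul0r.
  have /(has_dderivZ 0)/has_dderiv_derive[_ ->] := derivable_has_dderiv (h1 0).
  by rewrite dotZl !mul0r.
- have -> : ratv (p + r) = ratv p + ratv r by apply/rowP => j; rewrite !mxE rmorphD.
  by rewrite dotDl -Dp -Dr (h2 (p, r)).
- have rd : ratv (delta_mx 0 i) = delta_mx 0 i :> 'rV[R]_n.
    by apply/rowP => j; rewrite !mxE ratr_nat.
  have -> : ratv (q 0 i *: delta_mx 0 i) = ratr (q 0 i) *: (delta_mx 0 i : 'rV_n).
    by rewrite -rd; apply/rowP => j; rewrite !mxE rmorphM.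
  have := h1 (delta_mx 0 i); rewrite rd => /derivable_has_dderiv.
  move=> /(has_dderivZ (ratr (q 0 i)))/has_dderiv_derive[_ ->].
  rewrite dotZl; congr (_ * _); rewrite /dot (bigD1 i)//= big1 ?addr0 => [|j ji].
    by rewrite !mxE !eqxx mul1r.
  by rewrite !mxE (negbTE ji) andbF mul0r.
Qed.

(** A finite grid of rational directions gives a common [d], and the Lipschitz condition extends the
    estimate to the unit ball. *)
Lemma uniform_derivative x : (forall q : 'rV[rat]_n,
    has_dderiv f x (ratv q) (dot (ratv q) (gradient f x))) ->
  forall e, 0 < e -> exists2 d, 0 < d & forall h u, 0 < h < d -> enorm u <= 1 ->
    `|f (x + h *: u) - f x - dot u (gradient f x) * h| <= e * h.
Proof.
set G := gradient f x => fq e e0.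
(* Replacing [u] by a grid point at sup-distance [r] changes [f] by at most [n L r h] and the linear
   term by at most [n |G| r h]. *)
pose C := n%:R * (L + enorm G) + 1.
have C0 : 0 < C by rewrite ltr_wpDl// mulr_ge0// addr_ge0// enorm_ge0.
have e2 : 0 < e / 2 by rewrite divr_gt0.
have [N NC] := ex_invn_lt (divr_gt0 e2 C0).
have : \forall h \near (0 : R)^'+, forall k, 
    `|f (x + h *: ratv (grid (N := N) k)) - f x - dot (ratv (grid k)) G * h| <= e / 2 * `|h|.
  apply: filter_forall => k; have [d d0 fd] := fq (grid k) _ e2.
  near=> h; apply: fd; rewrite gtr0_norm; first by near: h; exact: nbhs_right_lt.
  by near: h; exact: nbhs_right_gt.
move=> [d /= d0 hd]; exists d => // h u /andP[h0 hdd] u1.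
have [k uk] := ex_grid N (le_trans (norm_le_enorm u) u1).
have := hd h; rewrite /= sub0r normrN (gtr0_norm h0) => /(_ hdd h0 k).
set q := ratv (grid k) in uk *.
have uq : enorm (u - q) <= n%:R * N.+1%:R^-1.
  by rewrite (le_trans (enorm_le_norm _))// ler_wpM2l.
have h1 : `|f (x + h *: u) - f (x + h *: q)| <= L * (n%:R * N.+1%:R^-1) * h.
  rewrite (le_trans (fL _ _))// -mulrA ler_wpM2l// opprD addrACA subrr add0r -scalerBr.
  by rewrite enormZ (gtr0_norm h0) mulrC ler_wpM2r// ltW.
have h2 : `|dot (q - u) G * h| <= n%:R * N.+1%:R^-1 * enorm G * h.
  rewrite normrM (gtr0_norm h0) ler_wpM2r ?(ltW h0)// (le_trans (norm_dot _ _))//.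
  by rewrite ler_wpM2r ?enorm_ge0// enormB.
have h3 : (C - 1) * N.+1%:R^-1 * h <= e / 2 * h.
  rewrite ler_wpM2r ?(ltW h0)//; move: NC; rewrite ltr_pdivlMr// mulrC => /ltW; apply: le_trans.
  by rewrite ler_wpM2r ?invr_ge0// gerBl.
move: h1 h2 h3; rewrite dotBl /C addrK.
move: (f (x + h *: u)) (f (x + h *: q)) (f x) (dot u G) (dot q G) (enorm G) (N.+1%:R^-1) => a b c A B g r.
rewrite !ler_norml; clear.
by move=> /andP[? ?] /andP[? ?] ? /andP[? ?]; apply/andP; split; lra.
Unshelve. all: by end_near. Qed.

(** Cauchy-Schwarz bounds the increase of [f] on the ball from above; a step of length [h] along the
    normalized gradient attains it up to [e * h]. *)
Lemma upper_envelope_gradient_ae : \forall x \ae mu,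
  k.+1%:R * (upper_envelope f k.+1%:R^-1 x - f x) @[k --> \oo] --> enorm (gradient f x).
Proof.
apply: filterS rat_derivative_ae => x /uniform_derivative fx.
apply/cvgrPdist_le => e e0; have [d d0 fd] := fx e e0.
near=> k.
have k0 : 0 < k.+1%:R^-1 :> R by rewrite invr_gt0.
have kd : k.+1%:R^-1 < d by near: k; exact: near_infty_natSinv_lt (PosNum d0).
set h : R := k.+1%:R^-1 in k0 kd *.
have -> : k.+1%:R = h^-1 by rewrite invrK.
set G := gradient f x in fd *.
have hk : 0 < h < d by rewrite k0 kd.
have up : upper_envelope f h x <= f x + (enorm G + e) * h.
  apply: ge_sup => [|_ [y yx <-]].
    by exists (f x); exists x => //; rewrite /eball/= subrr enorm0 ltW.
  have u1 : enorm (h^-1 *: (y - x)) <= 1.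
    by rewrite enormZ gtr0_norm ?invr_gt0// mulrC ler_pdivrMr// mul1r.
  have := fd h _ hk u1; rewrite scalerA divff ?gt_eqF// scale1r (addrC x) subrK.
  have := norm_dot (h^-1 *: (y - x)) G; set D := dot _ _ => DG.
  have DGh : D * h <= enorm G * h.
    rewrite ler_wpM2r ?(ltW k0)// (le_trans (ler_norm _))// (le_trans DG)//.
    by rewrite ler_piMl// enorm_ge0.
  by rewrite ler_norml mulrDl => /andP[_]; lra.
have lo : f x + (enorm G - e) * h <= upper_envelope f h x.
  have [G0|G0] := eqVneq (enorm G) 0.
    apply: le_trans (le_upper_envelope L0 fL _ (ltW k0)).
    by rewrite gerDl G0 sub0r mulNr oppr_le0 mulr_ge0// ltW.
  have Gp : 0 < enorm G by rewrite lt_def G0 enorm_ge0.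
  pose u := (enorm G)^-1 *: G.
  have u1 : enorm u = 1 by rewrite /u enormZ gtr0_norm ?invr_gt0// mulVf.
  have := fd h u hk; rewrite u1 => /(_ (lexx _)).
  rewrite /u dotZl dotvv expr2 mulKf// => Hu.
  have /(upper_envelope_ge L0 fL) : enorm (x + h *: u - x) <= h.
    by rewrite addrC addKr enormZ u1 mulr1 gtr0_norm.
  by move: Hu; rewrite ler_norml mulrBl => /andP[+ _]; rewrite -/u; lra.
rewrite ler_distl; apply/andP; split.
  by rewrite lerBlDl mulrC ler_pdivrMr// lerBlDl addrC (addrC e); move: up; lra.
by rewrite -lerBlDr mulrC ler_pdivlMr// lerBrDl.
Unshelve. all: by end_near. Qed.

End total_derivative.

(** * From envelopes to gradients *)

Lemma measurable_excess d (V : measurableType d) (R : realType) (u w : V -> R) (a : R) :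
  measurable_fun setT u -> measurable_fun setT w ->
  measurable_fun setT (fun x => Num.max 0 (u x - Num.max a (w x))).
Proof.
move=> mu mw; have mm : measurable_fun setT (fun x => Num.max a (w x)).
  exact: measurable_maxr.
have md : measurable_fun setT (fun x => u x - Num.max a (w x)) by exact: measurable_funB.
exact: measurable_maxr.
Qed.

Section envelope_limit.
Context {R : realType} {n : nat}.
Hypothesis n_gt0 : (0 < n)%N.
Implicit Types (x y : 'rV[R]_n).
Local Notation mu := (@lebesgue_measure_rV R n).
Context (f : 'rV[R]_n -> R) (L : R) (L0 : 0 <= L).
Hypothesis fL : forall x y, `|f x - f y| <= L * enorm (x - y).

Lemma measurable_elipschitz : measurable_fun setT f.
Proof. by apply: continuous_measurable_rV => //; apply: elipschitz_continuous; exists L. Qed.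
Let mf := measurable_elipschitz.

Lemma lebesgue_measure_rV_complete : measure_is_complete mu.
Proof. by move=> A; exact: negligible_measurable. Qed.

(** An almost everywhere limit of measurable functions, for a complete measure. *)
Lemma measurable_norm_gradient : measurable_fun setT (fun x => enorm (gradient f x)).
Proof.
pose u (k : nat) x := (k.+1%:R * (upper_envelope f k.+1%:R^-1 x - f x))%:E.
have mu' : measurable_fun setT (fun x => limn_esup (u ^~ x)).
  apply: measurable_fun_limn_esup => k; apply/measurable_EFinP.
  apply: measurable_funM; first exact: measurable_cst.
  apply: measurable_funB mf.
  by apply: (measurable_upper_envelope n_gt0 L0 fL); rewrite invr_gt0.
apply/measurable_EFinP; apply: (ae_measurable_fun lebesgue_measure_rV_complete _ mu').
apply: filterS (upper_envelope_gradient_ae n_gt0 L0 fL) => x ux _.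
have {}ux : u ^~ x @ \oo --> (enorm (gradient f x))%:E by apply/cvg_EFin; [exact: nearW|].
by rewrite is_cvg_limn_esupE; [exact/cvg_lim|apply/cvg_ex; eexists; exact: ux].
Qed.

(** The integrand of the overview for [h = 1 / (k + 1)], with shift [c h] and already divided by
    [h]. *)
Definition layer a c (k : nat) x : R :=
  k.+1%:R * Num.max 0 (upper_envelope f k.+1%:R^-1 x - c / k.+1%:R - Num.max a (f x)).

Lemma measurable_envelope_sub c (k : nat) :
  measurable_fun setT (fun x => upper_envelope f k.+1%:R^-1 x - c / k.+1%:R).
Proof.
apply: measurable_funB; last exact: measurable_cst.
by apply: (measurable_upper_envelope n_gt0 L0 fL); rewrite invr_gt0.
Qed.

Lemma measurable_layer a c k : measurable_fun setT (layer a c k).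
Proof.
apply: measurable_funM; first exact: measurable_cst.
by apply: measurable_excess mf; exact: measurable_envelope_sub.
Qed.

Let k_ge0 (k : nat) : 0 <= k.+1%:R^-1 :> R. Proof. by rewrite invr_ge0. Qed.

Lemma integral_layer a c k : (\int[mu]_x (layer a c k x)%:E = (k.+1%:R)%:E *
  \int[mu]_x (Num.max 0 (upper_envelope f k.+1%:R^-1 x - c / k.+1%:R - Num.max a (f x)))%:E)%E.
Proof.
rewrite -ge0_integralZl; first by apply: eq_integral => x _; rewrite -EFinM.
- exact: measurableT.
- apply/measurable_EFinP; by apply: measurable_excess mf; exact: measurable_envelope_sub.
- by move=> x _; rewrite lee_fin le_max lexx.
- by rewrite lee_fin.
Qed.

Lemma layer_ge0 a c k x : 0 <= layer a c k x.
Proof. by rewrite mulr_ge0// le_max lexx. Qed.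

Lemma layer_le a c k x : 0 <= c -> layer a c k x <= L.
Proof.
move=> c0; rewrite /layer mulrC -ler_pdivlMr// ge_max divr_ge0//=.
have := upper_envelope_le L0 fL x (k_ge0 k).
have : 0 <= c / k.+1%:R by rewrite divr_ge0.
have : f x <= Num.max a (f x) by rewrite le_max lexx orbT.
move: (c / _) (L / _) (upper_envelope _ _ _) (Num.max _ _) => p q r s.
by move=> h1 h2 h3; lra.
Qed.

Lemma layer_eq0 a c k x : 0 <= c -> f x + L / k.+1%:R <= a -> layer a c k x = 0.
Proof.
move=> c0 fa; rewrite /layer max_l ?mulr0//.
have := upper_envelope_le L0 fL x (k_ge0 k).
have : 0 <= c / k.+1%:R by rewrite divr_ge0.
have : a <= Num.max a (f x) by rewrite le_max lexx.
move: fa; move: (c / _) (L / _) (upper_envelope _ _ _) (Num.max _ _) => p q r s fa.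
by move=> h1 h2 h3; lra.
Qed.

Lemma ex_divn_le (d : R) : 0 < d -> exists K, forall k, (K <= k)%N -> L / k.+1%:R <= d.
Proof.
move=> d0; have L1 : 0 < L + 1 by rewrite ltr_wpDl.
have [K Kd] := ex_invn_lt (divr_gt0 d0 L1).
exists K => k Kk; move: Kd; rewrite ltr_pdivlMr// mulrC => /ltW; apply: le_trans.
apply: ler_pM; rewrite ?invr_ge0 ?lerDl//.
by rewrite lef_pV2 ?posrE// ler_nat ltnS.
Qed.

Let cvg_max0 (u : nat -> R) (l : R) : u @ \oo --> l ->
  Num.max 0 (u k) @[k --> \oo] --> Num.max 0 l.
Proof.
move=> /cvgrPdist_le ul; apply/cvgrPdist_le => e e0.
apply: filterS (ul e e0) => k; rewrite !ler_norml => /andP[h1 h2].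
by case: (leP 0 l) => ?; case: (leP 0 (u k)) => ?; apply/andP; split; lra.
Qed.

(** Where [f x < a] the layers vanish eventually; where [a <= f x], equality included, the maximum
    with [a] is [f x] and the rate of the envelope remains. *)
Lemma layer_cvg a c : 0 <= c -> \forall x \ae mu, layer a c k x @[k --> \oo] -->
  (if a <= f x then Num.max 0 (enorm (gradient f x) - c) else 0).
Proof.
move=> c0; apply: filterS (upper_envelope_gradient_ae n_gt0 L0 fL) => x ux.
case: ifPn => [fa|]; last first.
  rewrite -ltNge -subr_gt0 => fa; have [K KL] := ex_divn_le fa.
  apply: cvg_near_cst; exists K => // k /= /KL; rewrite lerBrDl => h.
  exact: layer_eq0.
rewrite (_ : (fun k => _) = (fun k => Num.max 0
    (k.+1%:R * (upper_envelope f k.+1%:R^-1 x - f x) - c))).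
  by apply: cvg_max0; apply: cvgB ux _; exact: cvg_cst.
apply/funext => k; rewrite /layer (max_r fa) maxr_pMr// mulr0 !mulrBr; congr Num.max.
by rewrite mulrCA divff// mulr1; ring.
Qed.

Lemma integral_layer_cvg a c t : 0 <= c -> t < a -> (mu [set x | (t < f x)%R] < +oo)%E ->
  (\int[mu]_x (layer a c k x)%:E @[k --> \oo] -->
   \int[mu]_(x in [set x | (a <= f x)%R]) (Num.max 0 (enorm (gradient f x) - c))%:E)%E.
Proof.
(* Only from index [K] on are the layers supported in [{f > t}], hence dominated by [L] times its
   indicator; the sequence is shifted accordingly. *)
move=> c0; rewrite -subr_gt0 => ta foo; have [K KL] := ex_divn_le ta.
rewrite integral_mkcond/= -(cvg_shiftn K).
have mt : measurable [set x | t < f x].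
  by apply: measurable_open_rV => //; apply: open_superlevel; apply: elipschitz_continuous; exists L.
pose phi x : \bar R := (if a <= f x then Num.max 0 (enorm (gradient f x) - c) else 0)%:E.
rewrite (_ : (fun x => _) = phi); last first.
  apply/funext => x; rewrite /phi patchE; have [fa|fa] := boolP (a <= f x).
    by rewrite mem_set.
  by rewrite memNset//; exact/negP.
pose psi k x := (layer a c (k + K) x)%:E.
pose dom x := (L * \1_[set x | t < f x] x)%:E.
have mpsi k : measurable_fun setT (psi k) by apply/measurable_EFinP; exact: measurable_layer.
have mphi : measurable_fun setT phi.
  apply/measurable_EFinP; apply: measurable_fun_ifT; last exact: measurable_cst.
    exact: measurable_fun_ler.
  apply: measurable_maxr; first exact: measurable_cst.
  by apply: measurable_funB; [exact: measurable_norm_gradient|exact: measurable_cst].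
have cpsi : \forall x \ae mu, setT x -> psi ^~ x @ \oo --> phi x.
  apply: filterS (layer_cvg a c0) => x xc _; apply/cvg_EFin; first exact: nearW.
  by move: xc; rewrite -(cvg_shiftn K).
have idom : mu.-integrable setT dom.
  rewrite (_ : dom = fun x => (L%:E * (\1_[set x | t < f x] x)%:E)%E) //.
  apply: integrableZl => //; apply/integrableP; split.
    by apply/measurable_EFinP; exact: measurable_indic.
  rewrite (eq_integral (fun x => (\1_[set x | t < f x] x)%:E)) => [|x _].
    by rewrite integral_indic// setIT.
  by rewrite gee0_abs// lee_fin.
have ldom : \forall x \ae mu, forall k, setT x -> (`|psi k x| <= dom x)%E.
  apply: aeW => x k _; rewrite gee0_abs ?lee_fin ?layer_ge0// indicE.
  have [ft|ft] := ltP t (f x); first by rewrite mem_set// mulr1 layer_le.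
  rewrite memNset; last by apply/negP; rewrite -leNgt.
  rewrite mulr0 layer_eq0//; have := KL _ (leq_addl k K).
  by move: (L / _) => q ?; lra.
by have [_ _] := dominated_convergence measurableT mpsi mphi cpsi idom ldom.
Qed.

End envelope_limit.

(** * The inequality for hinges of the gradient norm *)

Section gradient_inequality.
Context {R : realType} {n : nat}.
Hypothesis n_gt0 : (0 < n)%N.
Local Notation mu := (@lebesgue_measure_rV R n).
Context (X : set ('rV[R]_n -> R)) (X_SV : X = spaceS \/ X = spaceV).
Context (T : ('rV[R]_n -> R) -> 'rV[R]_n -> R) (T_rearr : rearrangement X T).
Hypothesis T_smooth : smoothing T.
Context (f : 'rV[R]_n -> R) (Xf : X f) (f_lip : elipschitz f).
Context (g : 'rV[R]_n -> R) (g_lip : elipschitz g).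
Hypothesis Tfg : \forall x \ae mu, T f x = g x.

Lemma rearr_superlevel_measure t : mu [set x | t < g x] = mu [set x | t < f x].
Proof.
have [_ eq_m _] := T_rearr; rewrite -(eq_m f Xf t).
by apply/eqP; rewrite eq_le; apply/andP; split;
  rewrite -[X in (mu X <= _)%E]setIT -[X in (_ <= mu X)%E]setIT;
  apply: ess_subset_measure; apply: negligibleS Tfg => x [/= a b] e; apply: b; rewrite ?e// -e.
Qed.

(** At height [t] the layers of the two integrands are the differences of sets in
    [level_inequality], with shift [c / k.+1]. *)
Lemma le_integral_layer (Lf Lg : R) (Lf0 : 0 <= Lf) (Lg0 : 0 <= Lg)
    (fL : forall x y, `|f x - f y| <= Lf * enorm (x - y))
    (gL : forall x y, `|g x - g y| <= Lg * enorm (x - y)) a c k :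
  (ess_inf_rV f < a%:E)%E -> 0 <= c ->
  (\int[mu]_x (layer g a c k x)%:E <= \int[mu]_x (layer f a c k x)%:E)%E.
Proof.
move=> fa c0; rewrite (integral_layer n_gt0 Lg0 gL) (integral_layer n_gt0 Lf0 fL); apply: lee_wpmul2l; first by rewrite lee_fin.
have k0 : 0 < k.+1%:R^-1 :> R by rewrite invr_gt0.
apply: le_integral_layers.
- exact: (measurable_envelope_sub n_gt0 Lg0 gL).
- exact: (measurable_elipschitz n_gt0 gL).
- exact: (measurable_envelope_sub n_gt0 Lf0 fL).
- exact: (measurable_elipschitz n_gt0 fL).
move=> t at_.
have E (u : 'rV[R]_n -> R) (L : R) : 0 <= L -> (forall x y, `|u x - u y| <= L * enorm (x - y)) ->
    [set x | u x <= t < upper_envelope u k.+1%:R^-1 x - c / k.+1%:R] =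
    parallel_set [set x | t + c / k.+1%:R < u x] k.+1%:R^-1 `\` [set x | t < u x].
  move=> L0 uL; rewrite -(upper_envelope_superlevel L0 uL _ k0).
  apply/seteqP; split => x /=; rewrite ltrBrDr leNgt; first by move=> /andP[/negP].
  by move=> [-> /negP ->].
rewrite (E g _ Lg0 gL) (E f _ Lf0 fL).
apply: (level_inequality n_gt0 X_SV T_rearr T_smooth Xf f_lip g_lip Tfg) => //.
  by apply: lt_le_trans fa _; rewrite lee_fin.
by rewrite divr_ge0.
Qed.

Lemma le_integral_gradient a c : (ess_inf_rV f < a%:E)%E -> 0 <= c ->
  (\int[mu]_(x in [set x | (a <= g x)%R]) (Num.max 0 (enorm (gradient g x) - c))%:E <=
   \int[mu]_(x in [set x | (a <= f x)%R]) (Num.max 0 (enorm (gradient f x) - c))%:E)%E.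
Proof.
move=> fa c0; have [t /andP[ft]] := lte_real_between fa; rewrite lte_fin => ta.
have [Lf Lf0 fL] := elipschitz_ge0 f_lip; have [Lg Lg0 gL] := elipschitz_ge0 g_lip.
have foo := superlevel_finite X_SV Xf ft.
have goo : (mu [set x | (t < g x)%R] < +oo)%E by rewrite rearr_superlevel_measure.
apply: lee_cvg_to (integral_layer_cvg n_gt0 Lg0 gL c0 ta goo)
  (integral_layer_cvg n_gt0 Lf0 fL c0 ta foo) _.
by apply: nearW => k; exact: le_integral_layer fL gL _ _ _ fa c0.
Qed.

End gradient_inequality.

(** * Young functions *)

Section young.
Context {R : realType}.

(** The discrete form of writing a convex function as an integral of hinges against its second
    derivative: summing twice recovers the values. *)
Lemma sum_second_differences (a : nat -> R) (N : nat) : a 0%N = 0 ->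
  \sum_(j < N) (a j.+1 - 2 * a j + (if (j : nat) is i.+1 then a i else 0)) * (N%:R - j%:R) = a N.
Proof.
move=> a0; set b := fun j : nat => a j.+1 - 2 * a j + (if j is i.+1 then a i else 0).
have sb M : \sum_(j < M) b j = a M - (if M is i.+1 then a i else 0).
  elim: M => [|M IH]; first by rewrite big_ord0 a0 subrr.
  by rewrite big_ord_recr/= IH /b; case: M {IH} => [|M]; ring.
elim: N => [|N IH]; first by rewrite big_ord0 a0.
rewrite big_ord_recr/= (_ : N.+1%:R - N%:R = 1) ?mulr1; last by rewrite -natr1 addrAC subrr add0r.
rewrite (eq_bigr (fun j : 'I_N => b j * (N%:R - j%:R) + b j)) => [|j _]; last first.
  by rewrite -natr1 -[X in X * _ = _]/(b j); ring.
by rewrite big_split/= IH sb /b; case: N {IH} => [|N]; ring.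
Qed.

Context (Phi : R -> \bar R) (Phi_young : young_function Phi).

Lemma young_ge0 t : 0 <= t -> (0 <= Phi t)%E.
Proof. by case: Phi_young => + _ _ _; apply. Qed.

Lemma young0 : Phi 0 = 0%E.
Proof. by case: Phi_young. Qed.

Lemma le_young s t : 0 <= s -> s <= t -> (Phi s <= Phi t)%E.
Proof.
move=> s0; have [->|t0] := eqVneq t 0 => st.
  by rewrite (_ : s = 0)//; apply/eqP; rewrite eq_le st.
have {}t0 : 0 < t by rewrite lt_def t0 (le_trans s0).
have l01 : 0 <= s / t <= 1 by rewrite divr_ge0 ?(ltW t0)//= ler_pdivrMr// mul1r.
have [_ _ conv _] := Phi_young; have := conv t 0 (s / t) (ltW t0) (lexx 0) l01.
rewrite mulr0 addr0 divfK ?gt_eqF// young0 mule0 adde0 => /le_trans; apply.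
case/andP: l01 => l0 l1.
by rewrite -[leRHS]mul1e lee_wpmul2r ?lee_fin// young_ge0 ?(ltW t0).
Qed.

Context (delta : R) (delta0 : 0 < delta).
Local Notation phi j := (Phi (j%:R * delta)).

Let grid_ge0 (j : nat) : 0 <= j%:R * delta. Proof. by rewrite mulr_ge0// ltW. Qed.

Let le_phi (i j : nat) : (i <= j)%N -> (phi i <= phi j)%E.
Proof. by move=> ij; apply: le_young => //; rewrite ler_wpM2r ?(ltW delta0)// ler_nat. Qed.

Let phi_fin (i j : nat) : (i <= j)%N -> (phi j < +oo)%E -> phi i = (fine (phi i))%:E.
Proof.
move=> ij j_fin; rewrite fineK// ge0_fin_numE ?young_ge0//.
by apply: le_lt_trans j_fin; exact: le_phi.
Qed.

(** The value before index [0] counts as [0], so index [0] yields the first increment. *)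
Definition second_difference (j : nat) : R := fine (phi j.+1) - 2 * fine (phi j) +
  (if j is i.+1 then fine (phi i) else 0).

Lemma second_difference_ge0 j : (phi j.+1 < +oo)%E -> 0 <= second_difference j.
Proof.
move=> j_fin; rewrite /second_difference; case: j j_fin => [|j] j_fin.
  by rewrite mul0r young0/= mulr0 subr0 addr0 fine_ge0// young_ge0.
have [_ _ conv _] := Phi_young.
have h01 : 0 <= (2^-1 : R) <= 1 by rewrite invr_ge0 ler0n/= invf_le1// ler1n.
have := conv _ _ _ (grid_ge0 j.+2) (grid_ge0 j) h01.
rewrite (_ : _ * _ + _ = j.+1%:R * delta); last by rewrite -!natr1; field.
rewrite (@phi_fin j.+2 j.+2)// (@phi_fin j.+1 j.+2)// (@phi_fin j j.+2) ?leqW//.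
by rewrite -!EFinM -EFinD lee_fin/=; lra.
Qed.

(** An infinite coefficient reproduces a [Phi] that jumps to [+oo]; its product with a vanishing
    hinge is [0]. *)
Definition slope_jump (j : nat) : \bar R :=
  if phi j.+1 == +oo%E then +oo%E else (second_difference j / delta)%:E.

Lemma slope_jump_ge0 j : (0 <= slope_jump j)%E.
Proof.
rewrite /slope_jump; case: eqP => // /eqP; rewrite -ltey => j_fin.
by rewrite lee_fin divr_ge0 ?(ltW delta0)// second_difference_ge0.
Qed.

(* The piecewise affine interpolation of Phi at the multiples of delta, moved to
   the right by delta in order to lie below Phi. *)
Definition hinge_sum (M : nat) (t : R) : \bar R :=
  (\sum_(j < M) slope_jump j * (Num.max 0 (t - j.+1%:R * delta))%:E)%E.

Let hinge_ge0 j t : (0 <= slope_jump j * (Num.max 0 (t - j.+1%:R * delta))%:E)%E.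
Proof. by rewrite mule_ge0 ?slope_jump_ge0// lee_fin le_max lexx. Qed.

Lemma hinge_sum_ge0 M t : (0 <= hinge_sum M t)%E.
Proof. by apply: sume_ge0 => j _; exact: hinge_ge0. Qed.

Let sum_jumps N : (phi N < +oo)%E ->
  (\sum_(j < N) (second_difference j * (N%:R - j%:R))%:E)%E = phi N.
Proof.
move=> N_fin; rewrite sumEFin (phi_fin (leqnn N) N_fin); congr EFin.
apply: (@sum_second_differences (fun j => fine (phi j))).
by rewrite mul0r young0.
Qed.

(** For [N] the integer part of [t / delta], the hinges from index [N] on vanish and the earlier
    ones are at most [(N - j) * delta]; so the sum is at most [phi N]. *)
Lemma hinge_sum_le M t : 0 <= t -> (hinge_sum M t <= Phi t)%E.
Proof.
move=> t0; have [->|] := eqVneq (Phi t) +oo%E; first by rewrite leey.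
rewrite -ltey => t_fin.
have := truncn_itv (divr_ge0 t0 (ltW delta0)).
set N := Num.truncn _; rewrite ler_pdivlMr// ltr_pdivrMr// => /andP[Nt tN].
have N_fin : (phi N < +oo)%E by apply: le_lt_trans t_fin; exact: le_young.
apply: (@le_trans _ _ (phi N)); last exact: le_young.
apply: (@le_trans _ _ (hinge_sum (N + M) t)).
  apply: (@lee_sum_nneg_ord _ (fun j => slope_jump j * (Num.max 0 (t - j.+1%:R * delta))%:E)%E predT).
    by move=> j _; exact: hinge_ge0.
  exact: leq_addl.
rewrite /hinge_sum big_split_ord/= [X in (_ + X)%E]big1 ?adde0 => [|j _]; last first.
  rewrite max_l ?mule0// subr_le0 (le_trans (ltW tN))// ler_wpM2r ?(ltW delta0)//.
  by rewrite ler_nat ltnS leq_addr.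
rewrite -(sum_jumps N_fin); apply: lee_sum => j _.
have jN := ltn_ord j.
have j_fin : (phi j.+1 < +oo)%E by apply: le_lt_trans N_fin; exact: le_phi.
rewrite /slope_jump lt_eqF// -EFinM lee_fin -mulrA ler_wpM2l ?second_difference_ge0//.
rewrite mulrC ler_pdivrMr// ge_max; apply/andP; split.
  by rewrite mulr_ge0 ?(ltW delta0)// subr_ge0 ler_nat ltnW.
by rewrite mulrBl; move: tN; rewrite -!natr1 !mulrDl; lra.
Qed.

(** The hinges before [J] are at least [(J - j) * delta]. If [phi J] is infinite, the last of them
    is positive and has an infinite coefficient. *)
Lemma hinge_sum_ge J M t : (J <= M)%N -> J.+1%:R * delta <= t -> (phi J <= hinge_sum M t)%E.
Proof.
move=> JM Jt; apply: (@le_trans _ _ (hinge_sum J t)); last first.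
  apply: (@lee_sum_nneg_ord _ (fun j => slope_jump j * (Num.max 0 (t - j.+1%:R * delta))%:E)%E predT) => //.
have [J_oo|] := eqVneq (phi J) +oo%E; last first.
  rewrite -ltey => J_fin; rewrite -(sum_jumps J_fin); apply: lee_sum => j _.
  have jJ := ltn_ord j.
  have j_fin : (phi j.+1 < +oo)%E by apply: le_lt_trans J_fin; exact: le_phi.
  rewrite /slope_jump lt_eqF// -EFinM lee_fin -mulrA ler_wpM2l ?second_difference_ge0//.
  rewrite mulrC ler_pdivlMr// le_max; apply/orP; right.
  by rewrite mulrBl; move: Jt; rewrite -!natr1 !mulrDl; lra.
case: J Jt J_oo {JM} => [|J] Jt J_oo; first by move: J_oo; rewrite mul0r young0.
rewrite /hinge_sum big_ord_recr/= {2}/slope_jump J_oo eqxx gt0_mulye.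
  by rewrite addey// gt_eqF// (lt_le_trans (ltNyr 0))//; exact: hinge_sum_ge0.
rewrite lte_fin lt_max subr_gt0; apply/orP; right; apply: lt_le_trans Jt.
by rewrite ltr_pM2r// ltr_nat.
Qed.

End young.

Section young_limit.
Context {R : realType} (Phi : R -> \bar R) (Phi_young : young_function Phi).

(** With [(k + 1) ^ 2] hinges at distance [delta = 1 / (k + 1)] the range grows to infinity. The
    shift and the rounding cost [2 delta], so the sum lies between [Phi (t - 2 delta)] and [Phi t],
    and left continuity concludes. *)
Lemma hinge_sum_cvg t : 0 <= t ->
  hinge_sum Phi k.+1%:R^-1 (k.+1 ^ 2) t @[k --> \oo] --> Phi t.
Proof.
have d0 (k : nat) : 0 < k.+1%:R^-1 :> R by rewrite invr_gt0.
rewrite le_eqVlt => /predU1P[<-|t0].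
  apply: cvg_near_cst; apply: nearW => k; rewrite (young0 Phi_young).
  apply/eqP; rewrite eq_le hinge_sum_ge0// andbT -(young0 Phi_young).
  exact: hinge_sum_le.
have [_ _ _ left_cont] := Phi_young.
pose s (k : nat) := t - 2 / k.+1%:R.
have s_t : s @ \oo --> t^'-.
  move=> A /nbhs_ballP[e /= e0 eA].
  have e2 : 0 < e / 2 by rewrite divr_gt0.
  suff : \forall k \near \oo, A (s k) by [].
  near=> k.
  have ke : k.+1%:R^-1 < e / 2 by near: k; exact: near_infty_natSinv_lt (PosNum e2).
  have := d0 k => k0; apply: eA.
    by rewrite /ball/= /s opprB addrCA subrr addr0 gtr0_norm ?divr_gt0//; move: ke; move: (_^-1) => r ?; lra.
  by rewrite /s ltrBlDr ltrDl divr_gt0.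
apply: (@squeeze_cvge _ _ _ _ (Phi \o s) _ (cst (Phi t))); last exact: cvg_cst.
  have t2 : 0 < t / 2 by rewrite divr_gt0.
  near=> k.
  have kt : k.+1%:R^-1 < t / 2 by near: k; exact: near_infty_natSinv_lt (PosNum t2).
  have tk : t <= k.+1%:R.
    rewrite (le_trans (ltW (unstable.ltr_bound t)))// ler_nat; apply: leqW.
    by near: k; exact: nbhs_infty_ge.
  rewrite hinge_sum_le ?(ltW t0)// andbT.
  have x0 : 0 <= t * k.+1%:R by rewrite mulr_ge0// ltW.
  have /andP[] := truncn_itv x0; set N := Num.truncn _ => Nx xN.
  have kk : k.+1%:R * k.+1%:R^-1 = 1 :> R by rewrite divff.
  have k0 := d0 k.
  set K : R := k.+1%:R in kt tk x0 xN Nx kk k0 *; set r := K^-1 in kt kk k0 *.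
  have K0 : 0 < K by [].
  have x2 : 2 < t * K.
    have : K * r < K * (t / 2) by rewrite ltr_pM2l.
    by rewrite kk; move: (K) => a; lra.
  have tr : t = t * K * r by rewrite -mulrA kk mulr1.
  case: (N) Nx xN => [|M] Nx xN; first by move: xN; rewrite ltNge (le_trans _ (ltW x2))// ler1n.
  apply: (@le_trans _ _ (Phi (M%:R * r))).
    apply: (le_young Phi_young); rewrite /s /= -/K -/r; first by move: kt; move: (r) => a; lra.
    have : t * K * r < M.+2%:R * r by rewrite ltr_pM2r.
    by rewrite -tr -!natr1 !mulrDl; lra.
  apply: hinge_sum_ge => //.
    rewrite -(ler_nat R) natrX -/K (@le_trans _ _ (t * K))//.
      by apply: le_trans Nx; rewrite ler_nat.
    by rewrite expr2 ler_wpM2r ?(ltW K0).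
  by rewrite -/K -/r [leRHS]tr ler_wpM2r ?(ltW k0).
exact: cvg_comp s_t (left_cont t t0).
Unshelve. all: by end_near. Qed.

Let measurable_hinge d (V : measurableType d) (D : set V) (r : V -> R) c :
  measurable_fun D r -> measurable_fun D (fun x => (Num.max 0 (r x - c))%:E).
Proof.
move=> mr; apply/measurable_EFinP; apply: measurable_maxr; first exact: measurable_cst.
by apply: measurable_funB mr _; exact: measurable_cst.
Qed.

Let measurable_hinge_sum d (V : measurableType d) (D : set V) (r : V -> R) delta M :
  measurable_fun D r -> measurable_fun D (fun x => hinge_sum Phi delta M (r x)).
Proof.
move=> mr; apply: emeasurable_sum => j; apply: measurable_funeM; exact: measurable_hinge.
Qed.

Lemma measurable_young d (V : measurableType d) (D : set V) (r : V -> R) :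
  (forall x, 0 <= r x) -> measurable_fun D r -> measurable_fun D (fun x => Phi (r x)).
Proof.
move=> r0 mr; rewrite (_ : (fun x => _) = fun x => limn_esup
    (fun k => hinge_sum Phi k.+1%:R^-1 (k.+1 ^ 2) (r x))).
  by apply: measurable_fun_limn_esup => k; exact: measurable_hinge_sum.
by apply/funext => x; have [_ ->] := cvg_limn_einf_sup (hinge_sum_cvg (r0 x)).
Qed.

(** Hinge sums are compared term by term. Since they stay below [Phi], a limit is needed only on the
    left, where Fatou's lemma suffices. *)
Lemma le_integral_young d (V : measurableType d) (m : {measure set V -> \bar R})
    (A B : set V) (p q : V -> R) : measurable A -> measurable B ->
  measurable_fun A p -> measurable_fun B q ->
  (forall x, 0 <= p x) -> (forall x, 0 <= q x) ->
  (forall c, 0 <= c -> (\int[m]_(x in A) (Num.max 0 (p x - c))%:E <=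
                        \int[m]_(x in B) (Num.max 0 (q x - c))%:E)%E) ->
  (\int[m]_(x in A) Phi (p x) <= \int[m]_(x in B) Phi (q x))%E.
Proof.
move=> mA mB mp mq p0 q0 pq.
pose S (k : nat) := hinge_sum Phi k.+1%:R^-1 (k.+1 ^ 2).
have d0 (k : nat) : 0 < k.+1%:R^-1 :> R by rewrite invr_gt0.
have mS (D : set V) (r : V -> R) k : measurable_fun D r -> measurable_fun D (fun x => S k (r x)).
  exact: measurable_hinge_sum.
have intS (D : set V) (r : V -> R) k : measurable D -> measurable_fun D r ->
    (\int[m]_(x in D) S k (r x) = \sum_(j < (k.+1 ^ 2)%N) slope_jump Phi k.+1%:R^-1 j *
       \int[m]_(x in D) (Num.max 0 (r x - j.+1%:R * k.+1%:R^-1))%:E)%E.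
  move=> mD mr; rewrite ge0_integral_sum//; last 2 first.
  - by move=> j; apply: measurable_funeM; exact: measurable_hinge.
  - by move=> j x _; rewrite mule_ge0 ?slope_jump_ge0// lee_fin le_max lexx.
  apply: eq_bigr => j _; rewrite ge0_integralZl//.
  - exact: measurable_hinge.
  - by move=> x _; rewrite lee_fin le_max lexx.
  - exact: slope_jump_ge0.
have leS k : (\int[m]_(x in A) S k (p x) <= \int[m]_(x in B) S k (q x))%E.
  rewrite !intS//; apply: lee_sum => j _; apply: lee_wpmul2l; first exact: slope_jump_ge0.
  by apply: pq; rewrite mulr_ge0// ltW.
apply: (@le_trans _ _ (\int[m]_(x in A) limn_einf (fun k => S k (p x)))%E).
  rewrite (eq_integral (fun x => limn_einf (fun k => S k (p x))))// => x _.
  by have [->] := cvg_limn_einf_sup (hinge_sum_cvg (p0 x)).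
apply: (le_trans (fatou m mA _ _)) => [k|k x _|]; first exact: mS.
  by apply: hinge_sum_ge0.
rewrite limn_einf_lim; apply: lime_le; first exact: is_cvg_einfs.
apply: nearW => k; apply: (@le_trans _ _ (\int[m]_(x in A) S k (p x))%E).
  by apply: ereal_inf_lbound; exists k => /=.
apply: (le_trans (leS k)); apply: ge0_le_integral => //; last by move=> x _; exact: hinge_sum_le.
- by move=> x _; exact: hinge_sum_ge0.
- exact: mS.
- exact: measurable_young.
Qed.

End young_limit.

Lemma ereal_approach_above (R : realType) (m : \bar R) : (m < +oo)%E ->
  exists a : nat -> R, [/\ forall k, (m < (a k)%:E)%E, {homo a : i j / (i <= j)%N >-> j <= i} &
    forall y : R, (m < y%:E)%E -> exists k, a k <= y].
Proof.
case: m => [m _| //|_].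
  exists (fun k => m + k.+1%:R^-1); split => [k|i j ij|y].
  - by rewrite lte_fin ltrDl invr_gt0.
  - by rewrite lerD2l lef_pV2 ?posrE// ler_nat ltnS.
  rewrite lte_fin -subr_gt0 => /ex_invn_lt[k ky]; exists k.
  by rewrite -lerBrDl ltW.
exists (fun k => - k%:R); split => [k|i j ij|y _]; first exact: ltNyr.
  by rewrite lerN2 ler_nat.
by exists (Num.bound (- y)); rewrite lerNl ltW// unstable.ltr_bound.
Qed.

(** * The inequalities on superlevel sets and on the whole space *)

Section conclusion.
Context {R : realType} {n : nat}.
Hypothesis n_gt0 : (0 < n)%N.
Local Notation mu := (@lebesgue_measure_rV R n).

(** At a minimum the increments for [h] and [- h] are both nonnegative, which forces each existing
    partial derivative to vanish. *)
Lemma gradient_minimum_ae (g : 'rV[R]_n -> R) (m : \bar R) : elipschitz g ->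
  (forall x, (m <= (g x)%:E)%E) -> \forall x \ae mu, ((g x)%:E <= m)%E -> gradient g x = 0.
Proof.
move=> /elipschitz_ge0[L L0 gL] mg.
apply: filterS (ae_forall_countable (fun i : 'I_n => derivable_ae n_gt0 L0 gL (delta_mx 0 i))) => x dg gm.
have minx y : g x <= g y by rewrite -lee_fin (le_trans gm).
apply/rowP => i; rewrite !mxE; set v := delta_mx 0 i; set l := 'D_v g x.
have gl := derivable_has_dderiv (dg i).
apply/eqP; rewrite -normr_le0; apply/ler_addgt0Pl => e e0; rewrite addr0.
have [d d0 gd] := gl e e0.
have d2 : 0 < d / 2 by rewrite divr_gt0.
have d2d : d / 2 < d by rewrite ltr_pdivrMr// ltr_pMr// ltr1n.
rewrite -(ler_pM2r d2) -[X in `|l| * X](gtr0_norm d2) -normrM.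
have := gd (d / 2); rewrite (gtr0_norm d2) => /(_ d2d).
have := gd (- (d / 2)); rewrite normrN (gtr0_norm d2) => /(_ d2d).
have := minx (x + (d / 2) *: v); have := minx (x + (- (d / 2)) *: v).
rewrite -/v -/l !ler_norml.
move: (d / 2) (g (x + _ *: v)) (g (x + _ *: v)) (g x) => r a b c h1 h2 /andP[h3 h4] /andP[h5 h6].
by apply/andP; split; lra.
Qed.

Context (X : set ('rV[R]_n -> R)) (X_SV : X = spaceS \/ X = spaceV).
Context (T : ('rV[R]_n -> R) -> 'rV[R]_n -> R) (T_rearr : rearrangement X T).
Context (Phi : R -> \bar R) (Phi_young : young_function Phi).
Hypothesis T_smooth : smoothing T.
Context (f : 'rV[R]_n -> R) (Xf : X f) (f_lip : elipschitz f).
Context (g : 'rV[R]_n -> R) (g_lip : elipschitz g).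
Hypothesis Tfg : \forall x \ae mu, T f x = g x.

Let mlevel (u : 'rV[R]_n -> R) (a : R) : measurable_fun setT u -> measurable [set x | a <= u x].
Proof.
move=> mu'; rewrite (_ : [set x | a <= u x] = setT `&` [set x | cst a x <= u x]).
  by apply: measurable_fun_le => //; exact: measurable_cst.
by rewrite setTI.
Qed.

Let mlip (u : 'rV[R]_n -> R) : elipschitz u -> measurable_fun setT u.
Proof. by move=> [L uL]; exact: (measurable_elipschitz n_gt0 uL). Qed.

Let Phi_ge0 (u : 'rV[R]_n -> R) x : (0 <= Phi (enorm (gradient u x)))%E.
Proof. by apply: young_ge0 => //; exact: enorm_ge0. Qed.

Let mnorm (u : 'rV[R]_n -> R) : elipschitz u -> measurable_fun setT (fun x => enorm (gradient u x)).
Proof. by move=> /elipschitz_ge0[L L0 uL]; exact: (measurable_norm_gradient n_gt0 L0 uL). Qed.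

Let mPhi (u : 'rV[R]_n -> R) : elipschitz u ->
  measurable_fun setT (fun x => Phi (enorm (gradient u x))).
Proof. by move=> /mnorm; apply: measurable_young => // x; exact: enorm_ge0. Qed.

Let le_integral_level (a : R) : (ess_inf_rV f < a%:E)%E ->
  (\int[mu]_(x in [set x | (a <= g x)%R]) Phi (enorm (gradient g x)) <=
   \int[mu]_(x in [set x | (a <= f x)%R]) Phi (enorm (gradient f x)))%E.
Proof.
move=> fa; apply: (le_integral_young Phi_young).
- by apply: mlevel; exact: mlip.
- by apply: mlevel; exact: mlip.
- by apply: measurable_funTS; exact: mnorm.
- by apply: measurable_funTS; exact: mnorm.
- by move=> x; exact: enorm_ge0.
- by move=> x; exact: enorm_ge0.
- move=> c c0.
  exact: (le_integral_gradient n_gt0 X_SV T_rearr T_smooth Xf f_lip g_lip Tfg).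
Qed.

Lemma polya_szego_level (a : R) : (ess_inf_rV f < a%:E)%E ->
  (\int[mu]_(x in [set x | (a <= T f x)%R]) Phi (enorm (gradient g x)) <=
   \int[mu]_(x in [set x | (a <= f x)%R]) Phi (enorm (gradient f x)))%E.
Proof.
move=> fa; apply: le_trans (le_integral_level fa).
have [XT _ _] := T_rearr.
have mTf : measurable_fun setT (T f) by move: (XT f Xf); case: X_SV => -> [].
rewrite integral_mkcond [leRHS]integral_mkcond le_eqVlt; apply/orP; left; apply/eqP.
have mPhig D : measurable D -> measurable_fun setT ((fun x => Phi (enorm (gradient g x))) \_ D).
  by move=> mD; apply: (measurable_restrictT _ mD).1; apply: measurable_funTS; exact: mPhi.
apply: ge0_ae_eq_integral => //.
- by apply: mPhig; exact: mlevel.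
- by apply: mPhig; apply: mlevel; exact: mlip.
- by move=> x _; apply: erestrict_ge0.
- by move=> x _; apply: erestrict_ge0.
- apply: filterS Tfg => x Tg _; rewrite !patchE.
  by congr (if _ then _ else _); apply/idP/idP; rewrite !inE/= Tg.
Qed.

Lemma polya_szego : (\int[mu]_x Phi (enorm (gradient g x)) <=
  \int[mu]_x Phi (enorm (gradient f x)))%E.
Proof.
(* By continuity of [g] the bound holds at every point, so [ess_inf_rV f] is attained by [g] only at
   minima. *)
have mg x : (ess_inf_rV f <= (g x)%:E)%E.
  apply: (le_trans (le_ess_inf_rearr n_gt0 X_SV T_rearr Xf)).
  rewrite /ess_inf_rV (eq_ess_inf (g := EFin \o g)).
    by apply: ess_inf_le_continuous => //; exact: elipschitz_continuous.
  by apply: filterS Tfg => y /= ->.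
have moo : (ess_inf_rV f < +oo)%E by rewrite (le_lt_trans (mg 0))// ltry.
have [a [ma a_decr a_m]] := ereal_approach_above moo.
pose F k := [set x | a k <= g x].
have mF k : measurable (F k) by apply: mlevel; exact: mlip.
have Phi_grad : \forall x \ae mu, setT x ->
    Phi (enorm (gradient g x)) = ((fun x => Phi (enorm (gradient g x))) \_ (\bigcup_k F k)) x.
  apply: filterS (gradient_minimum_ae g_lip mg) => x gx _; rewrite patchE.
  case: ifPn => //; rewrite notin_setE => nF; rewrite gx ?enorm0 ?young0//.
  by rewrite leNgt; apply/negP => /a_m[k ak]; apply: nF; exists k.
rewrite (ge0_ae_eq_integral measurableT (mPhi g_lip) _ _ _ Phi_grad)//; last first.
- by move=> x _; apply: erestrict_ge0.
- apply: (measurable_restrictT _ _).1; first by apply: bigcup_measurable => k _; exact: mF.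
  by apply: measurable_funTS; exact: mPhi.
rewrite -integral_mkcond.
have := @ge0_nondecreasing_set_cvg_integral _ _ _ F (fun x => Phi (enorm (gradient g x))) mu.
have incF : {homo F : i j / (i <= j)%N >-> (i <= j)%O}.
  by move=> i j ij; apply/subsetPset => x; apply: le_trans; exact: a_decr.
move=> /(_ incF mF (fun k => measurable_funTS (mPhi g_lip)) (fun k x _ => Phi_ge0 g x)) cF.
apply: (cvge_to_le cF); apply: nearW => k; apply: (le_trans (le_integral_level (ma k))).
apply: ge0_subset_integral => //; first by apply: mlevel; exact: mlip.
exact: mPhi.
Qed.

End conclusion.

(** Lipschitz representatives of [T f] coincide by continuity; quantifying over all of them
    expresses the gradient of [T f] without a choice. *)
Theorem theorem5p8 (R : realType) (n : nat) (n_ge2 : (2 <= n)%N)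
    (X : set ('rV[R]_n -> R)) (X_SV : X = spaceS \/ X = spaceV)
    (T : ('rV[R]_n -> R) -> 'rV[R]_n -> R) (T_rearr : rearrangement X T)
    (Phi : R -> \bar R) (Phi_young : young_function Phi)
    (T_smooth : smoothing T)
    (f : 'rV[R]_n -> R) (Xf : X f) (f_lip : elipschitz f) :
  (exists g : 'rV[R]_n -> R,
    elipschitz g /\ \forall x \ae lebesgue_measure_rV, T f x = g x) /\
  (forall g : 'rV[R]_n -> R, elipschitz g ->
    (\forall x \ae lebesgue_measure_rV, T f x = g x) ->
    (forall a : R, (ess_inf_rV f < a%:E)%E ->
      (\int[lebesgue_measure_rV]_(x in [set x | (a <= T f x)%R])
          Phi (enorm (gradient g x)) <=
       \int[lebesgue_measure_rV]_(x in [set x | (a <= f x)%R])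
          Phi (enorm (gradient f x)))%E) /\
    (\int[lebesgue_measure_rV]_x Phi (enorm (gradient g x)) <=
     \int[lebesgue_measure_rV]_x Phi (enorm (gradient f x)))%E).
Proof.
have n_gt0 : (0 < n)%N by exact: ltnW.
split.
  have [L L0 fL] := elipschitz_ge0 f_lip.
  exact: (lipschitz_rearr n_gt0 X_SV T_rearr T_smooth Xf f_lip L0 fL).
move=> g g_lip Tfg; split=> [a fa|].
  exact: (polya_szego_level n_gt0 X_SV T_rearr Phi_young T_smooth Xf f_lip g_lip Tfg fa).
exact: (polya_szego n_gt0 X_SV T_rearr Phi_young T_smooth Xf f_lip g_lip Tfg).
Qed.
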